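(* Let $a<b$ be real numbers, let $R>0$, and let $F$ be analytic in the rectangular region $(a,b)\times(0,R)=\{x+iy\in\mathbb{C}: a<x<b,\ 0<y<R\}$. Suppose that $f(x)=\lim_{y\to0^{+}}F(x+iy)$ in $\mathcal{D}'(a,b)$, that $x_{0}\in(a,b)$, that $f$ is a bounded function near $x_{0}$, and that the following average lateral limit exists: $$\lim_{x\to x_{0}^{+}}\frac{1}{x-x_{0}}\int_{x_{0}}^{x}f(t)\,\mathrm{d}t=\gamma .$$ Then $$\lim_{z\to x_{0}}F(z)=\gamma\quad\text{(angularly)}.$$
   Context: The equality $f(x)=\lim_{y\to0^{+}}F(x+iy)$ in $\mathcal{D}'(a,b)$ means that $\langle f,\phi\rangle=\lim_{y\to0^{+}}\int_{a}^{b}F(x+iy)\phi(x)\,\mathrm{d}x$ for every $\phi\in\mathcal{D}(a,b)$ (the smooth functions with compact support in $(a,b)$). ''$f$ is a bounded function near $x_{0}$'' means that the restriction of the distribution $f$ to some open neighborhood of $x_0$ is given by an $L^{\infty}$ function. Here $\gamma\in\mathbb{C}$. ''$F(z)\to\gamma$ angularly as $z\to x_{0}$'' (non-tangentially) means: for every $\theta\in(0,\pi/2)$, $F(z)\to\gamma$ as $z\to x_{0}$ with $z$ restricted to the sector $\theta\le\arg(z-x_{0})\le\pi-\theta$. *)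

(* Defs.v *)
From mathcomp Require Export all_boot all_order all_algebra.
From mathcomp Require Export all_classical all_reals all_analysis.
From mathcomp Require Export complex.

Set Implicit Arguments.
Unset Strict Implicit.
Unset Printing Implicit Defensive.

Import Order.TTheory GRing.Theory Num.Theory.
Import numFieldNormedType.Exports.

Local Open Scope classical_set_scope.
Local Open Scope ring_scope.
Local Open Scope complex_scope.

(* The regular algebra [R[i]^o] carries the topology of the complex modulus and
   is a normed module over the field [R[i]] itself, so that [derivable] below is
   complex differentiability. *)
Notation Cplx R := (R[i]^o).

Definition rectangle (R : realType) (a b h : R) : set (Cplx R) :=
  [set z | a < complex.Re z < b /\ 0 < complex.Im z < h].

Definition analytic_on (R : realType) (D : set (Cplx R)) (F : Cplx R -> Cplx R)
    : Prop :=
  forall z, D z -> derivable F z 1.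

(* A real integral of a non-integrable function has a junk value; below, the
   integrands are bounded and measurable on a bounded set (for the boundary
   value, as soon as the horizontal line lies in the rectangle). *)
Definition cintegral (R : realType) (A : set R) (g : R -> Cplx R) : Cplx R :=
  (\int[@lebesgue_measure R]_(x in A) complex.Re (g x)) +i*
  (\int[@lebesgue_measure R]_(x in A) complex.Im (g x)).

Definition smooth (R : realType) (p : R -> Cplx R) : Prop :=
  forall (n : nat) (x : R),
    derivable (derive1n n (fun t : R => complex.Re (p t))) x 1 /\
    derivable (derive1n n (fun t : R => complex.Im (p t))) x 1.

Definition cderive1n (R : realType) (n : nat) (p : R -> Cplx R) (x : R)
    : Cplx R :=
  (derive1n n (fun t : R => complex.Re (p t)) x) +i* (derive1n n (fun t : R => complex.Im (p t)) x).

Definition fsupport (R : realType) (p : R -> Cplx R) : set R :=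
  closure [set x | p x != 0].

(* The space D(U), its elements being extended by zero to the whole line. *)
Definition test_function (R : realType) (U : set R) (p : R -> Cplx R) : Prop :=
  [/\ smooth p, compact (fsupport p) & fsupport p `<=` U].

(* The space D'(U): a functional is a total function, of which only the values
   on D(U) matter; continuity is expressed by the usual seminorm estimates on
   each compact subset of U. *)
Definition distribution (R : realType) (U : set R)
    (f : (R -> Cplx R) -> Cplx R) : Prop :=
  (forall (c : Cplx R) (p q : R -> Cplx R),
     test_function U p -> test_function U q ->
     f (fun x => c * p x + q x) = c * f p + f q) /\
  (forall K : set R, compact K -> K `<=` U ->
     exists (N : nat) (M : R), forall p : R -> Cplx R,
       test_function U p -> fsupport p `<=` K ->
       Normc.normc (f p) <=
         M * \sum_(k < N.+1) sup (range (fun x => Normc.normc (cderive1n k p x)))).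

Definition distributional_boundary_value (R : realType) (a b : R)
    (F : Cplx R -> Cplx R) (f : (R -> Cplx R) -> Cplx R) : Prop :=
  forall p : R -> Cplx R, test_function `]a, b[ p ->
    cintegral `]a, b[ (fun x => F (x +i* y) * p x) @[y --> 0^'+] --> f p.

Definition Linfty (R : realType) (U : set R) (g : R -> Cplx R) : Prop :=
  [/\ measurable_fun U (fun x => complex.Re (g x)),
      measurable_fun U (fun x => complex.Im (g x)) &
      exists M : R,
        {ae @lebesgue_measure R, forall x, U x -> Normc.normc (g x) <= M}].

Definition restriction_given_by (R : realType)
    (f : (R -> Cplx R) -> Cplx R) (U : set R) (g : R -> Cplx R) : Prop :=
  forall p : R -> Cplx R, test_function U p ->
    f p = cintegral U (fun x => g x * p x).

(* [theta <= arg (z - x0) <= pi - theta], written in polar coordinates. *)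
Definition sector (R : realType) (x0 theta : R) : set (Cplx R) :=
  [set z | exists rho t : R, [/\ 0 < rho, theta <= t <= pi - theta &
     z = (x0 + rho * cos t) +i* (rho * sin t)]].

Definition angular_limit (R : realType) (F : Cplx R -> Cplx R) (x0 : R)
    (gamma : Cplx R) : Prop :=
  forall theta : R, 0 < theta < pi / 2 ->
    F z @[z --> within (sector x0 theta) (nbhs (x0%:C : Cplx R))] --> gamma.

(* Main.v *)
Require Import Defs.
From mathcomp Require Import measurable_realfun ring lra.
Import Order.TTheory GRing.Theory Num.Theory.
Import numFieldNormedType.Exports.
Local Open Scope classical_set_scope.
Local Open Scope ring_scope.
Local Open Scope complex_scope.
Set Implicit Arguments. Unset Strict Implicit. Unset Printing Implicit Defensive.

(** Subtracting a constant from [F], take [gamma = 0], and let [g] be the bounded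
    function which is the boundary value near [x0]. For [z = x + iy], Cauchy's
    formula expresses [F z] through the integral over the boundary of [F] against
    the difference of the Cauchy kernels at [z] and at its conjugate, which on the
    real line is a multiple of the Poisson kernel. The same is true for [F] multiplied by a power
    of a Moebius map [mob] whose pole lies below the real line, and on the real
    line only [g] enters: up to the factor [y],
    [F z * mob z ^+ n] is bounded by the integral of [mob ^+ n * g] against
    [2 / |u - z| ^+ 2] and a constant due to the rest of the contour
    ([poisson_ineq]).

    The freedom in [mob] makes a one-sided hypothesis sufficient. At the scale
    [r = |z - x0|] the zero and the pole of [mob] are mirror images in a line
    through [x0] which passes below the sector and above the half-line to the
    left of [x0]. So [|mob| >= 1] at [z], while on the left [|mob| <= 1],
    with a bound smaller than 1 on compact parts of the open half-line. On the
    left, where [g] is merely bounded, the integral is small once [n] is large,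
    except close to [x0], which carries little mass, and far away, where the kernel
    decays like [u ^- 2] ([left_piece]). On the right, for this [n], the kernel is
    Lipschitz at the scale [r] and the averages of [g] over [[x0, t]] tend to 0,
    so the integral is small for small [r] ([right_piece]). This gives
    [sector_limit].

    It remains to bound the rest of the contour, although nothing is known about
    the growth of [F] at the boundary. Instead of a contour a smooth cutoff [chi]
    is used. For [H w = F w * kernel w], the integral of [chi u * H (u + iv)] over
    [u] changes with [v] at a rate given by the integral of [chi' u * H (u + iv)]
    ([slide], from Goursat's theorem), and jumps when [v] crosses the height of
    the pole [z] ([jump]). As [chi'] vanishes near [x0], the functions [chi'] times
    kernel, for [z] near [x0], form a bounded family of test functions. Their
    integrals against [F] on a horizontal line converge as the line
    approaches the boundary, hence are bounded uniformly in the family and in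
    the height, if this is small, by the uniform boundedness principle ([uniform_boundedness],
    proved by a gliding hump). *)

Notation normc := Normc.normc.
Arguments Normc.normc : simpl never.

(** * Moduli and components of complex numbers *)

Section Norm.
Variable R : realType.
Local Notation C := R[i].
Implicit Types z w : C.

Lemma normcE2 z : normc z = Num.sqrt (complex.Re z ^+ 2 + complex.Im z ^+ 2).
Proof. by case: z. Qed.

Lemma normc_ge0 z : 0 <= normc z.
Proof. by case: z => a b; exact: sqrtr_ge0. Qed.

Lemma sqr_normcE z : normc z ^+ 2 = complex.Re z ^+ 2 + complex.Im z ^+ 2.
Proof. by rewrite normcE2 sqr_sqrtr// addr_ge0// sqr_ge0. Qed.

Lemma Re_le_normc z : `|complex.Re z| <= normc z.
Proof.
rewrite -(ler_pXn2r (ltn0Sn 1)) ?nnegrE ?normc_ge0 ?normr_ge0//.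
by rewrite sqr_normcE real_normK ?num_real// lerDl sqr_ge0.
Qed.

Lemma Im_le_normc z : `|complex.Im z| <= normc z.
Proof.
rewrite -(ler_pXn2r (ltn0Sn 1)) ?nnegrE ?normc_ge0 ?normr_ge0//.
by rewrite sqr_normcE [X in X <= _]real_normK ?num_real// lerDr sqr_ge0.
Qed.

Lemma normc_le_ReIm z : normc z <= `|complex.Re z| + `|complex.Im z|.
Proof.
rewrite -(ler_pXn2r (ltn0Sn 1)) ?nnegrE ?normc_ge0 ?addr_ge0//.
rewrite sqr_normcE sqrrD !real_normK ?num_real//.
have : 0 <= `|complex.Re z| * `|complex.Im z| by rewrite mulr_ge0.
lra.
Qed.

Lemma normcD z w : normc (z + w) <= normc z + normc w.
Proof. exact: le_normcD. Qed.

Lemma normcNE z : normc (- z) = normc z.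
Proof. exact: normcN. Qed.

Lemma normcBC z w : normc (z - w) = normc (w - z).
Proof. by rewrite -normcNE opprB. Qed.

Lemma normcB z w : normc (z - w) <= normc z + normc w.
Proof. by rewrite -(normcNE w); exact: normcD. Qed.

Lemma normcB_ge z w : normc z - normc w <= normc (z - w).
Proof. by have := normcD (z - w) w; rewrite subrK; lra. Qed.

Lemma normc_eq0P z : normc z = 0 <-> z = 0.
Proof.
split; first exact: Normc.eq0_normc.
by move=> ->; exact: Normc.normc0.
Qed.

Lemma normc_gt0 z : (0 < normc z) = (z != 0).
Proof.
rewrite lt_neqAle normc_ge0 andbT eq_sym; congr (~~ _).
by apply/eqP/eqP => /normc_eq0P.
Qed.

Lemma normcX z n : normc (z ^+ n) = normc z ^+ n.
Proof.
by elim: n => [|n IH]; rewrite ?expr0 ?Normc.normc1// !exprS Normc.normcM IH.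
Qed.

Lemma normc_real (x : R) : normc x%:C = `|x|.
Proof. by rewrite normcE2 /= expr0n addr0 sqrtr_sqr. Qed.

Lemma normc_i : normc ('i : C) = 1.
Proof. by rewrite normcE2 /= expr0n expr1n add0r sqrtr1. Qed.

Lemma cReD z w : complex.Re (z + w) = complex.Re z + complex.Re w.
Proof. by case: z; case: w. Qed.
Lemma cImD z w : complex.Im (z + w) = complex.Im z + complex.Im w.
Proof. by case: z; case: w. Qed.
Lemma cReN z : complex.Re (- z) = - complex.Re z.
Proof. by case: z. Qed.
Lemma cImN z : complex.Im (- z) = - complex.Im z.
Proof. by case: z. Qed.
Lemma cReM z w :
  complex.Re (z * w) = complex.Re z * complex.Re w - complex.Im z * complex.Im w.
Proof. by case: z; case: w. Qed.
Lemma cImM z w :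
  complex.Im (z * w) = complex.Re z * complex.Im w + complex.Im z * complex.Re w.
Proof. by case: z; case: w. Qed.
Lemma cReV z :
  complex.Re z^-1 = complex.Re z * (complex.Re z ^+ 2 + complex.Im z ^+ 2)^-1.
Proof. by case: z. Qed.
Lemma cImV z :
  complex.Im z^-1 = - complex.Im z * (complex.Re z ^+ 2 + complex.Im z ^+ 2)^-1.
Proof. by case: z => a b /=; rewrite mulNr. Qed.

Lemma eq_ReIm z w : complex.Re z = complex.Re w ->
  complex.Im z = complex.Im w -> z = w.
Proof. by case: z; case: w => ? ? ? ? /= -> ->. Qed.

Lemma realcD (x y : R) : x%:C + y%:C = (x + y)%:C :> C.
Proof. by apply: eq_ReIm => /=; rewrite ?addr0. Qed.
Lemma realcB (x y : R) : x%:C - y%:C = (x - y)%:C :> C.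
Proof. by apply: eq_ReIm => /=; rewrite ?subr0. Qed.
Lemma realcM (x y : R) : x%:C * y%:C = (x * y)%:C :> C.
Proof. by apply: eq_ReIm => /=; lra. Qed.

End Norm.

(** * Bisection *)

Section Bisection.
Variable R : realType.

Lemma nested_point (s t : nat -> R) :
  (forall k, s k <= s k.+1) -> (forall k, t k.+1 <= t k) ->
  (forall k, s k <= t k) -> exists X, forall k, s k <= X <= t k.
Proof.
move=> s_inc t_dec st.
have homs : {homo s : i j / (i <= j)%N >-> i <= j} by exact/nondecreasing_seqP.
have homt : {homo t : i j / (i <= j)%N >-> j <= i} by exact/nonincreasing_seqP.
have ub m : ubound (range s) (t m).
  move=> _ [k _ <-]; have [km|mk] := leqP k m.
    exact: le_trans (homs _ _ km) (st _).
  exact: le_trans (st _) (homt _ _ (ltnW mk)).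
have ne : range s !=set0 by exists (s 0%N), 0%N.
exists (sup (range s)) => k; apply/andP; split.
  by apply: ub_le_sup; [exists (t 0%N)|exists k].
exact: ge_sup.
Qed.

Lemma halving_small (L e : R) : 0 < e -> exists k, L / 2 ^+ k < e.
Proof.
move=> e0; exists (Num.truncn (L / e)).+1.
rewrite ltr_pdivrMr ?exprn_gt0// mulrC -ltr_pdivrMr//.
apply: (lt_le_trans (truncnS_gt _)).
by rewrite -natrX ler_nat; exact/ltnW/ltn_expl.
Qed.

Definition bisect_refine (Q Q' : R * R * (R * R)) : Prop :=
  [/\ Q.1.1 <= Q'.1.1, Q'.1.2 <= Q.1.2, Q'.1.2 - Q'.1.1 = (Q.1.2 - Q.1.1) / 2 &
   [/\ Q.2.1 <= Q'.2.1, Q'.2.2 <= Q.2.2 & Q'.2.2 - Q'.2.1 = (Q.2.2 - Q.2.1) / 2]].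

(** Induction over rectangles: a property which is inherited from the four quarters
    of a rectangle and which holds for all small rectangles about each point holds
    for the whole rectangle. Otherwise it fails for a nested sequence of quarters,
    and these shrink to a point. *)
Lemma bisect2 (P : R -> R -> R -> R -> Prop) a b c d : a <= b -> c <= d ->
  (forall x1 x2 y1 y2, a <= x1 -> x1 <= x2 -> x2 <= b ->
     c <= y1 -> y1 <= y2 -> y2 <= d ->
     P x1 ((x1 + x2) / 2) y1 ((y1 + y2) / 2) ->
     P ((x1 + x2) / 2) x2 y1 ((y1 + y2) / 2) ->
     P x1 ((x1 + x2) / 2) ((y1 + y2) / 2) y2 ->
     P ((x1 + x2) / 2) x2 ((y1 + y2) / 2) y2 -> P x1 x2 y1 y2) ->
  (forall x y, a <= x <= b -> c <= y <= d -> exists2 e, 0 < e &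
     forall x1 x2 y1 y2, a <= x1 -> x1 <= x <= x2 -> x2 <= b ->
       c <= y1 -> y1 <= y <= y2 -> y2 <= d -> x2 - x1 < e -> y2 - y1 < e ->
       P x1 x2 y1 y2) ->
  P a b c d.
Proof.
move=> ab cd glue loc; apply: contrapT => nP.
pose inv (Q : R * R * (R * R)) :=
  [/\ a <= Q.1.1, Q.1.1 <= Q.1.2, Q.1.2 <= b &
   [/\ c <= Q.2.1, Q.2.1 <= Q.2.2, Q.2.2 <= d & ~ P Q.1.1 Q.1.2 Q.2.1 Q.2.2]].
pose T := {Q | inv Q}.
have step (Q : T) : exists Q' : T, bisect_refine (sval Q) (sval Q').
  case: Q => -[[x1 x2] [y1 y2]] [/= ax xx xb [cy yy yd nPQ]].
  apply: contrapT => nex; apply: nPQ; apply: glue => //.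
  - apply: contrapT => nQ; apply: nex.
    have iQ : inv (x1, (x1 + x2) / 2, (y1, (y1 + y2) / 2)).
      by split => //=; try lra; split => //=; lra.
    by exists (exist _ _ iQ); split => /=; try lra; split; lra.
  - apply: contrapT => nQ; apply: nex.
    have iQ : inv ((x1 + x2) / 2, x2, (y1, (y1 + y2) / 2)).
      by split => //=; try lra; split => //=; lra.
    by exists (exist _ _ iQ); split => /=; try lra; split; lra.
  - apply: contrapT => nQ; apply: nex.
    have iQ : inv (x1, (x1 + x2) / 2, ((y1 + y2) / 2, y2)).
      by split => //=; try lra; split => //=; lra.
    by exists (exist _ _ iQ); split => /=; try lra; split; lra.
  - apply: contrapT => nQ; apply: nex.
    have iQ : inv ((x1 + x2) / 2, x2, ((y1 + y2) / 2, y2)).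
      by split => //=; try lra; split => //=; lra.
    by exists (exist _ _ iQ); split => /=; try lra; split; lra.
have [nxt nxtP] := choice step.
have i0 : inv (a, b, (c, d)) by [].
pose S k : T := iter k nxt (exist _ _ i0).
pose x1 k := (sval (S k)).1.1; pose x2 k := (sval (S k)).1.2.
pose y1 k := (sval (S k)).2.1; pose y2 k := (sval (S k)).2.2.
have inS k : inv (sval (S k)) by case: (S k).
have refS k : bisect_refine (sval (S k)) (sval (S k.+1)) by exact: nxtP.
have szx k : x2 k - x1 k = (b - a) / 2 ^+ k.
  elim: k => [|k IH]; first by rewrite expr0 divr1.
  have [_ _ -> _] := refS k; rewrite -/(x2 k) -/(x1 k) IH exprSr invfM mulrA.
  by [].
have szy k : y2 k - y1 k = (d - c) / 2 ^+ k.
  elim: k => [|k IH]; first by rewrite expr0 divr1.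
  have [_ _ _ [_ _ ->]] := refS k; rewrite -/(y2 k) -/(y1 k) IH exprSr invfM mulrA.
  by [].
have [X XP] : exists X, forall k, x1 k <= X <= x2 k.
  by apply: nested_point => k; [case: (refS k)|case: (refS k)|case: (inS k)].
have [Y YP] : exists Y, forall k, y1 k <= Y <= y2 k.
  by apply: nested_point => k;
    [case: (refS k) => ? ? ? []|case: (refS k)=> ? ? ? []|case: (inS k)=> ? ? ? []].
have [e e0 eP] := loc X Y (XP 0%N) (YP 0%N).
have [k] := @halving_small ((b - a) + (d - c)) e e0; rewrite mulrDl => ke.
have kx : x2 k - x1 k < e.
  rewrite szx; apply: le_lt_trans ke; rewrite lerDl.
  by rewrite divr_ge0 ?exprn_ge0// subr_ge0.
have ky : y2 k - y1 k < e.
  rewrite szy; apply: le_lt_trans ke; rewrite lerDr.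
  by rewrite divr_ge0 ?exprn_ge0// subr_ge0.
have [ax xx xb [cy yy yd nPk]] := inS k.
by apply: nPk; exact: (eP _ _ _ _ ax (XP k) xb cy (YP k) yd kx ky).
Qed.

Lemma bisect1 (P : R -> R -> Prop) a b : a <= b ->
  (forall x1 x2, a <= x1 -> x1 <= x2 -> x2 <= b ->
     P x1 ((x1 + x2) / 2) -> P ((x1 + x2) / 2) x2 -> P x1 x2) ->
  (forall x, a <= x <= b -> exists2 e, 0 < e &
     forall x1 x2, a <= x1 -> x1 <= x <= x2 -> x2 <= b -> x2 - x1 < e ->
       P x1 x2) ->
  P a b.
Proof.
move=> ab glue loc.
apply: (@bisect2 (fun x1 x2 _ _ => P x1 x2) a b 0 0) => //.
- by move=> x1 x2 _ _ ? ? ? _ _ _ ? ? _ _; exact: glue.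
- move=> x y xab _; have [e e0 eP] := loc x xab; exists e => //.
  by move=> x1 x2 _ _ ? ? ? _ _ _ ? _; exact: eP.
Qed.

(** The mean value inequality for functions without a derivative: the hypothesis
    only concerns short intervals around each [t], and the bound is additive under
    bisection. *)
Lemma local_lipschitz (D : R -> R[i]) (a b A : R) : a <= b ->
  (forall e t, 0 < e -> a <= t <= b -> exists2 s, 0 < s &
     forall t1 t2, a <= t1 -> t1 <= t <= t2 -> t2 <= b -> t2 - t1 < s ->
       normc (D t2 - D t1) <= (A + e) * (t2 - t1)) ->
  normc (D b - D a) <= A * (b - a).
Proof.
move=> ab loc; apply/ler_addgt0Pr => e e0.
have ba1 : 0 < b - a + 1 by lra.
have : normc (D b - D a) <= (A + e / (b - a + 1)) * (b - a).
  apply: (@bisect1 (fun x1 x2 =>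
    normc (D x2 - D x1) <= (A + e / (b - a + 1)) * (x2 - x1)) a b) => //.
    move=> x1 x2 _ _ _ H1 H2.
    have -> : D x2 - D x1 = (D x2 - D ((x1 + x2) / 2)) + (D ((x1 + x2) / 2) - D x1).
      by rewrite addrA subrK.
    apply: (le_trans (normcD _ _)); apply: (le_trans (lerD H2 H1)).
    by rewrite -mulrDr le_eqVlt; apply/orP; left; apply/eqP; congr (_ * _); lra.
  by move=> x xab; apply: loc => //; rewrite divr_gt0.
move=> /le_trans; apply; rewrite mulrDl lerD2l -mulrA ler_piMr// ?ltW//.
by rewrite mulrC ltr_pdivrMr// mul1r; lra.
Qed.

(** Compactness of [[a, b]]: radii that work near each point can be replaced by a
    single one. *)
Lemma interval_tube (Q : R -> R -> Prop) a b : a <= b ->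
  (forall x s s', 0 < s' -> s' <= s -> Q x s -> Q x s') ->
  (forall x, a <= x <= b -> exists2 s, 0 < s &
    forall x', `|x' - x| < s -> Q x' s) ->
  exists2 s, 0 < s & forall x, a <= x <= b -> Q x s.
Proof.
move=> ab mono loc.
apply: (@bisect1 (fun x1 x2 => exists2 s, 0 < s &
  forall x, x1 <= x <= x2 -> Q x s) a b) => //.
  move=> x1 x2 _ _ _ [s s0 sP] [s' s'0 s'P].
  have m0 : 0 < Num.min s s' by rewrite lt_min s0.
  exists (Num.min s s') => // x /andP[x1x xx2].
  have [xm|mx] := leP x ((x1 + x2) / 2).
    by apply: (@mono _ s) => //; [rewrite ge_min lexx|apply: sP; rewrite x1x].
  apply: (@mono _ s') => //; first by rewrite ge_min lexx orbT.
  by apply: s'P; rewrite (ltW mx).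
move=> x /loc[s s0 sP]; exists s => // x1 x2 _ xx _ x12.
by exists s => // x' x'x; apply: sP; rewrite ltr_norml; lra.
Qed.
End Bisection.

(** * Integrals of bounded complex functions *)

Section Integral.
Variable R : realType.
Local Notation C := R[i].
Local Notation mu := (@lebesgue_measure R).
Implicit Types (f g : R -> C) (a b : R) (A : set R).

(** Values in the field [R[i]] and not in its regular algebra, so that the lemmas on
    fields apply. *)
Definition ci A f : C := cintegral A f.

(** A class of functions that is closed under products and that is integrable on
    bounded intervals. *)
Definition bounded_meas A f : Prop :=
  [/\ measurable_fun A (fun x => complex.Re (f x)),
      measurable_fun A (fun x => complex.Im (f x)) &
      exists M, forall x, A x -> normc (f x) <= M].

Lemma bmS A B f : measurable B -> A `<=` B -> bounded_meas B f -> bounded_meas A f.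
Proof.
move=> mB AB [mr mi [M fM]]; split.
- exact: measurable_funS mB AB mr.
- exact: measurable_funS mB AB mi.
- by exists M => x /AB; exact: fM.
Qed.

Lemma bm_eq A f g : (forall x, A x -> f x = g x) ->
  bounded_meas A f -> bounded_meas A g.
Proof.
move=> fg [mr mi [M fM]]; split.
- by apply: eq_measurable_fun mr => x /set_mem /fg ->.
- by apply: eq_measurable_fun mi => x /set_mem /fg ->.
- by exists M => x Ax; rewrite -fg//; exact: fM.
Qed.

Lemma bmD A f g : bounded_meas A f -> bounded_meas A g ->
  bounded_meas A (fun x => f x + g x).
Proof.
move=> [mr mi [M fM]] [mr' mi' [N gN]]; split.
- under eq_fun do rewrite cReD; exact: measurable_funD.
- under eq_fun do rewrite cImD; exact: measurable_funD.
- exists (M + N) => x Ax; apply: (le_trans (normcD _ _)).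
  by rewrite lerD ?fM ?gN.
Qed.

Lemma bmM A f g : bounded_meas A f -> bounded_meas A g ->
  bounded_meas A (fun x => f x * g x).
Proof.
move=> [mr mi [M fM]] [mr' mi' [N gN]]; split.
- under eq_fun do rewrite cReM.
  by apply: measurable_funB; exact: measurable_funM.
- under eq_fun do rewrite cImM.
  by apply: measurable_funD; exact: measurable_funM.
- exists (M * N) => x Ax; rewrite Normc.normcM.
  by rewrite ler_pM ?normc_ge0 ?fM ?gN.
Qed.

Lemma bm_cst A (k : C) : bounded_meas A (fun=> k).
Proof. by split; [exact: measurable_cst..|exists (normc k)]. Qed.

Lemma bmN A f : bounded_meas A f -> bounded_meas A (fun x => - f x).
Proof.
move=> /(bmM (bm_cst A (-1))); apply: bm_eq => x _; exact: mulN1r.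
Qed.

Lemma bmB A f g : bounded_meas A f -> bounded_meas A g ->
  bounded_meas A (fun x => f x - g x).
Proof. by move=> hf hg; apply: bmD => //; exact: bmN. Qed.

Lemma bm_integrable a b f : bounded_meas `[a, b] f ->
  mu.-integrable `[a, b] (EFin \o (fun x => complex.Re (f x))) /\
  mu.-integrable `[a, b] (EFin \o (fun x => complex.Im (f x))).
Proof.
move=> [mr mi [M fM]].
have fin : (mu `[a, b]%classic < +oo)%E.
  by rewrite lebesgue_measure_itv /=; case: ifP => // _; rewrite -EFinB ltry.
split; apply: measurable_bounded_integrable => //.
- exists M; split; first exact: num_real.
  move=> y My x Ax; apply: le_trans (ltW My); exact: le_trans (Re_le_normc _) (fM _ Ax).
- exists M; split; first exact: num_real.
  move=> y My x Ax; apply: le_trans (ltW My); exact: le_trans (Im_le_normc _) (fM _ Ax).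
Qed.

Lemma ci_eq A f g : (forall x, A x -> f x = g x) -> ci A f = ci A g.
Proof.
by move=> fg; congr (_ +i* _); apply: eq_Rintegral => x /set_mem /fg ->.
Qed.

Lemma ciD a b f g : bounded_meas `[a, b] f -> bounded_meas `[a, b] g ->
  ci `[a, b] (fun x => f x + g x) = ci `[a, b] f + ci `[a, b] g.
Proof.
move=> /bm_integrable[fr fi] /bm_integrable[gr gi].
by apply: eq_ReIm => /=;
  [under eq_Rintegral do rewrite cReD|under eq_Rintegral do rewrite cImD];
  rewrite RintegralD.
Qed.

Lemma ciZ a b f (k : C) : bounded_meas `[a, b] f ->
  ci `[a, b] (fun x => k * f x) = k * ci `[a, b] f.
Proof.
move=> /bm_integrable[fr fi].
have iZ h (r : R) : mu.-integrable `[a, b] (EFin \o h) ->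
    mu.-integrable `[a, b] (EFin \o (fun x => r * h x)).
  by move=> ih; exact: (@eq_integrable _ _ _ _ _ _ _ _ _ (integrableZl _ r ih)).
apply: eq_ReIm => /=.
  under eq_Rintegral do rewrite cReM.
  rewrite (@RintegralB _ _ _ mu _ (fun x => complex.Re k * complex.Re (f x))
    (fun x => complex.Im k * complex.Im (f x)))//; try exact: iZ.
  by rewrite !RintegralZl// cReM.
under eq_Rintegral do rewrite cImM.
rewrite (@RintegralD _ _ _ mu _ (fun x => complex.Re k * complex.Im (f x))
    (fun x => complex.Im k * complex.Re (f x)))//; try exact: iZ.
by rewrite !RintegralZl// cImM.
Qed.

Lemma ciN a b f : bounded_meas `[a, b] f ->
  ci `[a, b] (fun x => - f x) = - ci `[a, b] f.
Proof.
move=> hf; rewrite -mulN1r -ciZ//; apply: ci_eq => x _; by rewrite mulN1r.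
Qed.

Lemma ciB a b f g : bounded_meas `[a, b] f -> bounded_meas `[a, b] g ->
  ci `[a, b] (fun x => f x - g x) = ci `[a, b] f - ci `[a, b] g.
Proof. by move=> hf hg; rewrite ciD ?ciN//; exact: bmN. Qed.

Lemma mu_itv a b : a <= b -> fine (mu `[a, b]%classic) = b - a.
Proof.
move=> ab; rewrite lebesgue_measure_itv /= lte_fin; case: ltP => //= ba.
by apply/eqP; rewrite eq_sym subr_eq0 eq_le ba.
Qed.

Lemma ci_cst a b (k : C) : a <= b ->
  ci `[a, b] (fun=> k) = (b - a)%:C * k.
Proof.
move=> ab; apply: eq_ReIm; rewrite /= Rintegral_cst// mu_itv// ?cReM ?cImM /=; lra.
Qed.

(** The constant 2 is the price of estimating the two components separately. *)
Lemma ci_le_int a b f (h : R -> R) : bounded_meas `[a, b] f ->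
  mu.-integrable `[a, b] (EFin \o h) ->
  (forall x, a <= x <= b -> normc (f x) <= h x) ->
  normc (ci `[a, b] f) <= 2 * \int[mu]_(x in `[a, b]) h x.
Proof.
move=> bf ih fh; have [fr fi] := bm_integrable bf.
have key k : mu.-integrable `[a, b] (EFin \o k) ->
    (forall x, a <= x <= b -> `|k x| <= h x) ->
    `|\int[mu]_(x in `[a, b]) k x| <= \int[mu]_(x in `[a, b]) h x.
  move=> ik kh; apply: (le_trans (le_normr_Rintegral _ ik)) => //.
  apply: le_Rintegral => //; exact: integrable_norm ik.
rewrite mulr_natl mulr2n; apply: (le_trans (normc_le_ReIm _)); apply: lerD => /=.
- by apply: key => // x /fh; apply: le_trans; exact: Re_le_normc.
- by apply: key => // x /fh; apply: le_trans; exact: Im_le_normc.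
Qed.

Lemma ci_le a b f M : a <= b -> bounded_meas `[a, b] f ->
  (forall x, a <= x <= b -> normc (f x) <= M) ->
  normc (ci `[a, b] f) <= 2 * M * (b - a).
Proof.
move=> ab bf fM.
have iM : mu.-integrable `[a, b] (EFin \o (fun=> M)).
  by have [+ _] := bm_integrable (bm_cst `[a, b] M%:C).
by apply: (le_trans (ci_le_int bf iM fM)); rewrite Rintegral_cst// mu_itv// mulrA.
Qed.

Lemma ci_split a c b f : a <= c -> c <= b -> bounded_meas `[a, b] f ->
  ci `[a, b] f = ci `[a, c] f + ci `[c, b] f.
Proof.
move=> ac cb /bm_integrable[fr fi].
have key h : mu.-integrable `[a, b] (EFin \o h) ->
    \int[mu]_(x in `[a, b]) h x =
    \int[mu]_(x in `[a, c]) h x + \int[mu]_(x in `[c, b]) h x.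
  move=> ih; rewrite -(@Rintegral_itv_obnd_cbnd R c); last first.
    by apply: integrableS ih => //; apply: subset_itvr; rewrite bnd_simp.
  by rewrite -(@Rintegral_itvB R h (BLeft a) (BRight b) c) ?bnd_simp// addrC subrK.
by apply: eq_ReIm => /=; exact: key.
Qed.

Definition rcont f (x : R) : Prop := forall e, 0 < e -> exists2 s, 0 < s &
  forall y, `|y - x| < s -> normc (f y - f x) <= e.

Lemma rcont_Re f x : rcont f x -> {for x, continuous (fun y => complex.Re (f y))}.
Proof.
move=> fx; apply/cvgrPdist_le => e e0; have [s s0 sP] := fx e e0.
near=> y; rewrite distrC -cReN -cReD; apply: (le_trans (Re_le_normc _)).
apply: sP; rewrite distrC; near: y; exact: (@cvgr_dist_lt _ _ _ (nbhs x) _ id x).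
Unshelve. all: by end_near. Qed.

Lemma rcont_Im f x : rcont f x -> {for x, continuous (fun y => complex.Im (f y))}.
Proof.
move=> fx; apply/cvgrPdist_le => e e0; have [s s0 sP] := fx e e0.
near=> y; rewrite distrC -cImN -cImD; apply: (le_trans (Im_le_normc _)).
apply: sP; rewrite distrC; near: y; exact: (@cvgr_dist_lt _ _ _ (nbhs x) _ id x).
Unshelve. all: by end_near. Qed.

Lemma rcont_real (h : R -> R) (x : R) : {for x, continuous h} -> rcont (fun y => (h y)%:C) x.
Proof.
move=> hx e e0; move/cvgrPdist_le : hx => /(_ e e0) /nbhs_ballP[s s0 sP].
exists s => // y yx.
have -> : normc ((h y)%:C - (h x)%:C) = `|h x - h y|.
  by rewrite realcB normc_real distrC.
apply: sP.
by rewrite /ball /= distrC.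
Qed.

Lemma rcont_bounded a b f : a <= b -> (forall x, a <= x <= b -> rcont f x) ->
  exists M, forall x, a <= x <= b -> normc (f x) <= M.
Proof.
move=> ab cf.
apply: (@bisect1 R (fun x1 x2 => exists M, forall x, x1 <= x <= x2 -> normc (f x) <= M)) => //.
  move=> x1 x2 _ _ _ [M MP] [N NP]; exists (Num.max M N) => x /andP[x1x xx2].
  rewrite le_max; have [xm|mx] := leP x ((x1 + x2) / 2).
    by rewrite MP// x1x.
  by rewrite NP ?orbT// (ltW mx).
move=> x /cf/(_ 1 ltr01)[s s0 sP]; exists s => // x1 x2 _ xx _ x12.
exists (normc (f x) + 1) => y yx; rewrite -lerBlDl.
by apply: (le_trans (normcB_ge _ _)); apply: sP; rewrite ltr_norml; lra.
Qed.

Lemma rcont_bm a b f : a <= b -> (forall x, a <= x <= b -> rcont f x) ->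
  bounded_meas `[a, b] f.
Proof.
move=> ab cf; split.
- apply: subspace_continuous_measurable_fun => //.
  apply: continuous_in_subspaceT => x /set_mem /=; rewrite in_itv /= => xab.
  exact: rcont_Re (cf _ xab).
- apply: subspace_continuous_measurable_fun => //.
  apply: continuous_in_subspaceT => x /set_mem /=; rewrite in_itv /= => xab.
  exact: rcont_Im (cf _ xab).
- have [M MP] := rcont_bounded ab cf; exists M => x /=; rewrite in_itv /=; exact: MP.
Qed.

Lemma bm_bound a b f : bounded_meas `[a, b] f ->
  exists2 M, 0 < M & forall x, a <= x <= b -> normc (f x) <= M.
Proof.
move=> [_ _ [M MP]]; exists (`|M| + 1); first by rewrite ltr_wpDl.
move=> x xab; apply: (@le_trans _ _ M); first by apply: MP; rewrite /= in_itv.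
by rewrite (le_trans (ler_norm _))// lerDl.
Qed.

End Integral.

(** * Complex differentiability *)

Section ComplexDiff.
Variable R : realType.
Local Notation C := R[i].
Implicit Types (H f g : C -> C) (z w : C).

Lemma normC_normc (z : C) : `|z| = (normc z)%:C.
Proof. by []. Qed.

Lemma posC (e : C) : 0 < e -> exists2 r : R, 0 < r & e = r%:C.
Proof.
case: e => r s; rewrite ltcE /= => /andP[/eqP -> r0]; by exists r.
Qed.

(** Stated by moduli, with real bounds; the topology of [Cplx R] is only involved
    in [derivable_cdiff]. *)
Definition cdiff H z : Prop := exists l, forall e, 0 < e -> exists2 d, 0 < d &
  forall w, normc (w - z) < d ->
    normc (H w - H z - l * (w - z)) <= e * normc (w - z).

Definition ccont H z : Prop := forall e, 0 < e -> exists2 d, 0 < d &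
  forall w, normc (w - z) < d -> normc (H w - H z) <= e.

Lemma derivable_cdiff (H : Cplx R -> Cplx R) (z : Cplx R) :
  derivable H z 1 -> cdiff H z.
Proof.
move=> /cvg_ex[l /cvgrPdist_le lP]; exists l => e e0.
have e0' : 0 < e%:C :> Cplx R by rewrite ltcR.
have := lP _ e0'; rewrite near_withinE => /nbhs_ballP[d' d'0 dP].
have [d d0 dE] := posC d'0; exists d => // w wz.
have [->|wnz] := eqVneq w z.
  by rewrite !subrr mulr0 subr0 Normc.normc0 mulr0.
have wz0 : w - z != 0 by rewrite subr_eq0.
have := dP (w - z); rewrite /ball /= sub0r normrN normC_normc dE ltcR.
move=> /(_ wz wz0); rewrite /shift /= [_ *: 1]mulr1 subrK [_ *: _]/(_ * _).
rewrite normC_normc lecR => le_e.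
have -> : H w - H z - l * (w - z) = - (l - (w - z)^-1 * (H w - H z)) * (w - z).
  by rewrite opprB mulrBl mulrAC mulVf// mul1r.
by rewrite Normc.normcM normcNE ler_wpM2r ?normc_ge0.
Qed.

Lemma cdiff_ccont H z : cdiff H z -> ccont H z.
Proof.
move=> [l lP] e e0; have [d d0 dP] := lP 1 ltr01.
have K0 : 0 < normc l + 1 by rewrite ltr_wpDl ?normc_ge0.
exists (Num.min d (e / (normc l + 1))); first by rewrite lt_min d0 divr_gt0.
move=> w; rewrite lt_min => /andP[wd we].
have -> : H w - H z = (H w - H z - l * (w - z)) + l * (w - z) by rewrite subrK.
apply: (le_trans (normcD _ _)).
apply: (le_trans (lerD (dP _ wd) (lexx _))).
rewrite Normc.normcM -mulrDl addrC -ler_pdivlMl// mulrC; exact: ltW.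
Qed.

Lemma ccont_cst (k z : C) : ccont (fun=> k) z.
Proof. by move=> e e0; exists 1 => // w _; rewrite subrr Normc.normc0 ltW. Qed.

Lemma ccontD f g z : ccont f z -> ccont g z -> ccont (fun w => f w + g w) z.
Proof.
move=> cf cg e e0; have e2 : 0 < e / 2 by lra.
have [r r0 rP] := cf _ e2; have [s s0 sP] := cg _ e2.
exists (Num.min r s); first by rewrite lt_min r0.
move=> w; rewrite lt_min => /andP[/rP h1 /sP h2].
have -> : f w + g w - (f z + g z) = (f w - f z) + (g w - g z) by ring.
by apply: (le_trans (normcD _ _)); lra.
Qed.

Lemma ccontM f g z : ccont f z -> ccont g z -> ccont (fun w => f w * g w) z.
Proof.
move=> cf cg e e0; pose K := normc (f z) + normc (g z) + 1.
have [nf ng] := (normc_ge0 (f z), normc_ge0 (g z)).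
have K0 : 0 < K by rewrite /K; lra.
have m0 : 0 < Num.min 1 (e / K) by rewrite lt_min ltr01 divr_gt0.
have [r r0 rP] := cf _ m0; have [s s0 sP] := cg _ m0.
exists (Num.min r s); first by rewrite lt_min r0.
move=> w; rewrite lt_min => /andP[/rP h1 /sP h2].
move: h1 h2; rewrite !le_min => /andP[h1 h1'] /andP[h2 h2'].
have -> : f w * g w - f z * g z =
  (f w - f z) * (g w - g z) + ((f w - f z) * g z + f z * (g w - g z)) by ring.
apply: (le_trans (normcD _ _)); apply: (le_trans (lerD (lexx _) (normcD _ _))).
rewrite !Normc.normcM.
have -> : e = e / K + (e / K * normc (g z) + normc (f z) * (e / K)).
  by rewrite /K; field; rewrite gt_eqF.
apply: lerD; last by apply: lerD; [apply: ler_wpM2r|apply: ler_wpM2l].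
by rewrite -[X in _ <= X]mulr1; apply: ler_pM; rewrite ?normc_ge0.
Qed.

Lemma ccontV f z : f z != 0 -> ccont f z -> ccont (fun w => (f w)^-1) z.
Proof.
move=> fz cf e e0; set n := normc (f z); have n0 : 0 < n by rewrite normc_gt0.
have m0 : 0 < Num.min (n / 2) (e * n ^+ 2 / 2).
  by rewrite lt_min !divr_gt0// mulr_gt0// exprn_gt0.
have [r r0 rP] := cf _ m0; exists r => // w /rP; rewrite le_min => /andP[h1 h2].
have fw : n / 2 <= normc (f w).
  by have := normcB_ge (f z) (f w); rewrite normcBC -/n; lra.
have fw0 : 0 < normc (f w) by apply: lt_le_trans fw; rewrite divr_gt0.
have -> : (f w)^-1 - (f z)^-1 = - (f w - f z) * ((f w)^-1 * (f z)^-1).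
  by field; rewrite fz -normc_gt0.
rewrite !Normc.normcM normcNE !Normc.normcV -invfM ler_pdivrMr ?mulr_gt0//.
apply: (le_trans h2); rewrite -/n expr2.
have -> : e * (n * n) / 2 = e * (n / 2 * n) by field.
by apply: ler_wpM2l; [exact: ltW|rewrite ler_wpM2r// ltW].
Qed.

(** Caratheodory's form of differentiability, which makes the product and
    quotient rules algebraic. *)
Lemma cdiffP H z : cdiff H z <->
  exists phi, ccont phi z /\ forall w, H w = H z + phi w * (w - z).
Proof.
split=> [[l lP]|[phi [cphi phiE]]].
  exists (fun w => if w == z then l else (H w - H z) / (w - z)); split.
    move=> e e0; have [d d0 dP] := lP e e0; exists d => // w /dP.
    rewrite eqxx; have [_ _|wz] := eqVneq w z.
      by rewrite subrr Normc.normc0 ltW.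
    have wz0 : w - z != 0 by rewrite subr_eq0.
    have -> : H w - H z - l * (w - z) = ((H w - H z) / (w - z) - l) * (w - z) by field.
    by rewrite Normc.normcM ler_pM2r// normc_gt0.
  move=> w /=; have [->|wz] := eqVneq w z; first by rewrite subrr mulr0 addr0.
  by rewrite divfK ?subr_eq0// addrC subrK.
exists (phi z) => e e0; have [d d0 dP] := cphi e e0; exists d => // w /dP h.
have -> : H w - H z - phi z * (w - z) = (phi w - phi z) * (w - z).
  by rewrite [H w]phiE; ring.
rewrite Normc.normcM.
by rewrite ler_wpM2r ?normc_ge0.
Qed.

Lemma cdiff_cst (k z : C) : cdiff (fun=> k) z.
Proof.
apply/cdiffP; exists (fun=> 0); split; first exact: ccont_cst.
by move=> w; rewrite mul0r addr0.
Qed.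

Lemma cdiff_id z : cdiff id z.
Proof.
apply/cdiffP; exists (fun=> 1); split; first exact: ccont_cst.
by move=> w; rewrite mul1r addrC subrK.
Qed.

Lemma cdiffD f g z : cdiff f z -> cdiff g z -> cdiff (fun w => f w + g w) z.
Proof.
move=> /cdiffP[p [cp pE]] /cdiffP[q [cq qE]]; apply/cdiffP.
exists (fun w => p w + q w); split; first exact: ccontD.
move=> w; rewrite [f w]pE [g w]qE; ring.
Qed.

Lemma cdiffM f g z : cdiff f z -> cdiff g z -> cdiff (fun w => f w * g w) z.
Proof.
move=> df dg; have cg := cdiff_ccont dg; move: df dg.
move=> /cdiffP[p [cp pE]] /cdiffP[q [cq qE]]; apply/cdiffP.
exists (fun w => p w * g w + f z * q w); split.
  by apply: ccontD; apply: ccontM => //; exact: ccont_cst.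
move=> w; have -> : f w * g w = f z * g w + p w * g w * (w - z) by rewrite {1}pE; ring.
have -> : f z * g w = f z * g z + f z * q w * (w - z) by rewrite {1}qE; ring.
ring.
Qed.

Lemma cdiffB f g z : cdiff f z -> cdiff g z -> cdiff (fun w => f w - g w) z.
Proof.
move=> /cdiffP[p [cp pE]] /cdiffP[q [cq qE]]; apply/cdiffP.
exists (fun w => p w + -1 * q w); split.
  by apply: ccontD => //; apply: ccontM => //; exact: ccont_cst.
move=> w; rewrite [f w]pE [g w]qE; ring.
Qed.

Lemma cdiffV f z : f z != 0 -> cdiff f z -> cdiff (fun w => (f w)^-1) z.
Proof.
move=> fz df; have cf := cdiff_ccont df.
move: df => /cdiffP[p [cp pE]].
suff [l lP] : exists l, forall e, 0 < e -> exists2 d, 0 < d & forall w, normc (w - z) < d ->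
    normc ((f w)^-1 - (f z)^-1 - l * (w - z)) <= e * normc (w - z) by exists l.
exists (- p z * (f z)^-1 * (f z)^-1) => e e0.
have cq : ccont (fun w => - 1 * p w * (f w)^-1 * (f z)^-1) z.
  have c1 := ccontM (ccont_cst (-1) z) cp.
  exact: (ccontM (ccontM c1 (ccontV fz cf)) (ccont_cst _ _)).
have [d d0 dP] := cq e e0.
have [r r0 rP] := cf (normc (f z) / 2) (divr_gt0 (etrans (normc_gt0 _) fz) (ltr0Sn _ 1)).
exists (Num.min d r); first by rewrite lt_min d0.
move=> w; rewrite lt_min => /andP[/dP h /rP h'].
have fw : f w != 0.
  have n0 : 0 < normc (f z) by rewrite normc_gt0.
  by rewrite -normc_gt0; have := normcB_ge (f z) (f w); rewrite normcBC; lra.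
have -> : (f w)^-1 - (f z)^-1 - - p z * (f z)^-1 * (f z)^-1 * (w - z) =
  (- 1 * p w * (f w)^-1 * (f z)^-1 - -1 * p z * (f z)^-1 * (f z)^-1) * (w - z).
  have E : (f w)^-1 - (f z)^-1 = - (f w - f z) * ((f w)^-1 * (f z)^-1).
    by field; rewrite fz fw.
  rewrite E [X in - (X - _)]pE; ring.
by rewrite Normc.normcM ler_wpM2r ?normc_ge0.
Qed.

Lemma cdiffX f n z : cdiff f z -> cdiff (fun w => f w ^+ n) z.
Proof.
move=> df; elim: n => [|n IH]; first exact: cdiff_cst.
suff -> : (fun w => f w ^+ n.+1) = (fun w => f w * f w ^+ n) by exact: cdiffM.
by apply/funext => w; rewrite exprS.
Qed.

Lemma cdiff_shift f k z : cdiff f (z + k) -> cdiff (fun w => f (w + k)) z.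
Proof.
move=> [l lP]; exists l => e e0; have [d d0 dP] := lP e e0; exists d => // w.
have E : w - z = (w + k) - (z + k) by rewrite opprD addrACA subrr addr0.
by rewrite E; exact: dP.
Qed.

Lemma normc_re (u u' v : R) : normc ((u +i* v) - (u' +i* v) : C) = `|u - u'|.
Proof. by rewrite -(normc_real (u - u')); congr normc; apply: eq_ReIm => /=; lra. Qed.

Lemma normc_im (u v v' : R) : normc ((u +i* v) - (u +i* v') : C) = `|v - v'|.
Proof.
rewrite -(normc_real (v - v')) -[RHS]mul1r -(normc_i R) -Normc.normcM.
by congr normc; apply: eq_ReIm => /=; lra.
Qed.

Lemma normc_box (u v u' v' : R) :
  normc ((u +i* v) - (u' +i* v') : C) <= `|u - u'| + `|v - v'|.
Proof. exact: (le_trans (normc_le_ReIm _)). Qed.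

Lemma ccont_hor H (u v : R) : ccont H (u +i* v) -> rcont (fun t => H (t +i* v)) u.
Proof.
move=> cH e e0; have [d d0 dP] := cH e e0; exists d => // t tu.
by apply: dP; rewrite normc_re.
Qed.

Lemma ccont_ver H (u v : R) : ccont H (u +i* v) -> rcont (fun t => H (u +i* t)) v.
Proof.
move=> cH e e0; have [d d0 dP] := cH e e0; exists d => // t tu.
by apply: dP; rewrite normc_im.
Qed.
End ComplexDiff.

(** * Goursat's theorem for rectangles *)

Section Goursat.
Variable R : realType.
Local Notation C := R[i].
Variable H : C -> C.

(** The integral over the boundary of a rectangle, opposite sides being combined. *)
Definition rect_int (x1 x2 y1 y2 : R) : C :=
  ci `[x1, x2] (fun u => H (u +i* y1) - H (u +i* y2)) +
  'i * ci `[y1, y2] (fun v => H (x2 +i* v) - H (x1 +i* v)).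

Variables a b c d : R.
Hypotheses (ab : a <= b) (cd : c <= d).
Hypothesis dH : forall x y, a <= x <= b -> c <= y <= d -> cdiff H (x +i* y).

Lemma hor_bm x1 x2 y : a <= x1 -> x1 <= x2 -> x2 <= b -> c <= y <= d ->
  bounded_meas `[x1, x2] (fun u => H (u +i* y)).
Proof.
move=> ax xx xb yd; apply: rcont_bm => // x /andP[x1x xx2].
by apply/ccont_hor/cdiff_ccont/dH => //; lra.
Qed.

Lemma ver_bm x y1 y2 : a <= x <= b -> c <= y1 -> y1 <= y2 -> y2 <= d ->
  bounded_meas `[y1, y2] (fun v => H (x +i* v)).
Proof.
move=> axb cy yy yd; apply: rcont_bm => // y /andP[y1y yy2].
by apply/ccont_ver/cdiff_ccont/dH => //; lra.
Qed.

Lemma rect_intE x1 x2 y1 y2 :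
  a <= x1 -> x1 <= x2 -> x2 <= b -> c <= y1 -> y1 <= y2 -> y2 <= d ->
  rect_int x1 x2 y1 y2 =
  ci `[x1, x2] (fun u => H (u +i* y1)) -
  ci `[x1, x2] (fun u => H (u +i* y2)) +
  'i * (ci `[y1, y2] (fun v => H (x2 +i* v)) -
        ci `[y1, y2] (fun v => H (x1 +i* v))).
Proof.
move=> *; rewrite /rect_int !ciB//; try (apply: hor_bm => //; lra);
  apply: ver_bm => //; lra.
Qed.

Lemma rect_int_split x1 x2 y1 y2 (xm ym : R) :
  a <= x1 -> x1 <= xm <= x2 -> x2 <= b -> c <= y1 -> y1 <= ym <= y2 -> y2 <= d ->
  rect_int x1 x2 y1 y2 =
  (rect_int x1 xm y1 ym + rect_int xm x2 y1 ym) +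
  (rect_int x1 xm ym y2 + rect_int xm x2 ym y2).
Proof.
move=> ax /andP[x1m mx2] xb cy /andP[y1m my2] yd.
have hs y : c <= y <= d -> ci `[x1, x2] (fun u => H (u +i* y)) =
    ci `[x1, xm] (fun u => H (u +i* y)) + ci `[xm, x2] (fun u => H (u +i* y)).
  by move=> cyd; apply: ci_split => //; apply: hor_bm => //; lra.
have vs x : a <= x <= b -> ci `[y1, y2] (fun v => H (x +i* v)) =
    ci `[y1, ym] (fun v => H (x +i* v)) + ci `[ym, y2] (fun v => H (x +i* v)).
  by move=> axb; apply: ci_split => //; apply: ver_bm => //; lra.
do 5! (rewrite rect_intE; [|by lra..]).
rewrite (hs y1); [|by lra]. rewrite (hs y2); [|by lra].
rewrite (vs x1); [|by lra]. rewrite (vs x2); [|by lra].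
ring.
Qed.

(** Near a point [H] is affine up to an error that is small relative to the
    distance, and the boundary integral of an affine function vanishes. *)
Lemma rect_int_local x y e : 0 < e -> a <= x <= b -> c <= y <= d ->
  exists2 s, 0 < s & forall x1 x2 y1 y2, a <= x1 -> x1 <= x <= x2 -> x2 <= b ->
    c <= y1 -> y1 <= y <= y2 -> y2 <= d -> x2 - x1 < s -> y2 - y1 < s ->
    normc (rect_int x1 x2 y1 y2) <= e * ((x2 - x1) + (y2 - y1)) ^+ 2.
Proof.
move=> e0 xab ycd; have [l lP] := dH xab ycd.
have e4 : 0 < e / 4 by lra.
have [r r0 rP] := lP _ e4.
exists (r / 2); first lra.
move=> x1 x2 y1 y2 ax xx xb cy yy yd hx hy.
set z := x +i* y in lP rP.
pose S := (x2 - x1) + (y2 - y1).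
have err u v : x1 <= u <= x2 -> y1 <= v <= y2 ->
    normc (H (u +i* v) - H z - l * ((u +i* v) - z)) <= e / 4 * S.
  move=> hu hv; have hS : normc ((u +i* v) - z) <= S.
    apply: (le_trans (normc_box _ _ _ _)); rewrite /S.
    by apply: lerD; rewrite ler_norml; lra.
  by apply: (le_trans (rP _ _)); [rewrite /S in hS; lra|rewrite ler_wpM2l//; lra].
pose k := l * 'i * (y2 - y1)%:C; pose k' := l * (x2 - x1)%:C.
have bh v : y1 <= v <= y2 -> bounded_meas `[x1, x2] (fun u => H (u +i* v)).
  by move=> hv; apply: hor_bm => //; lra.
have bv u : x1 <= u <= x2 -> bounded_meas `[y1, y2] (fun v => H (u +i* v)).
  by move=> hu; apply: ver_bm => //; lra.
have bD1 : bounded_meas `[x1, x2] (fun u => H (u +i* y1) - H (u +i* y2)).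
  by apply: bmB; apply: bh; lra.
have bD2 : bounded_meas `[y1, y2] (fun v => H (x2 +i* v) - H (x1 +i* v)).
  by apply: bmB; apply: bv; lra.
have x12 : x1 <= x2 by lra.
have y12 : y1 <= y2 by lra.
have E1 : normc (ci `[x1, x2] (fun u => H (u +i* y1) - H (u +i* y2) + k))
    <= 2 * (e / 2 * S) * (x2 - x1).
  apply: ci_le => //; first exact: (bmD bD1 (bm_cst _ _)).
  move=> u hu.
  have -> : H (u +i* y1) - H (u +i* y2) + k =
    (H (u +i* y1) - H z - l * ((u +i* y1) - z)) -
    (H (u +i* y2) - H z - l * ((u +i* y2) - z)).
    have -> : k = l * ((u +i* y2) - z) - l * ((u +i* y1) - z).
      rewrite /k -mulrA -mulrBr; congr (_ * _).
      by apply: eq_ReIm => /=; lra.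
    ring.
  apply: (le_trans (normcB _ _)).
  have -> : e / 2 * S = e / 4 * S + e / 4 * S by lra.
  by apply: lerD; apply: err => //; lra.
have E2 : normc (ci `[y1, y2] (fun v => H (x2 +i* v) - H (x1 +i* v) - k'))
    <= 2 * (e / 2 * S) * (y2 - y1).
  apply: ci_le => //; first exact: (bmB bD2 (bm_cst _ _)).
  move=> v hv.
  have -> : H (x2 +i* v) - H (x1 +i* v) - k' =
    (H (x2 +i* v) - H z - l * ((x2 +i* v) - z)) -
    (H (x1 +i* v) - H z - l * ((x1 +i* v) - z)).
    have -> : k' = l * ((x2 +i* v) - z) - l * ((x1 +i* v) - z).
      rewrite /k' -mulrBr; congr (_ * _).
      by apply: eq_ReIm => /=; lra.
    ring.
  apply: (le_trans (normcB _ _)).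
  have -> : e / 2 * S = e / 4 * S + e / 4 * S by lra.
  by apply: lerD; apply: err => //; lra.
have -> : rect_int x1 x2 y1 y2 =
   ci `[x1, x2] (fun u => H (u +i* y1) - H (u +i* y2) + k) +
   'i * ci `[y1, y2] (fun v => H (x2 +i* v) - H (x1 +i* v) - k').
  rewrite (ciD bD1 (bm_cst _ _)) (ciB bD2 (bm_cst _ _)) !ci_cst//.
  rewrite /rect_int /k /k'; ring.
apply: (le_trans (normcD _ _)); rewrite Normc.normcM normc_i mul1r.
apply: (le_trans (lerD E1 E2)); rewrite -mulrDr -/S expr2.
by rewrite le_eqVlt; apply/orP; left; apply/eqP; lra.
Qed.

(** The boundary integral is additive under subdivision and, for small rectangles, small
    compared to the square of the perimeter. For the quarters of a rectangle these
    squares add up to the one of the whole. *)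
Lemma goursat : rect_int a b c d = 0.
Proof.
apply/normc_eq0P/eqP; rewrite eq_le normc_ge0 andbT.
apply/ler_addgt0Pr => e e0; rewrite add0r.
pose K := ((b - a) + (d - c)) ^+ 2 + 1.
have K0 : 0 < K by rewrite ltr_wpDl ?sqr_ge0.
have : normc (rect_int a b c d) <= e / K * ((b - a) + (d - c)) ^+ 2.
  apply: (@bisect2 R (fun x1 x2 y1 y2 => normc (rect_int x1 x2 y1 y2) <=
    e / K * ((x2 - x1) + (y2 - y1)) ^+ 2) a b c d) => //.
    move=> x1 x2 y1 y2 ax xx xb cy yy yd; set xm := _ / 2; set ym := (y1 + y2) / 2.
    move=> H1 H2 H3 H4.
    have hxm : x1 <= xm <= x2 by rewrite /xm !midf_le.
    have hym : y1 <= ym <= y2 by rewrite /ym !midf_le.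
    rewrite (@rect_int_split _ _ _ _ xm ym)//.
    apply: (le_trans (normcD _ _)).
    apply: (le_trans (lerD (normcD _ _) (normcD _ _))).
    apply: (le_trans (lerD (lerD H1 H2) (lerD H3 H4))).
    rewrite -!mulrDr; apply: ler_wpM2l; first by rewrite divr_ge0 ?ltW.
    by rewrite /xm /ym le_eqVlt; apply/orP; left; apply/eqP; field.
  by move=> x y xab ycd; apply: rect_int_local => //; rewrite divr_gt0.
move=> /le_trans; apply; rewrite -mulrA ler_piMr ?ltW//.
by rewrite mulrC ltr_pdivrMr// mul1r /K ltrDl.
Qed.
End Goursat.

(** * Integrals over horizontal lines *)

Section Parts.
Variable R : realType.
Local Notation C := R[i].
Implicit Types (f : R -> C) (p dp : R -> R).

(** [dp] is the derivative of [p], and is bounded and Lipschitz. One constant serves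
    all the bounds, among them the quadratic Taylor remainder that takes the place
    of the derivative in the proofs. *)
Definition C11 p dp (L : R) : Prop :=
  [/\ 0 <= L,
      forall t, `|dp t| <= L,
      forall s t, `|p t - p s| <= L * `|t - s|,
      forall s t, `|dp t - dp s| <= L * `|t - s| &
      forall s t, `|p t - p s - dp s * (t - s)| <= L * (t - s) ^+ 2].

Lemma lipschitz_rcont f (L : R) : (forall s t, normc (f t - f s) <= L * `|t - s|) ->
  forall x, rcont f x.
Proof.
move=> fL x e e0; exists (e / (`|L| + 1)); first by rewrite divr_gt0// ltr_wpDl.
move=> y; rewrite ltr_pdivlMr ?ltr_wpDl// => yx.
apply: (le_trans (fL x y)); apply: ltW; apply: le_lt_trans yx.
rewrite mulrC ler_wpM2l//.
by rewrite (le_trans (ler_norm _))// lerDl.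
Qed.

Lemma real_lipschitz_bm a b p (L : R) : a <= b ->
  (forall s t, `|p t - p s| <= L * `|t - s|) ->
  bounded_meas `[a, b] (fun x => (p x)%:C : C).
Proof.
move=> ab pL; apply: rcont_bm => // x _; apply: (@lipschitz_rcont _ L) => s t.
by rewrite realcB normc_real.
Qed.

(** A function that varies by at most the square of the length of the interval is
    constant. Identities between integrals follow when the difference of both sides,
    as a function of the endpoint, has this property. *)
Lemma quadratic_const (D : R -> C) a b K : a <= b -> 0 <= K ->
  (forall t1 t2, a <= t1 -> t1 <= t2 -> t2 <= b ->
     normc (D t2 - D t1) <= K * (t2 - t1) ^+ 2) -> D b = D a.
Proof.
move=> ab K0 DK; apply/eqP; rewrite -subr_eq0; apply/eqP/normc_eq0P/eqP.
rewrite eq_le normc_ge0 andbT -(mul0r (b - a)).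
apply: local_lipschitz => // e t e0 _; exists (e / (K + 1)).
  by rewrite divr_gt0// ltr_wpDl.
move=> t1 t2 at1 /andP[t1t tt2] t2b; rewrite ltr_pdivlMr ?ltr_wpDl// => h.
apply: (le_trans (DK _ _ _ _ _)) => //; first exact: le_trans t1t tt2.
rewrite add0r expr2 mulrA ler_wpM2r//; first lra.
nra.
Qed.

Lemma ci_point (a : R) f : bounded_meas `[a, a] f -> ci `[a, a] f = 0.
Proof.
move=> bf; have [M M0 MP] := bm_bound bf.
apply/normc_eq0P/eqP; rewrite eq_le normc_ge0 andbT.
by apply: (le_trans (ci_le (lexx a) bf MP)); rewrite subrr mulr0.
Qed.

Lemma bm_sub s t (a b : R) f : a <= s -> t <= b ->
  bounded_meas `[a, b] f -> bounded_meas `[s, t] f.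
Proof.
move=> as' tb; apply: bmS => //; move=> x /=; rewrite !in_itv /=; lra.
Qed.

Section Primitive.
Variables (f : R -> C) (a b M : R).
Hypotheses (ab : a <= b) (bf : bounded_meas `[a, b] f) (M0 : 0 < M).
Hypothesis fM : forall x, a <= x <= b -> normc (f x) <= M.
Let N t := ci `[a, t] f.

Lemma sub_bm s t : a <= s -> t <= b -> bounded_meas `[s, t] f.
Proof.
by move=> as' tb; exact: bm_sub bf.
Qed.

Lemma primitiveB s t : a <= s -> s <= t -> t <= b -> N t - N s = ci `[s, t] f.
Proof.
move=> as' st tb; rewrite /N (@ci_split _ a s t)//; last exact: sub_bm.
by rewrite addrAC subrr add0r.
Qed.

Lemma primitive_lip s t : a <= s -> s <= t -> t <= b ->
  normc (N t - N s) <= 2 * M * (t - s).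
Proof.
move=> as' st tb; rewrite primitiveB//; apply: ci_le => //; first exact: sub_bm.
by move=> x hx; apply: fM; lra.
Qed.

Lemma primitive_bm s t : a <= s -> s <= t -> t <= b -> bounded_meas `[s, t] N.
Proof.
move=> as' st tb; have ab' := ab.
(* Held constant beyond the endpoints, the primitive becomes Lipschitz on the line. *)
pose clip u := Num.max a (Num.min u b).
have clipP u : a <= clip u <= b.
  by rewrite /clip /Num.max /Num.min; case: (ltP u b) => ?; case: ltP => ?; lra.
have clip_lip u v : u <= v -> clip u <= clip v /\ clip v - clip u <= v - u.
  by move=> uv; rewrite /clip /Num.max /Num.min; case: (ltP u b) => ?;
    case: (ltP v b) => ?; do 2! case: ltP => ?; split; lra.
apply: (@bm_eq _ _ (fun u => N (clip u))).
  move=> u /=; rewrite in_itv /= => hu; congr N.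
  by rewrite /clip /Num.max /Num.min; case: (ltP u b) => ?; case: ltP => ?; lra.
apply: rcont_bm => // x _; apply: (@lipschitz_rcont _ (2 * M)) => u v.
wlog uv : u v / u <= v.
  move=> W; have [uv|/ltW vu] := leP u v; first exact: W.
  by rewrite normcBC distrC; exact: W.
have [c1 c2] := clip_lip _ _ uv.
have [/andP[hu _] /andP[_ hv]] := (clipP u, clipP v).
apply: (le_trans (primitive_lip hu c1 hv)).
rewrite ger0_norm ?subr_ge0//; apply: ler_wpM2l; last exact: c2.
by rewrite mulr_ge0// ltW.
Qed.

(** Integration by parts for a merely measurable [f], whose primitive [N] need not be
    differentiable. *)
Lemma ci_parts p dp L : C11 p dp L -> p b = 0 ->
  ci `[a, b] (fun x => (p x)%:C * f x) =
  - ci `[a, b] (fun x => (dp x)%:C * N x).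
Proof.
move=> [L0 dpL pL dpLip pT] pb; have ab' := ab; have M0' := M0.
have sub s t g : a <= s -> t <= b -> bounded_meas `[a, b] g -> bounded_meas `[s, t] g.
  by move=> as' tb; exact: bm_sub.
have bp s t : s <= t -> bounded_meas `[s, t] (fun x => (p x)%:C : C).
  by move=> st; exact: (real_lipschitz_bm st pL).
have bdp s t : s <= t -> bounded_meas `[s, t] (fun x => (dp x)%:C : C).
  by move=> st; exact: (real_lipschitz_bm st dpLip).
have bpf : bounded_meas `[a, b] (fun x => (p x)%:C * f x) by exact: (bmM (bp _ _ ab)).
have bN : bounded_meas `[a, b] N by exact: primitive_bm.
have bdpN : bounded_meas `[a, b] (fun x => (dp x)%:C * N x) by exact: (bmM (bdp _ _ ab)).
pose D t := ci `[a, t] (fun x => (p x)%:C * f x) - (p t)%:C * N t +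
            ci `[a, t] (fun x => (dp x)%:C * N x).
have NB : forall t, a <= t <= b -> normc (N t) <= 2 * M * (b - a).
  move=> t /andP[at' tb]; have := primitive_lip (lexx a) at' tb.
  rewrite {2}/N ci_point ?subr0; last exact: sub_bm.
  by move=> /le_trans; apply; apply: ler_wpM2l; lra.
set B := 2 * M * (b - a) in NB.
have B0 : 0 <= B by rewrite /B; apply: mulr_ge0; lra.
have : D b = D a.
  apply: (@quadratic_const _ _ _ (2 * (L * M) + 2 * (L * B + L * (2 * M)) + L * B)) => //.
    have LM : 0 <= L * M by rewrite mulr_ge0// ltW.
    have LB : 0 <= L * B by rewrite mulr_ge0.
    lra.
  move=> t1 t2 at1 t12 t2b.
  have t1b : t1 <= b by lra.
  have at2 : a <= t2 by lra.
  pose n := ci `[t1, t2] f.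
  have E1 : ci `[a, t2] (fun x => (p x)%:C * f x) =
      ci `[a, t1] (fun x => (p x)%:C * f x) +
      ci `[t1, t2] (fun x => (p x)%:C * f x).
    by apply: ci_split => //; exact: sub bpf.
  have E2 : ci `[a, t2] (fun x => (dp x)%:C * N x) =
      ci `[a, t1] (fun x => (dp x)%:C * N x) +
      ci `[t1, t2] (fun x => (dp x)%:C * N x).
    by apply: ci_split => //; exact: sub bdpN.
  have E3 : N t2 = N t1 + n by rewrite /n -primitiveB// addrC subrK.
  have bf12 : bounded_meas `[t1, t2] f by exact: sub bf.
  have F1 : ci `[t1, t2] (fun x => (p x)%:C * f x) - (p t2)%:C * n =
      ci `[t1, t2] (fun x => ((p x)%:C - (p t2)%:C) * f x).
    rewrite /n -ciZ// -ciB//; [|exact: sub bpf|exact: (bmM (bm_cst _ _))].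
    by apply: ci_eq => x _; rewrite mulrBl.
  have F2 : ci `[t1, t2] (fun x => (dp x)%:C * N x) -
      ((t2 - t1)%:C * ((dp t1)%:C * N t1)) =
      ci `[t1, t2] (fun x => (dp x)%:C * N x - (dp t1)%:C * N t1).
    by rewrite -ci_cst// -ciB//; [exact: sub bdpN|exact: bm_cst].
  have -> : D t2 - D t1 =
     (ci `[t1, t2] (fun x => (p x)%:C * f x) - (p t2)%:C * n) +
     (ci `[t1, t2] (fun x => (dp x)%:C * N x) -
        ((t2 - t1)%:C * ((dp t1)%:C * N t1))) +
     ((dp t1)%:C * (t2 - t1)%:C - ((p t2)%:C - (p t1)%:C)) * N t1.
    rewrite /D E1 E2 E3; ring.
  rewrite F1 F2; apply: (le_trans (normcD _ _)).
  rewrite [X in _ <= X]mulrDl; apply: lerD; last first.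
    rewrite Normc.normcM realcM !realcB normc_real [X in _ <= X]mulrAC.
    apply: ler_pM; [exact: normr_ge0|exact: normc_ge0| |by apply: NB; lra].
    by rewrite distrC; exact: pT.
  apply: (le_trans (normcD _ _)); rewrite [X in _ <= X]mulrDl; apply: lerD.
    have -> : 2 * (L * M) * (t2 - t1) ^+ 2 = 2 * (L * (t2 - t1) * M) * (t2 - t1) by ring.
    apply: ci_le => //.
      by apply: bmM => //; apply: bmB; [exact: bp|exact: bm_cst].
    move=> x hx; rewrite Normc.normcM realcB normc_real.
    apply: ler_pM; rewrite ?normr_ge0 ?normc_ge0//; last by apply: fM; lra.
    apply: (le_trans (pL _ _)); apply: ler_wpM2l => //.
    by rewrite ler_norml; lra.
  have -> : 2 * (L * B + L * (2 * M)) * (t2 - t1) ^+ 2 =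
    2 * (L * (t2 - t1) * B + L * (2 * M * (t2 - t1))) * (t2 - t1) by ring.
  apply: ci_le => //.
    by apply: bmB; [exact: sub bdpN|exact: bm_cst].
  move=> x hx.
  have -> : (dp x)%:C * N x - (dp t1)%:C * N t1 =
    ((dp x)%:C - (dp t1)%:C) * N x + (dp t1)%:C * (N x - N t1) by ring.
  apply: (le_trans (normcD _ _)); rewrite !Normc.normcM realcB !normc_real.
  apply: lerD; apply: ler_pM; rewrite ?normr_ge0 ?normc_ge0//.
  - apply: (le_trans (dpLip _ _)); apply: ler_wpM2l => //.
    by rewrite ler_norml; lra.
  - by apply: NB; lra.
  - have hx1 : t1 <= x by lra.
    have hx2 : x <= b by lra.
    apply: (le_trans (primitive_lip at1 hx1 hx2)).
    by apply: ler_wpM2l => //; lra.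
have sa g : bounded_meas `[a, b] g -> ci `[a, a] g = 0.
  by move=> bg; apply: ci_point; exact: sub bg.
rewrite /D pb mul0r subr0 (sa _ bpf) (sa _ bdpN) /N (sa _ bf) mulr0 subr0 addr0.
by move/eqP; rewrite addr_eq0 => /eqP.
Qed.
End Primitive.

Lemma ci_derivative (a b L : R) p dp : a <= b -> C11 p dp L ->
  ci `[a, b] (fun x => (dp x)%:C : C) = (p b - p a)%:C.
Proof.
move=> ab [L0 dpL pL dpLip pT].
have bdp s t : s <= t -> bounded_meas `[s, t] (fun x => (dp x)%:C : C).
  by move=> st; exact: (real_lipschitz_bm st dpLip).
pose D t : C := ci `[a, t] (fun x => (dp x)%:C : C) - (p t)%:C.
have : D b = D a.
  apply: (@quadratic_const _ _ _ (3 * L)) => //; first by rewrite mulr_ge0.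
  move=> t1 t2 at1 t12 t2b.
  have -> : D t2 - D t1 =
    ci `[t1, t2] (fun x => (dp x)%:C - (dp t1)%:C : C) -
    ((p t2)%:C - (p t1)%:C - (dp t1)%:C * ((t2 - t1)%:C)).
    rewrite /D (@ci_split _ a t1 t2)//; last by apply: bdp; lra.
    rewrite ciB ?ci_cst//; [ring|exact: bdp|exact: bm_cst].
  apply: (le_trans (normcB _ _)).
  have -> : 3 * L * (t2 - t1) ^+ 2 =
     2 * (L * (t2 - t1)) * (t2 - t1) + L * (t2 - t1) ^+ 2 by ring.
  apply: lerD.
    apply: ci_le => //; first by apply: bmB; [exact: bdp|exact: bm_cst].
    move=> x hx; rewrite realcB normc_real; apply: (le_trans (dpLip _ _)).
    by apply: ler_wpM2l => //; rewrite ler_norml; lra.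
  by rewrite realcM !realcB normc_real; exact: pT.
rewrite /D ci_point; last exact: bdp.
by move/eqP; rewrite add0r subr_eq => /eqP ->; rewrite addrC realcB.
Qed.

(** By [interval_tube] the modulus of continuity is uniform along the segment. *)
Lemma ccont_tube (H : C -> C) a b v e : a <= b -> 0 < e ->
  (forall u, a <= u <= b -> ccont H (u +i* v)) ->
  exists2 s, 0 < s & forall u w, a <= u <= b -> `|w - v| < s ->
    normc (H (u +i* w) - H (u +i* v)) <= e.
Proof.
move=> ab e0 cH.
have [|u|s s0 sP] := @interval_tube R (fun u s => forall w, `|w - v| < s ->
    normc (H (u +i* w) - H (u +i* v)) <= e) a b ab.
- by move=> u s s' _ s's h w wv; apply: h; exact: lt_le_trans wv s's.
- move=> hu; have [d d0 dP] := cH u hu (e / 2) (divr_gt0 e0 (ltr0Sn _ 1)).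
  exists (d / 2); first lra.
  move=> u' u'u w wv.
  have h1 : normc (H (u' +i* w) - H (u +i* v)) <= e / 2.
    by apply: dP; apply: (le_lt_trans (normc_box _ _ _ _)); lra.
  have h2 : normc (H (u' +i* v) - H (u +i* v)) <= e / 2.
    by apply: dP; apply: (le_lt_trans (normc_box _ _ _ _)); rewrite subrr normr0; lra.
  have -> : H (u' +i* w) - H (u' +i* v) =
    (H (u' +i* w) - H (u +i* v)) - (H (u' +i* v) - H (u +i* v)) by ring.
  by apply: (le_trans (normcB _ _)); lra.
by exists s => // u w hu; exact: sP.
Qed.

(** The derivative in [v] of the integral of [p u * H (u + iv)] is that of
    [p u * i H' (u + iv)], so after an integration by parts it is bounded by the
    integral of [p' u * H (u + iv)]. Goursat's theorem for thin rectangles replaces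
    [H']. *)
Lemma slide (H : C -> C) p dp (a b v1 v2 L A : R) : a <= b -> v1 <= v2 ->
  (forall x y, a <= x <= b -> v1 <= y <= v2 -> cdiff H (x +i* y)) ->
  C11 p dp L -> p a = 0 -> p b = 0 ->
  (forall v, v1 <= v <= v2 ->
     normc (ci `[a, b] (fun u => (dp u)%:C * H (u +i* v))) <= A) ->
  normc (ci `[a, b] (fun u => (p u)%:C * H (u +i* v2)) -
         ci `[a, b] (fun u => (p u)%:C * H (u +i* v1))) <= A * (v2 - v1).
Proof.
move=> ab v12 dH pC pa pb dpA; have [L0 dpL pL dpLip pT] := pC.
have bp : bounded_meas `[a, b] (fun x => (p x)%:C : C).
  exact: (real_lipschitz_bm ab pL).
have bdp : bounded_meas `[a, b] (fun x => (dp x)%:C : C).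
  exact: (real_lipschitz_bm ab dpLip).
have bH v : v1 <= v <= v2 -> bounded_meas `[a, b] (fun u => H (u +i* v)).
  by move=> hv; apply: (hor_bm dH).
apply: (@local_lipschitz R (fun v => ci `[a, b] (fun u => (p u)%:C * H (u +i* v)))) => //.
move=> e t e0 ht; have K0 : 0 < 8 * L * (b - a) + 1.
  by rewrite ltr_wpDl// mulr_ge0 ?mulr_ge0 ?subr_ge0.
pose e' := e / (8 * L * (b - a) + 1).
have e'0 : 0 < e' by rewrite divr_gt0.
have [s s0 sP] := ccont_tube ab e'0 (fun u hu => cdiff_ccont (dH u t hu ht)).
exists s => // t1 t2 v1t /andP[t1t tt2] t2v t12s.
have ht1 : v1 <= t1 <= v2 by lra.
have ht2 : v1 <= t2 <= v2 by lra.
have t12 : t1 <= t2 by lra.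
(* The primitive [N] of [f] is, by Goursat's theorem, [i] times the integral over
   [[t1, t2]] of the difference of [H] on two vertical sides, hence close to
   [k * (H (u + it) - H (a + it))]. *)
pose f u := H (u +i* t2) - H (u +i* t1).
have bf : bounded_meas `[a, b] f by apply: bmB; exact: bH.
have [M M0 fM] := bm_bound bf.
rewrite -ciB; [|exact: (bmM bp (bH _ ht2))|exact: (bmM bp (bH _ ht1))].
rewrite (@ci_eq _ _ _ (fun u => (p u)%:C * f u)); last by move=> u _; rewrite mulrBr.
rewrite (ci_parts ab bf M0 fM pC pb) normcNE.
pose N u := ci `[a, u] f.
have bN : bounded_meas `[a, b] N by exact: (primitive_bm ab bf M0 fM).
pose k := 'i * (t2 - t1)%:C.
pose err u := N u - k * (H (u +i* t) - H (a +i* t)).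
have bHa : bounded_meas `[a, b] (fun u => H (u +i* t) - H (a +i* t)).
  by apply: bmB; [exact: bH|exact: bm_cst].
have berr : bounded_meas `[a, b] err.
  by apply: bmB => //; apply: bmM => //; exact: bm_cst.
have errP u : a <= u <= b -> normc (err u) <= 4 * e' * (t2 - t1).
  move=> /andP[au ub].
  have dH' x y : a <= x <= u -> t1 <= y <= t2 -> cdiff H (x +i* y).
    move=> /andP[ax xu] /andP[t1y yt2]; apply: dH; first by rewrite ax (le_trans xu).
    by have /andP[v1t1 _] := ht1; have /andP[_ t2v2] := ht2; rewrite (le_trans v1t1)// (le_trans yt2).
  have G := goursat au t12 dH'.
  have bv x : a <= x <= u -> bounded_meas `[t1, t2] (fun v => H (x +i* v)).
    by move=> hx; apply: (ver_bm dH').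
  have bfu : bounded_meas `[a, u] f by exact: (sub_bm bf).
  have NE : N u = 'i * ci `[t1, t2] (fun v => H (u +i* v) - H (a +i* v)).
    move/eqP: G; rewrite /rect_int addrC addr_eq0 => /eqP ->.
    rewrite /N -ciN.
      by apply: ci_eq => x _; rewrite /f opprB.
    have h1 : t1 <= t1 <= t2 by rewrite lexx.
    have h2 : t1 <= t2 <= t2 by rewrite lexx andbT.
    by apply: bmB; [exact: (hor_bm dH' (lexx a) au (lexx u) h1)|exact: (hor_bm dH' (lexx a) au (lexx u) h2)].
  have buv : bounded_meas `[t1, t2] (fun v => H (u +i* v) - H (a +i* v)).
    by apply: bmB; apply: bv; rewrite lexx ?andbT.
  have -> : err u = 'i * ci `[t1, t2]
     (fun v => (H (u +i* v) - H (a +i* v)) - (H (u +i* t) - H (a +i* t))).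
    rewrite /err NE (ciB buv (bm_cst _ _)) ci_cst// /k; ring.
  rewrite Normc.normcM normc_i mul1r.
  have -> : 4 * e' * (t2 - t1) = 2 * (e' + e') * (t2 - t1) by ring.
  apply: ci_le => //; first exact: (bmB buv (bm_cst _ _)).
  move=> v hv.
  have -> : (H (u +i* v) - H (a +i* v)) - (H (u +i* t) - H (a +i* t)) =
    (H (u +i* v) - H (u +i* t)) - (H (a +i* v) - H (a +i* t)) by ring.
  apply: (le_trans (normcB _ _)).
  have vt : `|v - t| < s by rewrite ltr_norml; clear - hv v1t t1t tt2 t12s; lra.
  by apply: lerD; apply: sP; rewrite ?lexx ?au.
have bdH : bounded_meas `[a, b] (fun u => (dp u)%:C * H (u +i* t)).
  by apply: bmM => //; exact: bH.
have bderr : bounded_meas `[a, b] (fun u => (dp u)%:C * err u) by exact: bmM.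
have -> : ci `[a, b] (fun u => (dp u)%:C * N u) =
  k * ci `[a, b] (fun u => (dp u)%:C * H (u +i* t)) +
  ci `[a, b] (fun u => (dp u)%:C * err u).
  have z : ci `[a, b] (fun x => (dp x)%:C : C) = 0.
    by rewrite (ci_derivative ab pC) pa pb subrr.
  have -> : k * ci `[a, b] (fun u => (dp u)%:C * H (u +i* t)) =
     ci `[a, b] (fun u => k * ((dp u)%:C * H (u +i* t)) -
        (k * H (a +i* t)) * (dp u)%:C).
    rewrite ciB; [|exact: (bmM (bm_cst _ _) bdH)|exact: (bmM (bm_cst _ _) bdp)].
    by rewrite ciZ// (ciZ _ bdp) z mulr0 subr0.
  rewrite -ciD//.
    apply: ci_eq => u _; rewrite /err; ring.
  apply: bmB; [exact: (bmM (bm_cst _ _) bdH)|exact: (bmM (bm_cst _ _) bdp)].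
apply: (le_trans (normcD _ _)); rewrite mulrDl; apply: lerD.
  rewrite Normc.normcM mulrC /k Normc.normcM normc_i mul1r normc_real.
  rewrite ger0_norm ?subr_ge0//; apply: ler_wpM2r; first lra.
  exact: dpA.
apply: (@le_trans _ _ (2 * (L * (4 * e' * (t2 - t1))) * (b - a))).
  apply: ci_le => // u hu; rewrite Normc.normcM normc_real.
  by apply: ler_pM; rewrite ?normr_ge0 ?normc_ge0//; exact: errP.
have -> : 2 * (L * (4 * e' * (t2 - t1))) * (b - a) =
  (e' * (8 * L * (b - a))) * (t2 - t1) by ring.
apply: ler_wpM2r; first lra.
rewrite /e' -mulrA ler_piMr ?ltW// mulrC ltr_pdivrMr// mul1r ltrDl//.
Qed.
End Parts.

(** * The jump across a pole *)

Section Jump.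
Variable R : realType.
Local Notation C := R[i].

Lemma cdiff_divB (E : C -> C) (c w : C) : cdiff E w -> w != c ->
  cdiff (fun w => E w * (w - c)^-1) w.
Proof.
move=> dE wc; apply: cdiffM => //; apply: cdiffV; first by rewrite subr_eq0.
by apply: cdiffB; [exact: cdiff_id|exact: cdiff_cst].
Qed.

(** The imaginary part of the integrand is a Poisson kernel, of total mass 2 pi. It is
    at least [s^-1] at distance at most [s] from [x], whence the bound 2. Any
    positive bound would do. *)
Lemma poisson_mass (p : R -> R) (a b x s : R) : 0 < s -> a <= x - s -> x + s <= b ->
  (forall u, 0 <= p u) -> (forall u, x - s <= u <= x + s -> p u = 1) ->
  let k u : C := (p u)%:C * (((u +i* - s) - x%:C)^-1 - ((u +i* s) - x%:C)^-1) in
  bounded_meas `[a, b] k -> 2 <= normc (ci `[a, b] k).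
Proof.
move=> s0 ax xb p0 p1 k bk.
have Imk u : complex.Im (k u) = p u * (2 * s / ((u - x) ^+ 2 + s ^+ 2)).
  rewrite /k cImM /= mul0r addr0; congr (_ * _).
  have -> : - s - 0 = - s by rewrite subr0.
  by rewrite subr0 sqrrN; lra.
have den u : 0 < (u - x) ^+ 2 + s ^+ 2 by rewrite ltr_wpDl ?sqr_ge0// exprn_gt0.
have k0 u : 0 <= complex.Im (k u).
  by rewrite Imk mulr_ge0// divr_ge0 ?mulr_ge0 ?ltW.
apply: le_trans (Im_le_normc _); apply: le_trans (ler_norm _).
rewrite (@ci_split _ a (x - s))//; last lra.
rewrite (@ci_split _ (x - s) (x + s)); [|lra|lra|exact: bm_sub bk].
rewrite !cImD.
have g0 c d : 0 <= complex.Im (ci `[c, d] k) by apply: Rintegral_ge0 => u _; exact: k0.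
suff : 2 <= complex.Im (ci `[x - s, x + s] k).
  by have := g0 a (x - s); have := g0 (x + s) b; lra.
have bk' : bounded_meas `[x - s, x + s] k by exact: bm_sub bk.
have [_ ik] := bm_integrable bk'.
have [ic _] := bm_integrable (bm_cst `[x - s, x + s] (s^-1)%:C).
apply: (@le_trans _ _ (\int[@lebesgue_measure R]_(u in `[x - s, x + s]) s^-1)).
  rewrite Rintegral_cst// mu_itv; last lra.
  have -> : x + s - (x - s) = 2 * s by lra.
  by rewrite mulrC mulfK// gt_eqF.
apply: le_Rintegral => // u; rewrite /= in_itv /= => hu.
suff : s^-1 <= complex.Im (k u) by [].
rewrite Imk p1// mul1r ler_pdivlMr// mulrC ler_pdivrMr//.
nra.
Qed.

(** Write [E w / (w - z)] as [E z / (w - z)] plus a function [Q] which is bounded near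
    [z] and continuous elsewhere. The integrals of [Q] over the lines just below and
    just above [z] nearly agree, while those of [(w - z)^-1] differ by at least 2 in
    modulus. *)
Lemma jump (E : C -> C) (p : R -> R) (a b x y eta tau L e : R) :
  0 < eta -> 0 < tau -> a <= x - tau -> x + tau <= b ->
  (forall u v, a <= u <= b -> `|v - y| <= eta -> cdiff E (u +i* v)) ->
  (forall s t, `|p t - p s| <= L * `|t - s|) ->
  (forall u, 0 <= p u <= 1) -> (forall u, x - tau <= u <= x + tau -> p u = 1) ->
  0 < e -> exists2 s0, 0 < s0 & forall s, 0 < s -> s < s0 ->
  2 * normc (E (x +i* y)) - e <=
    normc (ci `[a, b] (fun u => (p u)%:C *
             (E (u +i* (y - s)) * ((u +i* (y - s)) - (x +i* y))^-1)) -
           ci `[a, b] (fun u => (p u)%:C *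
             (E (u +i* (y + s)) * ((u +i* (y + s)) - (x +i* y))^-1))).
Proof.
move=> eta0 tau0 ax xb dE pL p01 p1 e0; set z := x +i* y.
have ab : a <= b by lra.
have dEz : cdiff E z by apply: dE; rewrite ?subrr ?normr0; lra.
have [l lP] := dEz.
have [d d0 dP] := lP 1 ltr01.
pose Q (w : C) : C := (E w - E z) * (w - z)^-1.
pose B := normc l + 1.
have B0 : 0 < B by rewrite ltr_wpDl// normc_ge0.
have QB w : normc (w - z) < d -> w != z -> normc (Q w) <= B.
  move=> wd wz; have wz0 : 0 < normc (w - z) by rewrite normc_gt0 subr_eq0.
  rewrite /Q Normc.normcM Normc.normcV ler_pdivrMr// /B mulrDl.
  have -> : E w - E z = (E w - E z - l * (w - z)) + l * (w - z) by rewrite subrK.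
  by apply: (le_trans (normcD _ _)); rewrite [X in _ <= X]addrC Normc.normcM lerD2r dP.
have [t' t'0 [t'tau t'd t'e]] : exists2 t', 0 < t' & [/\ t' <= tau, t' < d / 2 & 8 * B * t' <= e / 2].
  (* Within [t'] of [x] the bound [B] for [Q] is used; there the
     integral is at most [2 * (B + B) * (2 * t')], half of [e]. *)
  exists (Num.min tau (Num.min (d / 3) (e / (16 * B)))).
    rewrite !lt_min tau0 !divr_gt0//; lra.
  split; first by rewrite ge_min lexx.
    by rewrite gt_min; apply/orP; right; rewrite gt_min; apply/orP; left; lra.
  apply: (@le_trans _ _ (8 * B * (e / (16 * B)))).
    by apply: ler_wpM2l; [rewrite mulr_ge0 ?ltW|rewrite !ge_min lexx !orbT].
  by rewrite le_eqVlt; apply/orP; left; apply/eqP; field; rewrite gt_eqF.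
have at1 : a <= x - t' by clear - ax t'tau; lra.
have t12 : x - t' <= x + t' by clear - t'0; lra.
have t2b : x + t' <= b by clear - xb t'tau; lra.
have t1b : x - t' <= b by exact: le_trans t12 t2b.
have at2 : a <= x + t' by exact: le_trans at1 t12.
pose e' := e / (8 * (b - a) + 1).
have e'D : 0 < 8 * (b - a) + 1 by clear - ab; lra.
have e'0 : 0 < e' by rewrite divr_gt0.
have N4 : 4 * e' * (b - a) <= e / 2.
  have -> : 4 * e' * (b - a) = (e / 2) * ((8 * (b - a)) / (8 * (b - a) + 1)).
    by rewrite /e'; field; rewrite gt_eqF.
  by rewrite ler_piMr//; [clear - e0; lra|rewrite ler_pdivrMr// mul1r lerDl].
have N5 : 0 <= e' * t' by rewrite mulr_ge0 ?ltW.
have dQ u v : a <= u <= b -> `|v - y| <= eta -> (u +i* v : C) != z ->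
    cdiff Q (u +i* v).
  move=> hu hv wz; apply: cdiff_divB => //.
  by apply: cdiffB; [exact: dE|exact: cdiff_cst].
have ccQ u : a <= u <= b -> u != x -> ccont Q (u +i* y).
  move=> hu ux; apply: cdiff_ccont; apply: dQ => //.
    by rewrite subrr normr0 ltW.
  by apply: contra ux => /eqP[->].
have [s1 s10 s1P] : exists2 s1, 0 < s1 & forall u w, a <= u <= x - t' -> `|w - y| < s1 ->
    normc (Q (u +i* w) - Q (u +i* y)) <= e'.
  apply: ccont_tube => // u /andP[au ux]; apply: ccQ; first by rewrite au (le_trans ux).
  by rewrite lt_eqF//; apply: (le_lt_trans ux); rewrite ltrBlDr ltrDl.
have [s2 s20 s2P] : exists2 s2, 0 < s2 & forall u w, x + t' <= u <= b -> `|w - y| < s2 ->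
    normc (Q (u +i* w) - Q (u +i* y)) <= e'.
  apply: ccont_tube => // u /andP[xu ub]; apply: ccQ; first by rewrite ub (le_trans at2).
  by rewrite gt_eqF//; apply: lt_le_trans xu; rewrite ltrDl.
exists (Num.min (Num.min s1 s2) (Num.min (d / 2) (Num.min eta tau))).
  by rewrite !lt_min s10 s20 eta0 tau0 divr_gt0.
move=> s s0; rewrite !lt_min => /andP[/andP[ss1 ss2] /andP[sd /andP[seta stau]]].
pose E' v u : C := (p u)%:C * (E (u +i* v) * ((u +i* v) - z)^-1).
rewrite -/(E' (y - s)) -/(E' (y + s)).
have nz u v : v != y -> (u +i* v : C) != z by move=> vy; apply: contra vy => /eqP[_ ->].
have ny : y - s != y by rewrite lt_eqF// ltrBlDr ltrDl.
have py : y + s != y by rewrite gt_eqF// ltrDl.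
have h1 : `|y - s - y| = s by rewrite addrAC subrr add0r normrN gtr0_norm.
have h2 : `|y + s - y| = s by rewrite addrAC subrr add0r gtr0_norm.
have vy1 : `|y - s - y| <= eta by rewrite h1 ltW.
have vy2 : `|y + s - y| <= eta by rewrite h2 ltW.
have bp : bounded_meas `[a, b] (fun x => (p x)%:C : C) by exact: (real_lipschitz_bm ab pL).
have bd (G : C -> C) v : (forall u, a <= u <= b -> cdiff G (u +i* v)) ->
    bounded_meas `[a, b] (fun u => G (u +i* v)).
  by move=> dG; apply: rcont_bm => // u hu; apply/ccont_hor/cdiff_ccont/dG.
have bE v : v != y -> `|v - y| <= eta -> bounded_meas `[a, b] (E' v).
  move=> vy hv; apply: bmM => //.
  apply: (bd (fun w => E w * (w - z)^-1)) => u hu.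
  by apply: cdiff_divB; [exact: dE|exact: nz].
have bQ v : v != y -> `|v - y| <= eta -> bounded_meas `[a, b] (fun u => Q (u +i* v)).
  by move=> vy hv; apply: bd => u hu; apply: dQ => //; exact: nz.
have bI v : v != y -> `|v - y| <= eta -> bounded_meas `[a, b] (fun u => ((u +i* v) - z)^-1).
  move=> vy hv; apply: (@bm_eq _ _ (fun u => 1 * ((u +i* v) - z)^-1)).
    by move=> *; rewrite mul1r.
  apply: (bd (fun w => 1 * (w - z)^-1)) => u hu.
  by apply: (@cdiff_divB (fun=> 1)); [exact: cdiff_cst|exact: nz].
pose k u : C := (p u)%:C * (((u +i* (y - s)) - z)^-1 - ((u +i* (y + s)) - z)^-1).
pose q u : C := (p u)%:C * (Q (u +i* (y - s)) - Q (u +i* (y + s))).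
have bk : bounded_meas `[a, b] k by apply: bmM => //; apply: bmB; exact: bI.
have bq : bounded_meas `[a, b] q by apply: bmM => //; apply: bmB; exact: bQ.
have -> : ci `[a, b] (E' (y - s)) - ci `[a, b] (E' (y + s)) =
   E z * ci `[a, b] k + ci `[a, b] q.
  rewrite -ciB; [|exact: bE|exact: bE].
  rewrite -(ciZ _ bk) -ciD//; last exact: (bmM (bm_cst _ _) bk).
  apply: ci_eq => u _; rewrite /E' /k /q /Q; ring.
have k2 : 2 <= normc (ci `[a, b] k).
  have kE : k = (fun u => (p u)%:C * (((u +i* - s) - x%:C)^-1 - ((u +i* s) - x%:C)^-1)).
    by apply/funext => u; rewrite /k; congr (_ * (_^-1 - _^-1)); apply: eq_ReIm;
      rewrite /= ?subr0// addrAC subrr add0r.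
  rewrite kE; apply: poisson_mass => //.
  - by clear - ax stau; lra.
  - by clear - xb stau; lra.
  - by move=> u; have /andP[] := p01 u.
  - by move=> u hu; apply: p1; clear - hu stau; lra.
  - by rewrite -kE.
have qe : normc (ci `[a, b] q) <= e.
  rewrite (@ci_split _ a (x - t'))//.
  rewrite (@ci_split _ (x - t') (x + t') b)//; last exact: bm_sub bq.
  have pm u w c : normc w <= c -> normc ((p u)%:C * w) <= c.
    move=> wc; rewrite Normc.normcM normc_real; have /andP[pu0 pu1] := p01 u.
    rewrite ger0_norm//; apply: le_trans wc; rewrite ler_piMl// normc_ge0//.
  have far c d' : a <= c -> c <= d' -> d' <= b ->
     (forall u w, c <= u <= d' -> `|w - y| < Num.min s1 s2 ->
        normc (Q (u +i* w) - Q (u +i* y)) <= e') ->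
     normc (ci `[c, d'] q) <= 2 * (e' + e') * (d' - c).
    move=> ac cd db hQ; apply: ci_le => //; first exact: bm_sub bq.
    move=> u hu; apply: pm.
    have -> : Q (u +i* (y - s)) - Q (u +i* (y + s)) =
      (Q (u +i* (y - s)) - Q (u +i* y)) - (Q (u +i* (y + s)) - Q (u +i* y)) by ring.
    apply: (le_trans (normcB _ _)).
    by apply: lerD; apply: hQ => //; rewrite ?h1 ?h2 lt_min ss1.
  have N1 : normc (ci `[a, x - t'] q) <= 2 * (e' + e') * (x - t' - a).
    by apply: far => // u w hu; rewrite lt_min => /andP[w1 _]; exact: s1P.
  have N3 : normc (ci `[x + t', b] q) <= 2 * (e' + e') * (b - (x + t')).
    by apply: far => // u w hu; rewrite lt_min => /andP[_ w2]; exact: s2P.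
  have N2 : normc (ci `[x - t', x + t'] q) <= 2 * (B + B) * (x + t' - (x - t')).
    apply: ci_le => //; first exact: bm_sub bq.
    move=> u hu; apply: pm; apply: (le_trans (normcB _ _)).
    have ux : `|u - x| <= t' by rewrite ler_norml; clear - hu; lra.
    have uxd : `|u - x| + s < d by clear - ux t'd sd; lra.
    by apply: lerD; apply: QB; rewrite ?nz//; apply: (le_lt_trans (normc_box _ _ _ _));
      rewrite ?h1 ?h2.
  apply: (le_trans (normcD _ _)); apply: (le_trans (lerD (lexx _) (normcD _ _))).
  clear - N1 N2 N3 N4 N5 t'e; lra.
have := normcB_ge (E z * ci `[a, b] k) (- ci `[a, b] q).
rewrite opprK normcNE Normc.normcM => h.
have := ler_wpM2l (normc_ge0 (E z)) k2; lra.
Qed.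
End Jump.

(** * Bounded families of smooth functions *)

Section Families.
Variable R : realType.
Implicit Types (O S : set R) (n : nat).

(** The functions [f i] have derivatives on [O] up to the order [n], and these are bounded
    uniformly in [i]: a bounded set of functions of class [C^n]. The index carries the
    parameters of the kernel. *)
Fixpoint SB (I : Type) O n (f : I -> R -> R) : Prop :=
  (exists M : R, forall i x, O x -> `|f i x| <= M) /\
  (if n is m.+1 then exists f' : I -> R -> R,
     (forall i x, O x -> is_derive x 1 (f i) (f' i x)) /\ SB O m f' else True).

Lemma SB_bound I O n (f : I -> R -> R) : SB O n f ->
  exists2 M, 0 <= M & forall i x, O x -> `|f i x| <= M.
Proof.
have key : (exists M : R, forall i x, O x -> `|f i x| <= M) ->
    exists2 M, 0 <= M & forall i x, O x -> `|f i x| <= M.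
  move=> [M MP]; exists `|M| => // i x Ox; exact: le_trans (MP i x Ox) (ler_norm _).
by case: n => [|n] [h _]; exact: key.
Qed.

Lemma SB_bound' I O n (f : I -> R -> R) : SB O n f ->
  exists M, forall i x, O x -> `|f i x| <= M.
Proof. by case: n => [|n] []. Qed.

Lemma SBS I O n (f : I -> R -> R) : SB O n.+1 f -> SB O n f.
Proof.
elim: n f => [|n IH] f [fM [f' [df sf']]]; first by [].
by split => //; exists f'; split => //; exact: IH.
Qed.

Lemma SB_cst I O n (c : I -> R) M : (forall i, `|c i| <= M) ->
  SB O n (fun i _ => c i).
Proof.
elim: n c M => [|n IH] c M cM; first by split => //; exists M.
split; first by exists M.
exists (fun _ _ => 0); split; first by move=> i x _; exact: is_derive_cst.
by apply: (IH _ 0) => i; rewrite normr0.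
Qed.

Lemma SB_id I O n M : (forall x, O x -> `|x| <= M) -> SB O n (fun (_ : I) x => x).
Proof.
move=> OM; case: n => [|n]; first by split => //; exists M.
split; first by exists M.
exists (fun _ _ => 1); split; first by move=> i x _; exact: is_derive_id.
by apply: (@SB_cst _ _ _ (fun=> 1) 1) => _; rewrite normr1.
Qed.

Lemma SBD I O n (f g : I -> R -> R) : SB O n f -> SB O n g ->
  SB O n (fun i x => f i x + g i x).
Proof.
elim: n f g => [|n IH] f g.
  move=> /SB_bound[M M0 MP] /SB_bound[N N0 NP]; split => //; exists (M + N) => i x Ox.
  by apply: (le_trans (ler_normD _ _)); apply: lerD; [exact: MP|exact: NP].
move=> sf sg; have [M M0 MP] := SB_bound sf; have [N N0 NP] := SB_bound sg.
move: sf sg => [_ [f' [df sf']]] [_ [g' [dg sg']]]; split.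
  exists (M + N) => i x Ox.
  by apply: (le_trans (ler_normD _ _)); apply: lerD; [exact: MP|exact: NP].
exists (fun i x => f' i x + g' i x); split; last exact: IH.
by move=> i x Ox; apply: is_deriveD; [exact: df|exact: dg].
Qed.

Lemma SBM I O n (f g : I -> R -> R) : SB O n f -> SB O n g ->
  SB O n (fun i x => f i x * g i x).
Proof.
elim: n f g => [|n IH] f g.
  move=> /SB_bound[M M0 MP] /SB_bound[N N0 NP]; split => //; exists (M * N) => i x Ox.
  by rewrite normrM ler_pM// ?MP ?NP.
move=> sf sg; have [M M0 MP] := SB_bound sf; have [N N0 NP] := SB_bound sg.
have [sf1 sg1] := (SBS sf, SBS sg).
move: sf sg => [_ [f' [df sf']]] [_ [g' [dg sg']]]; split.
  by exists (M * N) => i x Ox; rewrite normrM ler_pM// ?MP ?NP.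
exists (fun i x => f i x * g' i x + g i x * f' i x); split; last first.
  by apply: SBD; exact: IH.
move=> i x Ox; have := dg i x Ox; have := df i x Ox => h1 h2.
exact: is_deriveM.
Qed.

Lemma SBN I O n (f : I -> R -> R) : SB O n f -> SB O n (fun i x => - f i x).
Proof.
move=> sf; have := SBM (@SB_cst I O n (fun=> -1) 1 _) sf.
suff -> : (fun i x => -1 * f i x) = (fun i x => - f i x).
  by apply => i; rewrite normrN normr1.
by apply/funext => i; apply/funext => x; rewrite mulN1r.
Qed.

Lemma SBV I O n (f : I -> R -> R) c : 0 < c ->
  (forall i x, O x -> c <= `|f i x|) -> SB O n f ->
  SB O n (fun i x => (f i x)^-1).
Proof.
move=> c0 fc; elim: n f fc => [|n IH] f fc sf.
  split => //; exists c^-1 => i x Ox; rewrite normfV lef_pV2 ?posrE//; first exact: fc.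
  exact: lt_le_trans c0 (fc _ _ Ox).
have sV := IH _ fc (SBS sf).
move: sf => [_ [f' [df sf']]]; split; first exact: SB_bound' sV.
exists (fun i x => - ((f i x)^-1 * (f i x)^-1) * f' i x); split; last first.
  by apply: SBM => //; apply: SBN; exact: SBM.
move=> i x Ox.
have f0 : f i x != 0 by rewrite -normr_gt0; exact: lt_le_trans c0 (fc _ _ Ox).
have h := is_deriveV f0 (df i x Ox).
by apply: (is_derive_eq h); rewrite -invfM -expr2 mulNr scaleNr.
Qed.

Lemma SB_reindex I J O n (f : I -> R -> R) (h : J -> I) :
  SB O n f -> SB O n (fun j => f (h j)).
Proof.
elim: n f => [|n IH] f [[M MP]]; first by split => //; exists M => j; exact: MP.
move=> [f' [df sf']]; split; first by exists M => j; exact: MP.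
exists (fun j => f' (h j)); split; [by move=> j; exact: df|exact: IH].
Qed.

Lemma SB_affine I n (f : I -> R -> R) k l : SB setT n f ->
  SB setT n (fun i x => f i (k * x + l)).
Proof.
elim: n f => [|n IH] f [[M MP]]; first by split => //; exists M => j x _; exact: MP.
move=> [f' [df sf']]; split; first by exists M => i x _; exact: MP.
exists (fun i x => k * f' i (k * x + l)); split.
  move=> i x _; have d1 : is_derive x 1 (fun x => k * x + l) k.
    have h : is_derive x 1 ((fun x : R => k *: x) + cst l) (k *: 1 + 0).
      by apply: is_deriveD.
    by apply: (is_derive_eq h); rewrite addr0 /GRing.scale /= mulr1.
  have h := @is_derive1_comp _ (f i) (fun x => k * x + l) x _ _ (df i (k * x + l) Logic.I) d1.
  by apply: (is_derive_eq h); rewrite mulrC.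
apply: SBM; last exact: IH.
by apply: (@SB_cst _ _ _ (fun=> k) `|k|).
Qed.

Lemma SB_subset I O O' n (f : I -> R -> R) : O' `<=` O -> SB O n f -> SB O' n f.
Proof.
move=> OO; elim: n f => [|n IH] f [[M MP]].
  by split => //; exists M => i x /OO; exact: MP.
move=> [f' [df sf']]; split; first by exists M => i x /OO; exact: MP.
by exists f'; split; [move=> i x /OO; exact: df|exact: IH].
Qed.

Lemma SB_ext I O n (f g : I -> R -> R) : open O ->
  (forall i x, O x -> f i x = g i x) -> SB O n f -> SB O n g.
Proof.
move=> oO fg; case: n => [|n].
  by move=> [[M MP] _]; split => //; exists M => i x Ox; rewrite -fg//; exact: MP.
move=> [[M MP] [f' [df sf']]]; split.
  by exists M => i x Ox; rewrite -fg//; exact: MP.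
exists f'; split => // i x Ox; apply: near_eq_is_derive (df i x Ox).
by apply: filterS (open_nbhs_nbhs (conj oO Ox)) => y; exact: fg.
Qed.

(** The line is covered by [O] and the open complement of [S], and on their overlap the
    derivatives, being unique, vanish as the functions do. *)
Lemma SB_extend I O S n (f : I -> R -> R) : open O -> closed S -> S `<=` O ->
  (forall i x, ~ S x -> f i x = 0) -> SB O n f -> SB setT n f.
Proof.
move=> oO cS SO; elim: n f => [|n IH] f f0 sf.
  have [M M0 MP] := SB_bound sf; split => //; exists M => i x _.
  by have [/SO/MP//|nS] := pselect (S x); rewrite f0// normr0.
have [M M0 MP] := SB_bound sf; move: sf => [_ [f' [df sf']]]; split.
  exists M => i x _.
  by have [/SO/MP//|nS] := pselect (S x); rewrite f0// normr0.
have d0 i x : ~ S x -> is_derive x 1 (f i) 0.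
  move=> nS; have dc : is_derive x 1 (cst (0 : R)) 0 by exact: is_derive_cst.
  apply: near_eq_is_derive dc.
  have oS : open (~` S) by exact: closed_openC.
  by apply: filterS (open_nbhs_nbhs (conj oS nS)) => y /f0 ->.
pose f'' i x := if pselect (O x) then f' i x else 0.
have f''E i x : O x -> f' i x = f'' i x by rewrite /f''; case: pselect.
exists f''; split.
  move=> i x _; rewrite /f''; case: pselect => [Ox|nO]; first exact: df.
  by apply: d0 => /SO.
apply: IH; last exact: SB_ext f''E sf'.
move=> i x nS; rewrite /f''; case: pselect => // Ox.
have [d1 e1] := df i x Ox; have [d2 e2] := d0 i x nS.
by rewrite -e1 e2.
Qed.

Lemma SB_derive1n I n (f : I -> R -> R) : SB setT n f ->
  forall m, (m <= n)%N ->
  SB setT (n - m) (fun i => (derive1n m (f i))).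
Proof.
move=> sf m; elim: m n f sf => [|m IH] n f sf; first by rewrite subn0.
case: n sf => // n [_ [f' [df sf']]] mn; rewrite subSS.
have -> : (fun i => (derive1n m.+1 (f i))) = (fun i => (derive1n m (f' i))).
  apply/funext => i; rewrite derive1Sn; congr (derive1n m _).
  by apply/funext => x; rewrite derive1E; have [_ ->] := df i x Logic.I.
exact: IH.
Qed.

Lemma SB_smooth I (f : I -> R -> R) : (forall n, SB setT n f) ->
  forall n, (forall i x, derivable ((derive1n n (f i))) x 1) /\
    exists M, forall i x, `|(derive1n n (f i)) x| <= M.
Proof.
move=> sf n; have := SB_derive1n (sf n.+1) (leqnSn n); rewrite subSnn.
move=> [[M MP] [f' [df _]]]; split.
  by move=> i x; have [] := df i x Logic.I.
by exists M => i x; exact: MP.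
Qed.

Lemma mvt_bound (f f' : R -> R) (M s t : R) : (forall x : R, is_derive x 1 f (f' x)) ->
  (forall x, `|f' x| <= M) -> `|f t - f s| <= M * `|t - s|.
Proof.
move=> df fM; wlog st : s t / s <= t.
  by move=> W; have [?|/ltW ?] := leP s t; [exact: W|rewrite distrC [`|t - s|]distrC; exact: W].
have cf : {within `[s, t], continuous f}.
  apply: derivable_within_continuous => x _; by have [] := df x.
have [c _ ->] := @MVT_segment _ f f' s t st (fun x _ => df x) cf.
by rewrite normrM ler_wpM2r.
Qed.

Lemma taylor_bound (f f' f'' : R -> R) (M s t : R) : (forall x : R, is_derive x 1 f (f' x)) ->
  (forall x : R, is_derive x 1 f' (f'' x)) -> (forall x, `|f'' x| <= M) ->
  `|f t - f s - f' s * (t - s)| <= M * (t - s) ^+ 2.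
Proof.
move=> df df' f''M.
have M0 : 0 <= M by exact: le_trans (f''M 0).
have cf (a b : R) : {within `[a, b], continuous f}.
  apply: derivable_within_continuous => x _; by have [] := df x.
have [c [hc ->]] : exists c, `|c - s| <= `|t - s| /\ f t - f s = f' c * (t - s).
  have [st|/ltW ts] := leP s t.
    have [c + ->] := @MVT_segment _ f f' s t st (fun x _ => df x) (cf _ _).
    rewrite in_itv /= => hc; exists c; split => //.
    by rewrite !ger0_norm; lra.
  have [c + E] := @MVT_segment _ f f' t s ts (fun x _ => df x) (cf _ _).
  rewrite in_itv /= => hc; exists c; split.
    by rewrite !ler0_norm; lra.
  by rewrite -opprB E; ring.
rewrite -mulrBl normrM -[X in _ <= M * X]real_normK ?num_real// expr2 mulrA.
apply: ler_wpM2r => //; apply: (le_trans (mvt_bound _ _ df' f''M)).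
exact: ler_wpM2l.
Qed.

(** Converse to [taylor_bound]; it yields derivatives at points where the
    rules of calculus do not apply. *)
Lemma quad_is_derive (f : R -> R) (x l K : R) :
  (forall y, `|f y - f x - l * (y - x)| <= K * (y - x) ^+ 2) -> is_derive x 1 f l.
Proof.
move=> fK; suff h : h^-1 *: (f (h *: (1 : R) + x) - f x) @[h --> 0^'] --> l.
  by apply: DeriveDef; [apply: cvgP h|exact: cvg_lim h].
apply/cvgrPdist_le => e e0.
have K1 : 0 < `|K| + 1 by rewrite ltr_wpDl.
rewrite near_withinE; near=> h => h0.
have hs : `|h| <= e / (`|K| + 1).
  rewrite -[h]subr0 distrC; near: h; apply: (@cvgr_dist_le _ _ _ (nbhs 0) _ id 0) => //.
  by rewrite divr_gt0.
have := fK (h + x); rewrite addrK => hK.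
have -> : l - h^-1 *: (f (h *: 1 + x) - f x) = - (h^-1 * (f (h + x) - f x - l * h)).
  by rewrite /GRing.scale /= mulr1; field.
rewrite normrN normrM normfV mulrC ler_pdivrMr ?normr_gt0//.
apply: (le_trans hK); rewrite -real_normK ?num_real// expr2 mulrA ler_wpM2r//.
apply: (@le_trans _ _ ((`|K| + 1) * `|h|)).
  by rewrite ler_wpM2r// (le_trans (ler_norm K))// lerDl.
by rewrite mulrC -ler_pdivlMr.
Unshelve. all: by end_near. Qed.

Lemma SB_C11 (f : R -> R) : (forall n, SB setT n (fun _ : unit => f)) ->
  exists L, C11 f (derive1 f) L.
Proof.
move=> sf; have d n (x : R) : is_derive x 1 (derive1n (n) f) (derive1n (n.+1) f x).
  by rewrite derive1nS derive1E; apply: DeriveDef => //; exact: (SB_smooth sf n).1 tt x.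
have [_ [M1 b1]] := SB_smooth sf 1; have [_ [M2 b2]] := SB_smooth sf 2.
have {}b1 x : `|derive1 f x| <= M1 by exact: b1 tt x.
have {}b2 x : `|derive1n (2) f x| <= M2 by exact: b2 tt x.
have M10 : 0 <= M1 by exact: le_trans (b1 0).
have M20 : 0 <= M2 by exact: le_trans (b2 0).
exists (M1 + M2); split; first exact: addr_ge0.
- by move=> t; apply: (le_trans (b1 t)); lra.
- move=> s t; apply: (le_trans (mvt_bound _ _ (d 0%N) b1)).
  by apply: ler_wpM2r => //; lra.
- move=> s t; apply: (le_trans (mvt_bound _ _ (d 1%N) b2)).
  by apply: ler_wpM2r => //; lra.
- move=> s t; apply: (le_trans (taylor_bound s t (d 0%N) (d 1%N) b2)).
  by apply: ler_wpM2r; [exact: sqr_ge0|lra].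
Qed.
End Families.

(** * Smooth cutoffs *)

Section Bump.
Variable R : realType.

(** The functions [x ^- k * exp (- 1 / x)] for positive [x]: their span is stable
    under differentiation, so all their derivatives are treated at once. *)
Definition flat (k : nat) (x : R) : R :=
  if 0 < x then x^-1 ^+ k * expR (- x^-1) else 0.

Lemma flat_ge0 k x : 0 <= flat k x.
Proof.
rewrite /flat; case: ifPn => // x0.
by rewrite mulr_ge0 ?expR_ge0// exprn_ge0// invr_ge0 ltW.
Qed.

(** With [t = x^-1], [t ^+ k] is at most a constant times [expR t] because
    [t / (k + 1) <= expR (t / (k + 1))]. *)
Lemma flat_bound k : exists M, forall x, `|flat k x| <= M.
Proof.
exists (k.+1%:R ^+ k.+1 + 1) => x; rewrite ger0_norm ?flat_ge0// /flat.
have c0 : 0 <= k.+1%:R ^+ k.+1 :> R by rewrite exprn_ge0.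
case: ifPn => [x0|_]; last by lra.
set t := x^-1; have t0 : 0 < t by rewrite invr_gt0.
rewrite expRN ler_pdivrMr ?expR_gt0// mulrDl mul1r.
have e1 : 1 <= expR t by apply: le_trans (expR_ge1Dx _); lra.
have e0 : 0 < expR t by exact: expR_gt0.
have [t1|t1] := leP t 1.
  have tk : t ^+ k <= 1 by rewrite exprn_ile1// ltW.
  have : 0 <= k.+1%:R ^+ k.+1 * expR t by rewrite mulr_ge0// ltW.
  lra.
have -> : expR t = expR (t / k.+1%:R) ^+ k.+1.
  by rewrite -expRM_natl mulrC divfK.
apply: (@le_trans _ _ (k.+1%:R ^+ k.+1 * expR (t / k.+1%:R) ^+ k.+1)); last first.
  by rewrite lerDl exprn_ge0// expR_ge0.
rewrite -exprMn; apply: (@le_trans _ _ (t ^+ k.+1)).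
  by rewrite ler_weXn2l// ltW.
apply: lerXn2r; rewrite ?nnegrE; [exact: ltW|by rewrite mulr_ge0// expR_ge0|].
by rewrite mulrC -ler_pdivrMr//; apply: le_trans (expR_ge1Dx _); rewrite lerDr.
Qed.

(** At 0 the quotient [flat k y / y ^+ 2 = flat k.+2 y] is bounded, so the derivative
    vanishes there. *)
Lemma flat_derive k (x : R) :
  is_derive x 1 (flat k) (flat k.+2 x - k%:R * flat k.+1 x).
Proof.
have [x0|x0|x0] := ltrgtP 0 x.
- have h1 : is_derive x 1 (fun y : R => y^-1) (- x ^- 2 *: 1).
    by apply: is_deriveV; rewrite ?gt_eqF//; exact: is_derive_id.
  have h2 := is_deriveX k h1.
  have h3 : is_derive x 1 (fun y : R => - y^-1) (- (- x ^- 2 *: 1)) by exact: is_deriveN.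
  have h4 := @is_derive1_comp _ expR (fun y => - y^-1) x _ _ (is_derive_expR _) h3.
  have h5 := is_deriveM h2 h4.
  have PE y : ((fun y : R => y^-1) ^+ k) y = y^-1 ^+ k by rewrite exprfctE.
  apply: (@near_eq_is_derive _ _ _ ((fun y : R => y^-1) ^+ k * (expR \o (fun y => - y^-1)))).
    have op : open [set y : R | 0 < y] by exact: open_gt.
    by apply: filterS (open_nbhs_nbhs (conj op x0)) => y /= y0; rewrite /flat y0 fctE PE.
  apply: (is_derive_eq h5).
  rewrite /flat x0 /GRing.scale /= PE.
  case: k {h2 h5 PE} => [|k] /=; rewrite !exprS ?expr0; field; exact: lt0r_neq0.
- have -> : flat k.+2 x - k%:R * flat k.+1 x = 0.
    by rewrite /flat ltNge (ltW x0)/= mulr0 subr0.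
  have dc : is_derive x 1 (cst (0 : R)) 0 by exact: is_derive_cst.
  apply: near_eq_is_derive dc.
  have op : open [set y : R | y < 0] by exact: open_lt.
  by apply: filterS (open_nbhs_nbhs (conj op x0)) => y /= y0; rewrite /flat ltNge (ltW y0).
- have [M MP] := flat_bound k.+2; rewrite -x0.
  have -> : flat k.+2 0 - k%:R * flat k.+1 0 = 0 by rewrite /flat ltxx mulr0 subr0.
  apply: (@quad_is_derive _ _ _ _ M) => y.
  have -> : flat k 0 = 0 by rewrite /flat ltxx.
  rewrite mul0r !subr0.
  have -> : flat k y = y ^+ 2 * flat k.+2 y.
    rewrite /flat; case: ifPn => [y0|_]; last by rewrite mulr0.
    by rewrite !exprS; field; exact: lt0r_neq0.
  by rewrite normrM ger0_norm ?sqr_ge0// mulrC ler_wpM2r ?sqr_ge0.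
Qed.

Lemma flat_SB n k : SB setT n (fun _ : unit => flat k).
Proof.
have bd j : exists M : R, forall (i : unit) x, setT x -> `|flat j x| <= M.
  by have [M MP] := flat_bound j; exists M.
elim: n k => [|n IH] k; first by split.
split => //; exists (fun _ x => flat k.+2 x - k%:R * flat k.+1 x); split.
  by move=> _ x _; exact: flat_derive.
apply: SBD => //; apply: SBN; apply: SBM => //.
by apply: (@SB_cst _ _ _ _ (fun=> k%:R) `|k%:R|).
Qed.

Definition step (x : R) : R := flat 0 x * (flat 0 x + flat 0 (1 - x))^-1.

Lemma step_den x : expR (- 2) <= flat 0 x + flat 0 (1 - x).
Proof.
have half y : 2^-1 <= y -> expR (- 2) <= flat 0 y.
  move=> y2; have y0 : 0 < y by apply: lt_le_trans y2.
  rewrite /flat y0 expr0 mul1r ler_expR lerN2.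
  by rewrite -[leRHS]invrK lef_pV2 ?posrE.
have [x2|x2] := leP 2^-1 x.
  by apply: (le_trans (half x x2)); rewrite lerDl flat_ge0.
have x2' : 2^-1 <= 1 - x by lra.
by apply: (le_trans (half _ x2')); rewrite lerDr flat_ge0.
Qed.

Lemma step_SB n : SB setT n (fun _ : unit => step).
Proof.
have s0 := flat_SB n 0.
apply: SBM => //; apply: (@SBV _ _ _ _ _ (expR (-2))); [exact: expR_gt0| |].
  by move=> i x _; rewrite ger0_norm ?step_den// addr_ge0 ?flat_ge0.
apply: SBD => //.
have := SB_affine (-1) 1 s0.
suff -> : (fun (_ : unit) (x : R) => flat 0 (-1 * x + 1)) = (fun _ x => flat 0 (1 - x)) by [].
by apply/funext => i; apply/funext => x; congr flat; lra.
Qed.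

Lemma step_itv x : 0 <= step x <= 1.
Proof.
have d0 : 0 < flat 0 x + flat 0 (1 - x) by exact: lt_le_trans (expR_gt0 _) (step_den x).
rewrite /step divr_ge0 ?flat_ge0 ?(ltW d0)//= ler_pdivrMr// mul1r lerDl flat_ge0//.
Qed.

Lemma step0 x : x <= 0 -> step x = 0.
Proof. by move=> x0; rewrite /step /flat ltNge x0 mul0r. Qed.

Lemma step1 x : 1 <= x -> step x = 1.
Proof.
move=> x1; have E : flat 0 (1 - x) = 0 by rewrite /flat ltNge subr_le0 x1.
have := step_den x; rewrite /step E addr0 => h; rewrite divff//.
by rewrite gt_eqF//; exact: lt_le_trans (expR_gt0 _) h.
Qed.

Definition bump (x : R) : R := step (2 - x) * step (2 + x).

Lemma bump_SB n : SB setT n (fun _ : unit => bump).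
Proof.
have s1 := SB_affine (-1) 2 (step_SB n); have s2 := SB_affine 1 2 (step_SB n).
have := SBM s1 s2.
suff -> : (fun (_ : unit) (x : R) => step (-1 * x + 2) * step (1 * x + 2)) = (fun _ x => bump x) by [].
by apply/funext => i; apply/funext => x; congr (step _ * step _); lra.
Qed.

Lemma bump_itv x : 0 <= bump x <= 1.
Proof.
have /andP[a0 a1] := step_itv (2 - x); have /andP[b0 b1] := step_itv (2 + x).
by rewrite /bump mulr_ge0//= mulr_ile1.
Qed.

Lemma bump1 x : `|x| <= 1 -> bump x = 1.
Proof. by rewrite ler_norml => h; rewrite /bump !step1 ?mulr1//; lra. Qed.

Lemma bump0 x : 2 <= `|x| -> bump x = 0.
Proof.
rewrite ler_normr /bump => /orP[h|h]; first by rewrite step0 ?mul0r//; lra.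
by rewrite (step0 (x := 2 + x)) ?mulr0//; lra.
Qed.

Definition cutoff (x0 r x : R) : R := bump (r^-1 * x + - (r^-1 * x0)).

Lemma cutoff_SB x0 r n : SB setT n (fun _ : unit => cutoff x0 r).
Proof. exact: (SB_affine _ _ (bump_SB n)). Qed.

Lemma cutoff_itv x0 r x : 0 <= cutoff x0 r x <= 1.
Proof. exact: bump_itv. Qed.

Lemma cutoff1 x0 r x : 0 < r -> `|x - x0| <= r -> cutoff x0 r x = 1.
Proof.
move=> r0 h; apply: bump1; rewrite -mulrBr normrM gtr0_norm ?invr_gt0//.
by rewrite mulrC ler_pdivrMr// mul1r.
Qed.

Lemma cutoff0 x0 r x : 0 < r -> 2 * r <= `|x - x0| -> cutoff x0 r x = 0.
Proof.
move=> r0 h; apply: bump0; rewrite -mulrBr normrM gtr0_norm ?invr_gt0//.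
by rewrite mulrC ler_pdivlMr.
Qed.
End Bump.

(** * Series of smooth functions *)

Section GeometricSeries.
Variable R : realType.
Implicit Types (u : nat -> R).

Definition sumn_lim u : R := limn (series u).

Lemma geometric_cvg u M : (forall k, `|u k| <= M / 2 ^+ k) ->
  series u @ \oo --> sumn_lim u.
Proof.
move=> uM; apply: normed_cvg.
have M0 : 0 <= M by have := uM 0%N; rewrite expr0 divr1; exact: le_trans.
apply: (@series_le_cvg _ _ (geometric M 2^-1)).
- by move=> n; exact: normr_ge0.
- by move=> n; rewrite /geometric /= mulr_ge0// exprn_ge0.
- by move=> n; rewrite /geometric /= exprVn; exact: uM.
- by apply: is_cvg_geometric_series; rewrite ger0_norm// invf_lt1// ltr1n.
Qed.

(** Used with [m = 0] as a bound for the sum. *)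
Lemma geometric_tail u U m A : series u @ \oo --> U ->
  (forall k, (m <= k)%N -> `|u k| <= A / 2 ^+ k) ->
  `|U - series u m| <= 2 * A / 2 ^+ m.
Proof.
move=> cu uA.
have part n : (m <= n)%N -> `|series u n - series u m| <= 2 * A / 2 ^+ m - 2 * A / 2 ^+ n.
  elim: n => [|n IH]; first by rewrite leqn0 => /eqP ->; rewrite !subrr normr0.
  rewrite leq_eqVlt => /predU1P[->|mn]; first by rewrite !subrr normr0.
  have -> : series u n.+1 - series u m = (series u n - series u m) + u n.
    by rewrite /series /= big_nat_recr//= addrAC.
  apply: (le_trans (ler_normD _ _)); apply: (le_trans (lerD (IH mn) (uA _ mn))).
  rewrite le_eqVlt; apply/orP; left; apply/eqP; rewrite exprS.
  by field; rewrite !expf_neq0.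
have A0 : 0 <= A.
  by have := uA m (leqnn m) => h; have := le_trans (normr_ge0 _) h; rewrite pmulr_lge0// invr_gt0 exprn_gt0.
apply/ler_addgt0Pr => e e0.
move/cvgrPdist_le : cu => /(_ e e0) [n0 _ nP].
have := nP (maxn n0 m) (leq_maxl _ _) => h.
have h' := part (maxn n0 m) (leq_maxr _ _).
have -> : U - series u m = (U - series u (maxn n0 m)) + (series u (maxn n0 m) - series u m).
  by rewrite addrA subrK.
apply: (le_trans (ler_normD _ _)).
have : 0 <= 2 * A / 2 ^+ (maxn n0 m) by rewrite divr_ge0 ?mulr_ge0// exprn_ge0.
lra.
Qed.

Definition smoothR (f : R -> R) : Prop := forall n (x : R), derivable (derive1n n f) x 1.

Lemma smoothR_is_derive f : smoothR f ->
  forall n (x : R), is_derive x 1 (derive1n n f) (derive1n n.+1 f x).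
Proof. by move=> sf n x; rewrite derive1nS derive1E; apply: DeriveDef => //; exact: sf. Qed.

Lemma derive1nP (f : R -> R) (D : nat -> R -> R) : D 0%N = f ->
  (forall n (x : R), is_derive x 1 (D n) (D n.+1 x)) ->
  smoothR f /\ forall n, derive1n n f = D n.
Proof.
move=> D0 dD; have E n : derive1n n f = D n.
  elim: n => [|n IH]; first by rewrite D0.
  by rewrite derive1nS IH; apply/funext => x; rewrite derive1E; have [_ ->] := dD n x.
by split => // n x; rewrite E; have [] := dD n x.
Qed.

Lemma smoothR_D f g : smoothR f -> smoothR g ->
  smoothR (fun x => f x + g x) /\
  forall n, derive1n n (fun x => f x + g x) = (fun x => derive1n n f x + derive1n n g x).
Proof.
move=> sf sg; apply: (@derive1nP _ (fun n x => derive1n n f x + derive1n n g x)) => // n x.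
by apply: is_deriveD; exact: smoothR_is_derive.
Qed.

Lemma smoothR_Z (c : R) f : smoothR f ->
  smoothR (fun x => c * f x) /\
  forall n, derive1n n (fun x => c * f x) = (fun x => c * derive1n n f x).
Proof.
move=> sf; apply: (@derive1nP _ (fun n x => c * derive1n n f x)) => // n x.
by apply: is_deriveZ; exact: smoothR_is_derive.
Qed.

Lemma smoothR_0 : smoothR (fun=> 0).
Proof.
by have [] // := @derive1nP (fun=> 0) (fun _ _ => 0).
Qed.

(** Termwise differentiation: the second order Taylor remainders of the terms
    are summable, so their sum is the remainder of the sum. *)
Lemma series_smooth (f : nat -> R -> R) : (forall j, smoothR (f j)) ->
  (forall n, exists M, forall j x, `|derive1n n (f j) x| <= M / 2 ^+ j) ->
  smoothR (fun x => sumn_lim (fun j => f j x)).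
Proof.
move=> sf fM.
pose D n x := sumn_lim (fun j => derive1n n (f j) x).
suff : smoothR (D 0%N) by [].
have [] // := @derive1nP (D 0%N) D => n x.
have [M0 MP0] := fM n; have [M1 MP1] := fM n.+1; have [M2 MP2] := fM n.+2.
apply: (@quad_is_derive _ _ _ _ (2 * M2)) => y.
pose w j := derive1n n (f j) y - derive1n n (f j) x - derive1n n.+1 (f j) x * (y - x).
have cw : series w @ \oo --> D n y - D n x - D n.+1 x * (y - x).
  have -> : series w = (fun m => series (fun j => derive1n n (f j) y) m -
     series (fun j => derive1n n (f j) x) m -
     series (fun j => derive1n n.+1 (f j) x) m * (y - x)).
    by apply/funext => m; rewrite /series /= mulr_suml -!sumrB.
  apply: cvgB; first by apply: cvgB; apply: geometric_cvg.
  by apply: cvgMl; apply: geometric_cvg.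
have wM k : (0 <= k)%N -> `|w k| <= (M2 * (y - x) ^+ 2) / 2 ^+ k.
  move=> _; rewrite mulrAC; apply: taylor_bound => t.
  - exact: smoothR_is_derive.
  - exact: smoothR_is_derive.
  - exact: MP2.
have := geometric_tail cw wM.
by rewrite /series /= big_geq// subr0 expr0 divr1 mulrA.
Qed.
End GeometricSeries.

(** * Uniform boundedness on test functions *)

Section UniformBoundedness.
Variable R : realType.
Variable S : set R.

Definition testR (f : R -> R) : Prop := smoothR f /\ forall x, ~ S x -> f x = 0.

Lemma testR_D f g : testR f -> testR g -> testR (fun x => f x + g x).
Proof.
move=> [sf f0] [sg g0]; split; first exact: (smoothR_D sf sg).1.
by move=> x Sx; rewrite f0// g0// addr0.
Qed.

Lemma testR_Z c f : testR f -> testR (fun x => c * f x).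
Proof.
move=> [sf f0]; split; first exact: (smoothR_Z c sf).1.
by move=> x Sx; rewrite f0// mulr0.
Qed.

Lemma testR_0 : testR (fun=> 0).
Proof. by split => //; exact: smoothR_0. Qed.

Variables (N : R -> (R -> R) -> R) (B : R -> R) (h : R).
Hypothesis h0 : 0 < h.
Hypothesis N_D : forall y f g, 0 < y < h -> testR f -> testR g ->
  N y (fun x => f x + g x) <= N y f + N y g.
Hypothesis N_Z : forall y c f, 0 < y < h -> testR f ->
  N y (fun x => c * f x) = `|c| * N y f.
Hypothesis N_B : forall y f M, 0 < y < h -> testR f -> (forall x, `|f x| <= M) ->
  N y f <= B y * M.
Hypothesis B0 : forall y, 0 < y < h -> 0 <= B y.
Hypothesis N_pt : forall f, testR f ->
  exists C eta, 0 < eta /\ forall y, 0 < y < eta -> N y f <= C.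

Variables (I : Type) (psi : I -> R -> R).
Hypothesis psi_test : forall i, testR (psi i).
Hypothesis psi_bound : forall n, exists M, forall i x, `|derive1n n (psi i) x| <= M.

Lemma N_opp y f : 0 < y < h -> testR f -> N y (fun x => - f x) = N y f.
Proof.
move=> hy tf; rewrite -[RHS]mul1r -(normr1 R) -normrN -N_Z//; congr (N y _).
by apply/funext => x; rewrite mulN1r.
Qed.

(** The difference of [s + f] and [s - f] is [2 * f], so one of the two is at least as
    large as [f]. *)
Lemma N_sign y s f : 0 < y < h -> testR s -> testR f ->
  exists2 sg : R, `|sg| = 1 & N y f <= N y (fun x => s x + sg * f x).
Proof.
move=> hy ts tf; pose g sg x := s x + sg * f x.
have tg sg : testR (g sg) by apply: testR_D => //; exact: testR_Z.
have : 2 * N y f <= N y (g 1) + N y (g (-1)).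
  rewrite -(N_opp hy (tg (-1))) -[2]ger0_norm// -N_Z//.
  have -> : (fun x => 2 * f x) = (fun x => g 1 x + - g (-1) x).
    by apply/funext => x; rewrite /g; ring.
  apply: N_D => //.
  have -> : (fun x => - g (-1) x) = (fun x => -1 * g (-1) x).
    by apply/funext => x; rewrite mulN1r.
  exact: testR_Z.
have [a|a] := leP (N y f) (N y (g 1)); first by exists 1; rewrite ?normr1.
by exists (-1); rewrite ?normrN ?normr1// -/(g (-1)); lra.
Qed.

(** The uniform boundedness principle, by a gliding hump: were the conclusion
    false, signs, members of the family and heights could be chosen so that the
    partial sums of a convergent series of multiples of the members are larger
    and larger at heights tending to 0, while the coefficients decrease so fast
    that the later terms are harmless at the earlier heights; the sum of the
    series would contradict [N_pt]. *)
Theorem uniform_boundedness : exists C eta, 0 < eta /\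
  forall i y, 0 < y < eta -> N y (psi i) <= C.
Proof.
apply: contrapT => nC.
have big C eta : 0 < eta -> exists i y, 0 < y < eta /\ C < N y (psi i).
  move=> eta0; apply: contrapT => nex; apply: nC; exists C, eta; split => // i y hy.
  by rewrite leNgt; apply/negP => lt; apply: nex; exists i, y.
have [M0' psiM'] := psi_bound 0.
pose M0 := `|M0'| + 1.
have M00 : 0 < M0 by rewrite /M0 ltr_wpDl.
have psiM i x : `|psi i x| <= M0.
  apply: (le_trans (psiM' i x)); apply: (le_trans (ler_norm _)); by rewrite lerDl.
(* The second component of the state bounds the effect at the earlier heights of
   functions of size [M0]; [coef] makes the later terms small in comparison. *)
pose coef (j : nat) (b : R) := (1 + b)^-1 / 2 ^+ j.
pose hump (st : (R -> R) * R) (j : nat) (fy : (R -> R) * R) := testR st.1 -> 0 <= st.2 ->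
  [/\ exists i, exists2 sg : R, `|sg| = 1 & fy.1 = (fun x => sg * (coef j st.2 * psi i x)),
      0 < fy.2 < h, fy.2 < j.+1%:R^-1 & j.+2%:R <= N fy.2 (fun x => st.1 x + fy.1 x)].
have step (st : (R -> R) * R * nat) : exists fy, hump st.1 st.2 fy.
  case: st => [[s b] j] /=.
  have [[ts b0]|nb] := pselect (testR s /\ 0 <= b); last first.
    by exists (s, b) => ts b0; exfalso; apply: nb.
  have c0 : 0 < coef j b by rewrite divr_gt0 ?invr_gt0 ?exprn_gt0//; lra.
  have m0 : 0 < Num.min h (j.+1%:R^-1) by rewrite lt_min h0 invr_gt0 ltr0n.
  have [i [y [/andP[y0]]]] := big (j.+2%:R / coef j b) _ m0.
  rewrite lt_min => /andP[yh yj]; rewrite ltr_pdivrMr// => large.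
  have hy : 0 < y < h by rewrite y0.
  have tc : testR (fun x => coef j b * psi i x) by exact: testR_Z.
  have [sg sg1 sgP] := N_sign hy ts tc.
  exists (fun x => sg * (coef j b * psi i x), y) => _ _; split => //=.
    by exists i, sg.
  apply: (le_trans (ltW large)); apply: le_trans sgP.
  by rewrite N_Z// gtr0_norm// mulrC.
have [nxt nxtP] := choice step.
pose st := fix st j : (R -> R) * R := if j is k.+1 then
  let fy := nxt (st k, k) in
  ((fun x => (st k).1 x + fy.1 x), (st k).2 + B fy.2 * M0) else ((fun=> 0), 0).
pose f j := (nxt (st j, j)).1; pose y j := (nxt (st j, j)).2; pose b j := (st j).2.
have inv j : testR (st j).1 /\ 0 <= b j.
  elim: j => [|j [ts b0]]; first by split => //=; exact: testR_0.
  have [[i [sg _ fE]] hy _ _] := nxtP (st j, j) ts b0; split.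
    by apply: testR_D => //=; rewrite fE; apply/testR_Z/testR_Z.
  by apply: addr_ge0 => //; apply: mulr_ge0; [exact: B0|exact: ltW].
have P j : [/\ exists i, exists2 sg : R, `|sg| = 1 &
      f j = (fun x => sg * (coef j (b j) * psi i x)),
      0 < y j < h, y j < j.+1%:R^-1 & j.+2%:R <= N (y j) (st j.+1).1].
  exact: nxtP (st j, j) (inv j).1 (inv j).2.
have cb j : 0 < 1 + b j by rewrite ltr_wpDr// (inv j).2.
have cpos j : 0 < coef j (b j) by rewrite divr_gt0 ?invr_gt0 ?exprn_gt0.
have nrm k sg a : `|sg| = 1 -> `|sg * (coef k (b k) * a)| = coef k (b k) * `|a|.
  by move=> sg1; rewrite normrM sg1 mul1r normrM (gtr0_norm (cpos k)).
have tf j : testR (f j).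
  by have [[i [sg _ fE]] _ _ _] := P j; rewrite fE; apply/testR_Z/testR_Z.
have bS j : b j.+1 = b j + B (y j) * M0 by [].
have bmono j k : (j <= k)%N -> b j <= b k.
  apply: (nondecreasing_seqP b).1 => n.
   rewrite bS lerDl; have [_ hy _ _] := P n.
  by apply: mulr_ge0; [exact: B0|exact: ltW].
have coef_le j : coef j (b j) <= (2 ^+ j)^-1.
  rewrite /coef ler_piMl ?invr_ge0 ?exprn_ge0// invf_le1//.
  by rewrite lerDl (inv j).2.
have fbound n : exists M, forall j x, `|derive1n n (f j) x| <= M / 2 ^+ j.
  have [M MP] := psi_bound n; exists M => j x.
  have [[i [sg sg1 fE]] _ _ _] := P j.
  have sp : smoothR (psi i) by case: (psi_test i).
  have sc := smoothR_Z (coef j (b j)) sp; have ss := smoothR_Z sg sc.1.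
  rewrite fE ss.2 sc.2 nrm// mulrC.
  apply: (le_trans (ler_wpM2r (ltW (cpos j)) (MP i x))).
  by apply: ler_wpM2l => //; exact: le_trans (MP i x).
have stE j x : (st j).1 x = series (fun k => f k x) j.
  elim: j => [|j IH]; first by rewrite /series /= big_geq.
  by rewrite /series /= big_nat_recr//=; congr (_ + _); exact: IH.
pose phi x := sumn_lim (fun k => f k x).
have [Mf MfP] := fbound 0%N.
have tphi : testR phi.
  split; first by apply: series_smooth => // j; case: (tf j).
  move=> x Sx; have cx := geometric_cvg (fun j => MfP j x).
  have z k : (0 <= k)%N -> `|f k x| <= 0 / 2 ^+ k.
    by move=> _; rewrite (tf k).2// normr0 mul0r.
  have := geometric_tail cx z; rewrite /series /= big_geq// subr0 mulr0 mul0r normr_le0.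
  by move=> /eqP.
have tail j x : `|phi x - (st j).1 x| <= 2 * (M0 / (1 + b j)) / 2 ^+ j.
  rewrite stE; apply: geometric_tail (geometric_cvg (fun j => MfP j x)) _ => k jk.
  have [[i [sg sg1 fE]] _ _ _] := P k.
  rewrite fE nrm// mulrC.
  apply: (@le_trans _ _ (M0 * coef k (b k))).
    by apply: ler_wpM2r; [exact: ltW|exact: psiM].
  rewrite /coef mulrA; apply: ler_wpM2r; first by rewrite invr_ge0 exprn_ge0.
  apply: ler_wpM2l; first exact: ltW.
  by rewrite lef_pV2 ?posrE// lerD2l bmono.
have [C [eta [eta0 CP]]] := N_pt tphi.
(* At the step [j] the height is below [eta] and the value exceeds [C] by 1. *)
pose j := (Num.truncn (`|C| + eta^-1)).+1.
have jC : `|C| + eta^-1 < j%:R by exact: truncnS_gt.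
have eta1 : 0 < eta^-1 by rewrite invr_gt0.
have [_ hy yj large] := P j.
have yeta : 0 < y j < eta.
  have /andP[y0 _] := hy; rewrite y0 /=; apply: (lt_le_trans yj).
  rewrite -[leRHS]invrK lef_pV2 ?posrE// ?ltr0n//.
  have : 0 <= `|C| by [].
  rewrite -natr1; lra.
have NC := CP _ yeta.
have tst := (inv j.+1).1.
have tdiff : testR (fun x => (st j.+1).1 x - phi x).
  have -> : (fun x => (st j.+1).1 x - phi x) = (fun x => (st j.+1).1 x + -1 * phi x).
    by apply/funext => x; rewrite mulN1r.
  by apply: testR_D => //; exact: testR_Z.
have N1 : N (y j) (st j.+1).1 <= N (y j) phi + N (y j) (fun x => (st j.+1).1 x - phi x).
  have -> : (st j.+1).1 = (fun x => phi x + ((st j.+1).1 x - phi x)).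
    by apply/funext => x; rewrite addrC subrK.
  rewrite [X in _ <= _ + N _ X](_ : _ = (fun x => (st j.+1).1 x - phi x)); last first.
    by apply/funext => x /=; rewrite [phi x + _]addrC subrK.
  exact: N_D.
have N2 : N (y j) (fun x => (st j.+1).1 x - phi x) <= 1.
  apply: (le_trans (N_B hy tdiff (M := 2 * (M0 / (1 + b j.+1)) / 2 ^+ j.+1) _)).
    by move=> x; rewrite distrC; exact: tail.
  have -> : B (y j) * (2 * (M0 / (1 + b j.+1)) / 2 ^+ j.+1) =
    ((B (y j) * M0) / (1 + b j.+1)) / 2 ^+ j.
    have aux (p r : R) : 0 < r -> p * (2 * (M0 / r) / 2 ^+ j.+1) = (p * M0 / r) / 2 ^+ j.
      by move=> r0; rewrite exprS; field; rewrite expf_neq0// gt_eqF.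
    exact: aux.
  rewrite ler_pdivrMr ?exprn_gt0// mul1r; apply: (@le_trans _ _ 1); last first.
    by rewrite exprn_ege1// ler1n.
  rewrite ler_pdivrMr// mul1r bS; have := (inv j).2; lra.
have lj : j.+2%:R <= N (y j) (st j.+1).1 by exact: large.
have : C <= `|C| by exact: ler_norm.
move: lj; rewrite -2!natr1; lra.
Qed.
End UniformBoundedness.

(** * Families of complex test functions *)

Section ComplexFamilies.
Variable R : realType.
Local Notation C := R[i].
Implicit Types (O : set R) (n : nat).

Definition CSB (I : Type) O n (f : I -> R -> C) : Prop :=
  SB O n (fun i x => complex.Re (f i x)) /\ SB O n (fun i x => complex.Im (f i x)).

Lemma CSB_eq I O n (f g : I -> R -> C) : (forall i x, f i x = g i x) -> CSB O n f -> CSB O n g.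
Proof.
by move=> fg; have -> : f = g by apply/funext => i; apply/funext.
Qed.

Lemma CSB_cst I O n (c : I -> C) M : (forall i, normc (c i) <= M) ->
  CSB O n (fun i _ => c i).
Proof.
move=> cM; split; apply: (@SB_cst _ _ _ _ _ M) => i; apply: le_trans (cM i).
  exact: Re_le_normc.
exact: Im_le_normc.
Qed.

Lemma CSB_D I O n (f g : I -> R -> C) : CSB O n f -> CSB O n g ->
  CSB O n (fun i x => f i x + g i x).
Proof.
move=> [fr fi] [gr gi]; split.
  under eq_fun do under eq_fun do rewrite cReD; exact: SBD.
under eq_fun do under eq_fun do rewrite cImD; exact: SBD.
Qed.

Lemma CSB_M I O n (f g : I -> R -> C) : CSB O n f -> CSB O n g ->
  CSB O n (fun i x => f i x * g i x).
Proof.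
move=> [fr fi] [gr gi]; split.
  under eq_fun do under eq_fun do rewrite cReM.
  by apply: SBD; [exact: SBM|apply: SBN; exact: SBM].
under eq_fun do under eq_fun do rewrite cImM.
by apply: SBD; exact: SBM.
Qed.

Lemma CSB_X I O n (f : I -> R -> C) k : CSB O n f -> CSB O n (fun i x => f i x ^+ k).
Proof.
move=> sf; elim: k => [|k IH].
  by apply: (@CSB_cst _ _ _ (fun=> 1) 1) => i; rewrite Normc.normc1.
apply: (@CSB_eq _ _ _ (fun i x => f i x * f i x ^+ k)); last exact: CSB_M.
by move=> i x; rewrite exprS.
Qed.

Lemma CSB_V I O n (f : I -> R -> C) c : 0 < c ->
  (forall i x, O x -> c <= normc (f i x)) -> CSB O n f ->
  CSB O n (fun i x => (f i x)^-1).
Proof.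
move=> c0 fc [fr fi].
have sq : SB O n (fun i x => (complex.Re (f i x) ^+ 2 + complex.Im (f i x) ^+ 2)^-1).
  apply: (@SBV _ _ _ _ _ (c ^+ 2)); first by rewrite exprn_gt0.
    move=> i x Ox; rewrite -sqr_normcE ger0_norm ?sqr_ge0//.
    by apply: lerXn2r; rewrite ?nnegrE ?normc_ge0 ?(ltW c0)//; exact: fc.
  under eq_fun do under eq_fun do rewrite !expr2.
  by apply: SBD; exact: SBM.
split.
  under eq_fun do under eq_fun do rewrite cReV; exact: SBM.
under eq_fun do under eq_fun do rewrite cImV.
by apply: SBM => //; exact: SBN.
Qed.

Lemma CSB_real I O n (f : I -> R -> R) : SB O n f -> CSB O n (fun i x => (f i x)%:C).
Proof.
move=> sf; split => //.
by apply: (@SB_cst _ _ _ _ (fun=> 0) 0) => i; rewrite normr0.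
Qed.

Lemma CSB_line I O n (v : I -> R) (c : I -> C) (M K : R) :
  (forall x, O x -> `|x| <= M) -> (forall i, `|v i| <= K) -> (forall i, normc (c i) <= K) ->
  CSB O n (fun i x => (x +i* v i) - c i).
Proof.
move=> OM vK cK.
have sv : CSB O n (fun i _ => (0 +i* v i) - c i : C).
  apply: (@CSB_cst _ _ _ _ (K + K)) => i; apply: (le_trans (normcB _ _)).
  apply: lerD => //; rewrite normcE2 /= expr0n /= add0r sqrtr_sqr; exact: vK.
apply: (@CSB_eq _ _ _ (fun i x => x%:C + ((0 +i* v i) - c i))).
  by move=> i x; rewrite addrA; congr (_ - _); apply: eq_ReIm => /=; lra.
by apply: CSB_D => //; apply: (@CSB_real _ _ _ (fun _ x => x)); exact: SB_id OM.
Qed.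

Lemma CSB_subset I O O' n (f : I -> R -> C) : O' `<=` O -> CSB O n f -> CSB O' n f.
Proof. by move=> OO [fr fi]; split; exact: SB_subset OO _. Qed.

(** A product with a cutoff is controlled where the cutoff lives, and this suffices. *)
Lemma CSB_extend I O S n (f : I -> R -> C) : open O -> closed S -> S `<=` O ->
  (forall i x, ~ S x -> f i x = 0) -> CSB O n f -> CSB setT n f.
Proof.
by move=> oO cS SO f0 [fr fi]; split; apply: (SB_extend oO cS SO) => // i x nS; rewrite f0.
Qed.
End ComplexFamilies.

Section Pairing.
Variable R : realType.
Local Notation C := R[i].
Variables (F : C -> C) (g : R -> C) (c d h : R).
Hypothesis cd : c <= d.
Hypothesis h0 : 0 < h.
Hypothesis dF : forall u v : R, c <= u <= d -> 0 < v < h -> cdiff F (u +i* v).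
Hypothesis bg : bounded_meas `[c, d] g.
Local Notation K := (`[c, d]%classic : set R).
Hypothesis Fg : forall phi : R -> R, testR K phi -> forall e : R, 0 < e ->
  exists2 eta : R, 0 < eta & forall y : R, 0 < y < eta ->
  normc (ci K (fun u => (phi u)%:C * F (u +i* y)) -
         ci K (fun u => (phi u)%:C * g u)) <= e.

Lemma F_bm y : 0 < y < h -> bounded_meas K (fun u => F (u +i* y)).
Proof.
by move=> hy; apply: rcont_bm => // u hu; apply/ccont_hor/cdiff_ccont/dF.
Qed.

Lemma smoothR_bm (phi : R -> R) (a b : R) : a <= b -> smoothR phi ->
  bounded_meas `[a, b] (fun u => (phi u)%:C : C).
Proof.
move=> ab sp; apply: rcont_bm => // u _; apply: rcont_real.
apply: differentiable_continuous; apply/derivable1_diffP; exact: (sp 0%N u).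
Qed.

(** For each test function the integrals over the lines at height [y] converge, so
    they are bounded for small [y]; at a fixed height they are bounded by a multiple of
    the maximum. The uniform boundedness principle applies to their moduli. *)
Lemma pairing_uniform_real (I : Type) (psi : I -> R -> R) :
  (forall i, testR K (psi i)) ->
  (forall n, exists M, forall i x, `|derive1n n (psi i) x| <= M) ->
  exists C0 eta, 0 < eta /\ forall i y, 0 < y < eta ->
    normc (ci K (fun u => (psi i u)%:C * F (u +i* y))) <= C0.
Proof.
move=> tpsi bpsi.
have hM (y : R) : exists M, 0 < y < h -> 0 <= M /\ forall x, c <= x <= d -> normc (F (x +i* y)) <= M.
  have [hy|nhy] := boolP (0 < y < h); last by exists 0.
  by have [M M0 MP] := bm_bound (F_bm hy); exists M => _; split => //; exact: ltW.
have [M MP] := choice hM.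
pose N (y : R) (f : R -> R) := normc (ci K (fun u => (f u)%:C * F (u +i* y))).
have bfF f y : 0 < y < h -> testR K f -> bounded_meas K (fun u => (f u)%:C * F (u +i* y)).
  by move=> hy [sf _]; apply: bmM; [exact: smoothR_bm|exact: F_bm].
apply: (@uniform_boundedness R K N (fun y => 2 * M y * (d - c)) h h0) => //.
- move=> y f f' hy tf tf'; rewrite /N.
  have -> : ci K (fun u => (f u + f' u)%:C * F (u +i* y)) =
     ci K (fun u => (f u)%:C * F (u +i* y)) + ci K (fun u => (f' u)%:C * F (u +i* y)).
    rewrite -ciD; [|exact: bfF|exact: bfF].
    by apply: ci_eq => u _; rewrite -realcD mulrDl.
  exact: normcD.
- move=> y k f hy tf; rewrite /N.
  have -> : ci K (fun u => (k * f u)%:C * F (u +i* y)) =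
     k%:C * ci K (fun u => (f u)%:C * F (u +i* y)).
    rewrite -ciZ; last exact: bfF.
    by apply: ci_eq => u _; rewrite -realcM mulrA.
  by rewrite Normc.normcM normc_real.
- move=> y f A hy tf fA; have [M0 MF] := MP y hy.
  have -> : 2 * M y * (d - c) * A = 2 * (A * M y) * (d - c) by ring.
  apply: ci_le => //; first exact: bfF.
  move=> x hx; rewrite Normc.normcM normc_real.
  by apply: ler_pM; rewrite ?normr_ge0 ?normc_ge0//; exact: MF.
- move=> y hy; have [M0 _] := MP y hy; rewrite !mulr_ge0// subr_ge0//.
- move=> f tf; have [eta eta0 P] := Fg tf ltr01.
  exists (1 + normc (ci K (fun u => (f u)%:C * g u))), eta; split => // y hy.
  have := P y hy; have := normcB_ge (ci K (fun u => (f u)%:C * F (u +i* y)))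
    (ci K (fun u => (f u)%:C * g u)).
  rewrite /N; lra.
Qed.

Lemma split_ReIm (f : R -> C) (G : R -> C) :
  bounded_meas K (fun u => (complex.Re (f u))%:C : C) ->
  bounded_meas K (fun u => (complex.Im (f u))%:C : C) -> bounded_meas K G ->
  ci K (fun u => f u * G u) = ci K (fun u => (complex.Re (f u))%:C * G u) +
     'i * ci K (fun u => (complex.Im (f u))%:C * G u).
Proof.
move=> br bi bG; rewrite -ciZ; last exact: bmM.
rewrite -ciD; [|exact: bmM|by apply: bmM; [exact: bm_cst|exact: bmM]].
by apply: ci_eq => u _; rewrite mulrA -mulrDl -complexE.
Qed.

Lemma CSB_testR (I : Type) (f : I -> R -> C) : (forall n, CSB setT n f) ->
  (forall i x, ~ K x -> f i x = 0) ->
  forall i, testR K (fun x => complex.Re (f i x)) /\ testR K (fun x => complex.Im (f i x)).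
Proof.
move=> sf f0 i; split; split.
- by move=> n; exact: (SB_smooth (fun m => (sf m).1) n).1 i.
- by move=> x Kx; rewrite f0.
- by move=> n; exact: (SB_smooth (fun m => (sf m).2) n).1 i.
- by move=> x Kx; rewrite f0.
Qed.

Lemma pairing_uniform (I : Type) (f : I -> R -> C) : (forall n, CSB setT n f) ->
  (forall i x, ~ K x -> f i x = 0) ->
  exists C0 eta, 0 < eta /\ forall i y, 0 < y < eta ->
    normc (ci K (fun u => f i u * F (u +i* y))) <= C0.
Proof.
move=> sf f0; have tf := CSB_testR sf f0.
have [C1 [e1 [e10 P1]]] := pairing_uniform_real (fun i => (tf i).1)
  (fun n => (SB_smooth (fun m => (sf m).1) n).2).
have [C2 [e2 [e20 P2]]] := pairing_uniform_real (fun i => (tf i).2)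
  (fun n => (SB_smooth (fun m => (sf m).2) n).2).
exists (C1 + C2), (Num.min h (Num.min e1 e2)).
split; first by rewrite !lt_min h0 e10 e20.
move=> i y /andP[y0]; rewrite !lt_min => /andP[yh /andP[ye1 ye2]].
have hy : 0 < y < h by rewrite y0.
rewrite split_ReIm; last exact: F_bm.
- apply: (le_trans (normcD _ _)); rewrite Normc.normcM normc_i mul1r.
  by apply: lerD; [apply: P1|apply: P2]; rewrite y0.
- by apply: smoothR_bm => //; case: (tf i).1.
- by apply: smoothR_bm => //; case: (tf i).2.
Qed.

(** The convergence [Fg] for real test functions extends to complex ones. *)
Lemma pairing_cvg (f : R -> C) : (forall n, CSB setT n (fun _ : unit => f)) ->
  (forall x, ~ K x -> f x = 0) -> forall e, 0 < e ->
  exists2 eta, 0 < eta & forall y, 0 < y < eta ->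
    normc (ci K (fun u => f u * F (u +i* y)) - ci K (fun u => f u * g u)) <= e.
Proof.
move=> sf f0 e e0; have [tr ti] := CSB_testR sf (fun _ => f0) tt.
have e2 : 0 < e / 2 by rewrite divr_gt0.
have [e1 e10 P1] := Fg tr e2; have [e3 e30 P2] := Fg ti e2.
exists (Num.min h (Num.min e1 e3)); first by rewrite !lt_min h0 e10 e30.
move=> y /andP[y0]; rewrite !lt_min => /andP[yh /andP[ye1 ye2]].
have hy : 0 < y < h by rewrite y0.
have br : bounded_meas K (fun u => (complex.Re (f u))%:C : C).
  by apply: smoothR_bm => //; case: tr.
have bi : bounded_meas K (fun u => (complex.Im (f u))%:C : C).
  by apply: smoothR_bm => //; case: ti.
rewrite (split_ReIm br bi (F_bm hy)) (split_ReIm br bi bg).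
rewrite opprD addrACA -mulrBr; apply: (le_trans (normcD _ _)).
rewrite Normc.normcM normc_i mul1r [e]splitr.
by apply: lerD; [apply: P1|apply: P2]; rewrite y0.
Qed.
End Pairing.

(** * The kernel *)

Section Kernel.
Variable R : realType.
Local Notation C := R[i].

(** For [x0 = 0] and [r = 1], [mob] has its pole at [pole k] and its zero at
    [pole k - gap k]. Both are below the real line, and they are mirror images in the
    line [k * u + v = 0], to which [gap k] is normal. So [|mob| < 1] exactly below
    this line. *)
Definition pole (k : R) : C := (1 + k ^+ 2 / 2) +i* (- (k / 2)).
Definition gap (k : R) : C := (k ^+ 2) +i* k.

Definition mob (k x0 r : R) (w : C) : C :=
  1 + (r%:C * gap k) * (w - (x0%:C + r%:C * pole k))^-1.

(** [y * kern] is the difference of the Cauchy kernels at [z = x + iy] and at its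
    conjugate, multiplied by a power of [mob]. *)
Definition kern (k : R) (n : nat) (x0 r : R) (z w : C) : C :=
  mob k x0 r w ^+ n * (2 * 'i) * (w - z^*)^-1 * (w - z)^-1.

Lemma Im_pole k x0 r u v :
  complex.Im ((u +i* v) - (x0%:C + r%:C * pole k) : C) = v + r * (k / 2).
Proof. by rewrite /pole /=; lra. Qed.

Lemma Re_pole k x0 r u v :
  complex.Re ((u +i* v) - (x0%:C + r%:C * pole k) : C) = u - x0 - r * (1 + k ^+ 2 / 2).
Proof. by rewrite /pole /=; lra. Qed.

Lemma gap_le k : 0 < k -> normc (gap k) <= k * (k + 1).
Proof.
move=> k0; apply: (le_trans (normc_le_ReIm _)) => /=.
by rewrite !ger0_norm ?sqr_ge0 ?(ltW k0)// expr2; lra.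
Qed.

Lemma Im_neq0 (w : C) : complex.Im w != 0 -> w != 0.
Proof. by apply: contra => /eqP ->. Qed.

Lemma mob_bound k x0 r u v : 0 < k -> 0 < r -> 0 <= v ->
  normc (mob k x0 r (u +i* v)) <= 2 * k + 3.
Proof.
move=> k0 r0 v0; rewrite /mob; apply: (le_trans (normcD _ _)).
rewrite Normc.normc1 !Normc.normcM normc_real gtr0_norm// Normc.normcV.
have hd : r * (k / 2) <= normc ((u +i* v) - (x0%:C + r%:C * pole k)).
  apply: le_trans (Im_le_normc _); rewrite Im_pole; apply: le_trans (ler_norm _).
  by rewrite lerDr.
have rk0 : 0 < r * (k / 2) by rewrite mulr_gt0 ?divr_gt0.
suff : r * normc (gap k) / normc ((u +i* v) - (x0%:C + r%:C * pole k)) <= 2 * k + 2 by lra.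
rewrite ler_pdivrMr; last exact: lt_le_trans hd.
apply: (@le_trans _ _ ((2 * k + 2) * (r * (k / 2)))); last by apply: ler_wpM2l => //; lra.
have := ler_wpM2l (ltW r0) (gap_le k0); lra.
Qed.

Lemma mob_cdiff k x0 r u v : v + r * (k / 2) != 0 ->
  cdiff (mob k x0 r) (u +i* v).
Proof.
move=> v0; apply: cdiffD; first exact: cdiff_cst.
apply: cdiffM; first exact: cdiff_cst.
apply: cdiffV; first by apply: Im_neq0; rewrite Im_pole.
by apply: cdiffB; [exact: cdiff_id|exact: cdiff_cst].
Qed.

(** The point [x + iy], the scale [r] of [mob] and the height [v] of the line. *)
Definition kern_params (x0 rho h : R) (t : R * R * (R * R)) : Prop :=
  [/\ `|t.1.1 - x0| <= rho, 0 < t.1.2 <= rho, 0 < t.2.1 <= 2 * rho & 0 <= t.2.2 <= h].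

(** Away from [x0] the kernels form a bounded family of smooth functions of the
    abscissa, uniformly in the pole, the scale and the height. *)
Lemma kern_family k n x0 del h : 0 < k -> 0 < del -> 0 < h ->
  exists2 rho, 0 < rho & forall m,
  CSB [set u | del / 2 < `|u - x0| < 3 * del] m
    (fun (t : {t | kern_params x0 rho h t}) u =>
       let: ((x, y), (r, v)) := sval t in
       kern k n x0 r (x +i* y) (u +i* v)).
Proof.
move=> k0 del0 h0.
pose D := 8 * (1 + k ^+ 2 / 2).
have k20 : 0 <= k ^+ 2 by exact: sqr_ge0.
have D0 : 0 < D by rewrite /D; lra.
have [rho rho0 rhoD] : exists2 rho, 0 < rho & rho * 8 * (1 + k ^+ 2 / 2) = del.
  by exists (del / D); [rewrite divr_gt0|rewrite -mulrA -/D divfK// gt_eqF].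
exists rho => //.
have rho8 : rho * 8 <= del.
  have kk : 0 <= rho * 8 * (k ^+ 2 / 2) by rewrite !mulr_ge0// ltW.
  by move: rhoD; rewrite mulrDr mulr1; lra.
move=> m; pose O := [set u : R | del / 2 < `|u - x0| < 3 * del].
pose I := {t | kern_params x0 rho h t}; rewrite -/O.
have OM x : O x -> `|x| <= `|x0| + 3 * del.
  move=> /andP[_ /ltW]; have := ler_normD (x - x0) x0; rewrite subrK; lra.
have B0 : normc (pole k) + 1 > 0 by rewrite ltr_wpDl// normc_ge0.
pose K := h + `|x0| + 2 * rho * (normc (pole k) + 1).
have x00 : 0 <= `|x0| by [].
have p0 : 0 <= normc (pole k) by exact: normc_ge0.
have rp0 : 0 <= 2 * rho * normc (pole k) by rewrite mulr_ge0// mulr_ge0// ltW.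
have vK (t : I) : `|(sval t).2.2| <= K.
  have [_ _ _ /andP[v0 vh]] := svalP t; rewrite ger0_norm// /K; lra.
have inv (c : I -> C) : (forall t, normc (c t) <= K) ->
    (forall (t : I) u, O u -> del / 4 <= `|u - complex.Re (c t)|) ->
    CSB O m (fun t u => ((u +i* (sval t).2.2) - c t)^-1).
  move=> cK cRe; apply: (@CSB_V _ _ _ _ _ (del / 4)); first by rewrite divr_gt0.
    move=> t u Ou; apply: le_trans (Re_le_normc _); rewrite cReD cReN /=; exact: cRe.
  exact: CSB_line OM vK cK.
have far x u : `|x - x0| <= del / 4 -> O u -> del / 4 <= `|u - x|.
  move=> hx /andP[hu _]; have := ler_normD (u - x) (x - x0); rewrite addrA subrK; lra.
have czK (t : I) s : `|s| = 1 -> normc (((sval t).1.1 +i* (s * (sval t).1.2)) : C) <= K.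
  move=> s1; have [hx /andP[y0 yr] _ _] := svalP t.
  apply: (le_trans (normc_le_ReIm _)) => /=; rewrite normrM s1 mul1r (gtr0_norm y0).
  have := ler_normD ((sval t).1.1 - x0) x0; rewrite subrK /K; lra.
have c1 (s : R) : `|s| = 1 -> CSB O m (fun (t : I) u => ((u +i* (sval t).2.2) -
     ((sval t).1.1 +i* (s * (sval t).1.2)))^-1).
  move=> s1; apply: (inv (fun t => (sval t).1.1 +i* (s * (sval t).1.2))).
    by move=> t; exact: czK.
  move=> t u Ou /=; apply: far => //; have [hx _ _ _] := svalP t.
  by apply: (le_trans hx); lra.
have cp : CSB O m (fun (t : I) u => ((u +i* (sval t).2.2) -
     (x0%:C + (sval t).2.1%:C * pole k))^-1).
  apply: (inv (fun t => x0%:C + (sval t).2.1%:C * pole k)).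
    move=> t; have [_ _ /andP[r0 rr] _] := svalP t.
    apply: (le_trans (normcD _ _)); rewrite Normc.normcM !normc_real (gtr0_norm r0).
    have := ler_wpM2r p0 rr; rewrite /K; lra.
  move=> t u Ou; have [_ _ /andP[r0 rr] _] := svalP t.
  have -> : complex.Re (x0%:C + (sval t).2.1%:C * pole k : C) =
     x0 + (sval t).2.1 * (1 + k ^+ 2 / 2) by rewrite /pole /=; lra.
  apply: far => //; rewrite addrAC subrr add0r ger0_norm; last by rewrite mulr_ge0 ?(ltW r0)//; lra.
  have k1 : 0 <= 1 + k ^+ 2 / 2 by lra.
  have := ler_wpM2r k1 rr; lra.
have cm : CSB O m (fun (t : I) u => mob k x0 (sval t).2.1 (u +i* (sval t).2.2)).
  rewrite /mob; apply: CSB_D.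
    by apply: (@CSB_cst _ _ _ _ (fun=> 1) 1) => _; rewrite Normc.normc1.
  apply: CSB_M => //.
  apply: (@CSB_cst _ _ _ _ (fun t : I => (sval t).2.1%:C * gap k) (2 * rho * normc (gap k))).
  move=> t; have [_ _ /andP[r0 rr] _] := svalP t.
  by rewrite Normc.normcM normc_real gtr0_norm// ler_wpM2r// normc_ge0.
have := CSB_M (CSB_M (CSB_M (CSB_X n cm)
  (@CSB_cst _ I O m (fun=> 2 * 'i) (normc (2 * 'i)) (fun=> lexx _)))
  (c1 (-1) (normrN1 _))) (c1 1 (normr1 _)).
apply: CSB_eq => -[[[x y] [r v]] ht] u /=.
by rewrite /kern mulN1r mul1r.
Qed.
End Kernel.

(** * The contour away from the boundary *)

Section Poisson.
Variable R : realType.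
Local Notation C := R[i].

Lemma closed_annulus (x0 del : R) : closed [set u : R | del <= `|u - x0| <= 2 * del].
Proof.
have ct : continuous (fun u : R => `|u - x0|).
  by move=> t; apply: cvg_norm; apply: cvgB; [exact: cvg_id|exact: cvg_cst].
have -> : [set u : R | del <= `|u - x0| <= 2 * del] =
   (fun u : R => `|u - x0|) @^-1` `[del, 2 * del].
  by apply/seteqP; split => u /=; rewrite in_itv.
by apply: (@preimage_closed _ _ (fun u : R => `|u - x0|)); [move=> t _; exact: ct|exact: interval_closed].
Qed.

Lemma open_annulus (x0 a b : R) : open [set u : R | a < `|u - x0| < b].
Proof.
have ct : continuous (fun u : R => `|u - x0|).
  by move=> t; apply: cvg_norm; apply: cvgB; [exact: cvg_id|exact: cvg_cst].
have -> : [set u : R | a < `|u - x0| < b] = (fun u : R => `|u - x0|) @^-1` `]a, b[.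
  by apply/seteqP; split => u /=; rewrite in_itv.
by apply: (@open_comp _ _ (fun u : R => `|u - x0|)); [move=> t _; exact: ct|exact: interval_open].
Qed.

Lemma cutoff_derive0 (x0 del u : R) : 0 < del ->
  ~ (del <= `|u - x0| <= 2 * del) -> derive1 (cutoff x0 del) u = 0.
Proof.
move=> del0 hu; rewrite derive1E.
have dc (c a b : R) : a < `|u - x0| < b ->
    (forall t, a < `|t - x0| < b -> cutoff x0 del t = c) -> 'D_1 (cutoff x0 del) u = 0.
  move=> uab tab; have h : is_derive u 1 (cst c) 0 by exact: is_derive_cst.
  suff [_ ->] : is_derive u 1 (cutoff x0 del) 0 by [].
  apply: near_eq_is_derive h.
  have ou : [set t : R | a < `|t - x0| < b] u by [].
  by apply: filterS (open_nbhs_nbhs (conj (@open_annulus x0 a b) ou)) => t /tab ->.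
have n0 : 0 <= `|u - x0| by [].
have [h|h] := ltP `|u - x0| del.
  apply: (dc 1 (-1) del); first by rewrite h andbT; lra.
  by move=> t /andP[_ ht]; rewrite cutoff1// ltW.
have h2 : 2 * del < `|u - x0| by rewrite ltNge; apply/negP => h'; apply: hu; rewrite h.
apply: (dc 0 (2 * del) (`|u - x0| + 1)); first by rewrite h2 ltrDl ltr01.
by move=> t /andP[ht _]; rewrite cutoff0// ltW.
Qed.

Lemma kern_cdiff k n x0 r (x y u v : R) : v + r * (k / 2) != 0 -> v != - y ->
  cdiff (fun w => mob k x0 r w ^+ n * (2 * 'i) * (w - (x +i* y)^*)^-1) (u +i* v).
Proof.
move=> h1 h2; apply: cdiffM.
  by apply: cdiffM; [apply: cdiffX; exact: mob_cdiff|exact: cdiff_cst].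
apply: cdiffV.
  by apply: Im_neq0 => /=; rewrite opprK; apply: contra h2; rewrite addr_eq0.
by apply: cdiffB; [exact: cdiff_id|exact: cdiff_cst].
Qed.

Lemma line_smooth O m (v M : R) (c : C) : (forall u, O u -> `|u| <= M) ->
  v != complex.Im c -> CSB O m (fun (_ : unit) u => ((u +i* v) - c)^-1).
Proof.
move=> OM vc.
apply: (@CSB_V _ _ _ _ _ `|v - complex.Im c|).
- by rewrite normr_gt0 subr_eq0.
- by move=> _ u _; apply: le_trans (Im_le_normc _); rewrite cImD cImN.
- apply: (@CSB_line _ _ _ _ (fun=> v) (fun=> c) M (Num.max `|v| (normc c))) => // _.
    by rewrite le_max lexx.
  by rewrite le_max lexx orbT.
Qed.

Lemma kern_smooth O m k n x0 r (x y v M : R) : (forall u, O u -> `|u| <= M) ->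
  0 < k -> 0 < r -> 0 <= v -> v != - y -> v != y ->
  CSB O m (fun (_ : unit) u => kern k n x0 r (x +i* y) (u +i* v)).
Proof.
move=> OM k0 r0 v0 vy1 vy2.
have vp : v != complex.Im (x0%:C + r%:C * pole k).
  have -> : complex.Im (x0%:C + r%:C * pole k : C) = - (r * (k / 2)) by rewrite /pole /=; lra.
  by rewrite gt_eqF//; apply: lt_le_trans v0; rewrite oppr_lt0 mulr_gt0 ?divr_gt0.
apply: CSB_M; last exact: line_smooth OM _.
apply: CSB_M; last exact: line_smooth OM _.
apply: CSB_M; last by apply: (@CSB_cst _ _ _ _ (fun=> 2 * 'i) (normc (2 * 'i))).
apply: CSB_X; apply: CSB_D.
  by apply: (@CSB_cst _ _ _ _ (fun=> 1) 1) => _; rewrite Normc.normc1.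
apply: CSB_M; last exact: line_smooth OM _.
by apply: (@CSB_cst _ _ _ _ (fun=> r%:C * gap k) (normc (r%:C * gap k))).
Qed.

Variables (F : C -> C) (g : R -> C) (x0 del h : R).
Local Notation c := (x0 - 2 * del).
Local Notation d := (x0 + 2 * del).
Local Notation K := (`[c, d]%classic : set R).
Hypothesis del0 : 0 < del.
Hypothesis h0 : 0 < h.
Hypothesis dF : forall u v : R, c <= u <= d -> 0 < v < h -> cdiff F (u +i* v).
Hypothesis bg : bounded_meas K g.
Hypothesis Fg : forall phi : R -> R, testR K phi -> forall e : R, 0 < e ->
  exists2 eta : R, 0 < eta & forall y : R, 0 < y < eta ->
  normc (ci K (fun u => (phi u)%:C * F (u +i* y)) -
         ci K (fun u => (phi u)%:C * g u)) <= e.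

Local Notation chi := (cutoff x0 del).

Lemma notK u : ~ K u -> 2 * del < `|u - x0|.
Proof.
move=> nK; rewrite ltNge; apply/negP => le; apply: nK.
by rewrite /= in_itv /=; move: le; rewrite ler_norml; lra.
Qed.

(** The kernel and [F] are evaluated at independent heights [v] and [w], since [F] is
    later shifted upwards. The bound is uniform because the functions [chi'] times
    kernel, supported away from [x0], form a bounded family. *)
Lemma side_terms (k : R) n : 0 < k -> exists rho C0 eta : R, [/\ 0 < rho, 0 < eta &
  forall x y r v w, kern_params x0 rho h ((x, y), (r, v)) -> 0 < w < eta ->
  normc (ci K (fun u => (derive1 chi u)%:C *
     (kern k n x0 r (x +i* y) (u +i* v) * F (u +i* w)))) <= C0].
Proof.
move=> k0; have [rho rho0 famP] := kern_family n x0 k0 del0 h0.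
pose I := {t | kern_params x0 rho h t}.
pose f (t : I) u : C := (derive1 chi u)%:C *
   (let: ((x, y), (r, v)) := sval t in kern k n x0 r (x +i* y) (u +i* v)).
have cd : c <= d by have := del0; lra.
have f0 (t : I) u : ~ (del <= `|u - x0| <= 2 * del) -> f t u = 0.
  by move=> hu; rewrite /f cutoff_derive0// mul0r.
have sf m : CSB setT m f.
  apply: (CSB_extend (@open_annulus x0 (del / 2) (3 * del)) (@closed_annulus x0 del)) => //.
    by move=> u /=; have := del0; lra.
  apply: CSB_M; last exact: famP.
  apply: (@CSB_subset _ _ setT) => //; apply: CSB_real.
  have := SB_derive1n (cutoff_SB x0 del m.+1) (isT : (1 <= m.+1)%N).
  by rewrite subSS subn0 => /(SB_reindex (fun _ : I => tt)).
have fK (t : I) u : ~ K u -> f t u = 0.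
  by move=> /notK hu; apply: f0 => /andP[_]; rewrite leNgt hu.
have [C0 [eta [eta0 P]]] := pairing_uniform cd h0 dF Fg sf fK.
exists rho, C0, eta; split => // x y r v w ht hw.
have := P (exist _ _ ht) w hw.
rewrite (@ci_eq _ _ _ (fun u => (derive1 chi u)%:C *
  (kern k n x0 r (x +i* y) (u +i* v) * F (u +i* w))))// => u _.
by rewrite /f /= mulrA.
Qed.

(** On a line inside the domain [F] is bounded by continuity, and the kernel has its
    poles at a distance at least [Y / 2]. *)
Lemma top_bound (k : R) n (Y : R) : 0 < k -> 0 < Y < h -> exists C0 s0 : R, [/\ 0 < s0, 0 <= C0 &
  forall x y r w, 0 < y <= Y / 2 -> 0 < r -> `|w - Y| < s0 ->
  normc (ci K (fun u => (chi u)%:C *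
     (kern k n x0 r (x +i* y) (u +i* Y) * F (u +i* w)))) <= C0].
Proof.
move=> k0 hY; have cd : c <= d by have := del0; lra.
have [s1 s10 s1P] := ccont_tube cd ltr01 (fun u hu => cdiff_ccont (dF hu hY)).
have [M M0 MP] := bm_bound (F_bm cd dF hY).
have /andP[Y0 Yh] := hY.
pose A := 2 * k + 3; have A0 : 0 < A by rewrite /A; lra.
pose T := A ^+ n * 2 * (Y / 2)^-1 * (Y / 2)^-1.
have T0 : 0 <= T by rewrite /T !mulr_ge0 ?invr_ge0 ?divr_ge0 ?exprn_ge0// ltW.
exists (2 * (T * (M + 1)) * (d - c)), (Num.min s1 (Num.min Y (h - Y))); split.
- by rewrite !lt_min s10 Y0 subr_gt0.
- by rewrite mulr_ge0 ?subr_ge0// mulr_ge0// mulr_ge0// ltW// ltr_wpDl// ltW.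
move=> x y r w /andP[y0 yY] r0; rewrite !lt_min => /andP[ws /andP[wY whY]].
have hw : 0 < w < h by move: wY whY; rewrite !ltr_norml; lra.
have KM u : K u -> `|u| <= `|x0| + 2 * del.
  by rewrite /= in_itv /= => hu; rewrite ler_norml; have := ler_norm x0; have := ler_norm (- x0); rewrite normrN; lra.
have vy1 : Y != - y by rewrite gt_eqF//; lra.
have vy2 : Y != y by rewrite gt_eqF//; lra.
have chib : bounded_meas K (fun u => (chi u)%:C : C).
  have [L [_ _ pL _ _]] := SB_C11 (fun m => cutoff_SB x0 del m).
  exact: (real_lipschitz_bm cd pL).
have kb : bounded_meas K (fun u => kern k n x0 r (x +i* y) (u +i* Y)).
  apply: rcont_bm => // u hu; apply/ccont_hor/cdiff_ccont.
  apply: cdiff_divB; last by apply: contra vy2 => /eqP[_ ->].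
  by apply: kern_cdiff => //; rewrite gt_eqF// addr_gt0// mulr_gt0 ?divr_gt0.
apply: ci_le => //.
  by apply: bmM => //; apply: bmM => //; exact: (F_bm cd dF hw).
move=> u hu; rewrite !Normc.normcM normc_real.
have /andP[c0 c1] := cutoff_itv x0 del u.
rewrite ger0_norm// -[leRHS]mul1r; apply: ler_pM => //.
  by rewrite !mulr_ge0 ?normc_ge0.
have lineB (z : C) : Y / 2 <= `|Y - complex.Im z| -> normc ((u +i* Y) - z)^-1 <= (Y / 2)^-1.
  move=> hz; have hz' : Y / 2 <= normc ((u +i* Y) - z).
    by apply: (le_trans hz); apply: le_trans (Im_le_normc _); rewrite cImD cImN.
  by rewrite Normc.normcV lef_pV2 ?posrE ?divr_gt0//; apply: lt_le_trans hz'; rewrite divr_gt0.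
apply: ler_pM; rewrite ?mulr_ge0 ?normc_ge0//; last first.
  have -> : F (u +i* w) = (F (u +i* w) - F (u +i* Y)) + F (u +i* Y) by rewrite subrK.
  by apply: (le_trans (normcD _ _)); rewrite addrC; apply: lerD; [exact: MP|exact: s1P].
rewrite /T; apply: ler_pM; rewrite ?mulr_ge0 ?normc_ge0//; last first.
  by apply: lineB => /=; rewrite ger0_norm; lra.
apply: ler_pM; rewrite ?mulr_ge0 ?normc_ge0//; last first.
  by apply: lineB => /=; rewrite ger0_norm; lra.
rewrite normc_i mulr1 normcX; apply: ler_pM; rewrite ?exprn_ge0 ?normc_ge0//.
  apply: lerXn2r; rewrite ?nnegrE ?normc_ge0 ?(ltW A0)//.
  by apply: mob_bound => //; exact: ltW.
have -> : (2 : C) = (2 : R)%:C by rewrite mulr2n -realcD.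
by rewrite normc_real ger0_norm.
Qed.
End Poisson.

(** * The Poisson inequality *)

Section PoissonInequality.
Variable R : realType.
Local Notation C := R[i].
Variables (F : C -> C) (g : R -> C) (x0 del h : R).
Local Notation c := (x0 - 2 * del).
Local Notation d := (x0 + 2 * del).
Local Notation K := (`[c, d]%classic : set R).
Hypothesis del0 : 0 < del.
Hypothesis h0 : 0 < h.
Hypothesis dF : forall u v : R, c <= u <= d -> 0 < v < h -> cdiff F (u +i* v).
Hypothesis bg : bounded_meas K g.
Hypothesis Fg : forall phi : R -> R, testR K phi -> forall e : R, 0 < e ->
  exists2 eta : R, 0 < eta & forall y : R, 0 < y < eta ->
  normc (ci K (fun u => (phi u)%:C * F (u +i* y)) -
         ci K (fun u => (phi u)%:C * g u)) <= e.

Local Notation chi := (cutoff x0 del).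

Lemma chi_kern_smooth k n (x y r : R) m : 0 < k -> 0 < r -> 0 < y ->
  CSB setT m (fun _ : unit => fun u => (chi u)%:C * kern k n x0 r (x +i* y) (u +i* 0)).
Proof.
move=> k0 r0 y0; have del0' := del0.
have cK : closed K by exact: interval_closed.
apply: (CSB_extend (@open_annulus R x0 (-1) (3 * del)) cK).
- move=> u /=; rewrite in_itv /= => hu.
  have : `|u - x0| <= 2 * del by rewrite ler_norml; lra.
  have : 0 <= `|u - x0| by []. lra.
- by move=> _ u /notK hu; rewrite cutoff0 ?mul0r// ltW.
apply: CSB_M.
  by apply: (@CSB_subset _ _ setT) => //; apply: CSB_real; exact: cutoff_SB.
apply: (@kern_smooth _ _ _ _ _ _ _ _ _ _ (`|x0| + 3 * del)) => //.
- move=> u /= /andP[_ hu]; have := ler_normD (u - x0) x0; rewrite subrK; lra.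
- by rewrite eq_sym oppr_eq0 gt_eqF.
- by rewrite eq_sym gt_eqF.
Qed.

(** The Poisson inequality for [F (w + i eps)], which is analytic across the real
    line. The line [v = 0] is moved up to [y - s] and from [y + s] to [Y]; in between
    the jump at [z] is [2 * normc (E z)] at least, where
    [E z * y = F (z + i eps) * mob z ^+ n]. *)
Lemma poisson_shifted (k : R) n : 0 < k -> exists rho C0 s0 : R, [/\ 0 < rho, 0 <= C0, 0 < s0 &
  forall x y r eps : R, `|x - x0| <= rho -> 0 < y <= rho -> 0 < r <= 2 * rho ->
  0 < eps < s0 -> y + eps < h /\
  2 * normc (F (x +i* (y + eps)) * mob k x0 r (x +i* y) ^+ n) <=
  y * (normc (ci K (fun u => ((chi u)%:C * kern k n x0 r (x +i* y) (u +i* 0)) * F (u +i* eps))) + C0)].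
Proof.
move=> k0; have del0' := del0.
have [rho1 [C1 [eta [rho10 eta0 sideP]]]] := side_terms del0 h0 dF Fg n k0.
(* The height [Y] is fixed; it leaves room for [eps] below both [h] and [eta]. *)
pose Y := Num.min h eta / 2.
have Y0 : 0 < Y by rewrite divr_gt0// lt_min h0 eta0.
have Yh2 : 2 * Y <= h by rewrite /Y mulrC divfK// ge_min lexx.
have Yeta2 : 2 * Y <= eta by rewrite /Y mulrC divfK// ge_min lexx orbT.
have hY : 0 < Y < h by lra.
have [C2 [s1 [s10 C20 topP]]] := top_bound del0 dF n k0 hY.
clearbody Y.
pose rho := Num.min rho1 (Num.min (Y / 4) (del / 4)).
have rho0 : 0 < rho by rewrite !lt_min rho10 !divr_gt0.
have rho_1 : rho <= rho1 by rewrite ge_min lexx.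
have rho_Y : rho <= Y / 4 by rewrite !ge_min lexx orbT.
have rho_d : rho <= del / 4 by rewrite !ge_min lexx !orbT.
clearbody rho.
exists rho, (C2 + `|C1| * Y), (Num.min Y s1); split => //.
- by rewrite addr_ge0// mulr_ge0// ltW.
- by rewrite lt_min Y0 s10.
move=> x y r eps hx /andP[y0 yrho] /andP[r0 rrho] /andP[eps0].
rewrite lt_min => /andP[epsY epss]; split; first by lra.
have hx1 : `|x - x0| <= rho1 by exact: le_trans rho_1.
have y1 : 0 < y <= rho1 by rewrite y0 (le_trans yrho).
have r1 : 0 < r <= 2 * rho1 by rewrite r0 (le_trans rrho)//; lra.
have yY : y <= Y / 4 by exact: le_trans rho_Y.
have yY2 : 0 < y <= Y / 2 by lra.
have vh v : 0 <= v <= Y -> 0 <= v <= h /\ 0 < v + eps < eta /\ v + eps < h by lra.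
have vy v : `|v - y| <= y / 2 -> 0 <= v /\ v + eps < h by rewrite ler_norml; lra.
have cx : c <= x - del / 2 by move: hx; rewrite ler_norml; lra.
have xd : x + del / 2 <= d by move: hx; rewrite ler_norml; lra.
have sY s : 0 < s -> s < y -> y - s <= Y /\ 0 <= y + s /\ y + s <= Y by lra.
have xx0 u : x - del / 2 <= u <= x + del / 2 -> `|u - x0| <= del.
  by move: hx; rewrite !ler_norml; lra.
have cd : c <= d by lra.
have chic : chi c = 0 by rewrite cutoff0// ler_normr; apply/orP; right; lra.
have chid : chi d = 0 by rewrite cutoff0// ler_normr; apply/orP; left; lra.
have tri4 (z1 z2 z3 z4 : C) :
    normc (z1 - z4) <= normc (z1 - z2) + normc z2 + normc z3 + normc (z3 - z4).
  have -> : z1 - z4 = ((z1 - z2) + z2 - z3) + (z3 - z4) by ring.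
  apply: (le_trans (normcD _ _)); apply: lerD => //.
  by apply: (le_trans (normcB _ _)); apply: lerD => //; exact: normcD.
have sumup (m e s j p q a b : R) : 0 <= s -> m - e <= j -> j <= a + p + q + b ->
    a <= `|C1| * (y - s - 0) -> b <= `|C1| * (Y - (y + s)) -> q <= C2 ->
    m <= p + (C2 + `|C1| * Y) + e.
  move=> /(mulr_ge0 (normr_ge0 C1)); lra.
set z := x +i* y.
pose ie : C := 0 +i* eps.
pose E (w : C) : C := F (w + ie) * (mob k x0 r w ^+ n * (2 * 'i) * (w - z^*)^-1).
pose H (w : C) : C := E w * (w - z)^-1.
have shift u v : (u +i* v) + ie = u +i* (v + eps) :> C.
  by apply: eq_ReIm => /=; rewrite ?addr0.
have HE u v : H (u +i* v) = kern k n x0 r z (u +i* v) * F (u +i* (v + eps)).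
  by rewrite /H /E shift /kern; ring.
have rk0 : 0 < r * (k / 2) by rewrite mulr_gt0// divr_gt0.
have dE u v : c <= u <= d -> 0 <= v -> v + eps < h -> cdiff E (u +i* v).
  move=> hu v0 vh'; apply: cdiffM.
    by apply: cdiff_shift; rewrite shift; apply: dF => //; rewrite vh' andbT ltr_wpDl.
  by apply: kern_cdiff; rewrite gt_eqF//; [exact: ltr_wpDl|apply: lt_le_trans v0; rewrite oppr_lt0].
have dH u v : c <= u <= d -> 0 <= v -> v + eps < h -> v != y -> cdiff H (u +i* v).
  move=> hu v0 vh' vny; apply: cdiff_divB; first exact: dE.
  by apply: contra vny => /eqP[_ ->].
have [L LP] := SB_C11 (fun m => cutoff_SB x0 del m).
have [_ _ pL _ _] := LP.
pose Phi v := ci K (fun u => (chi u)%:C * H (u +i* v)).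
have side v : 0 <= v <= Y ->
    normc (ci K (fun u => (derive1 chi u)%:C * H (u +i* v))) <= `|C1|.
  move=> hv; rewrite (@ci_eq _ _ _ (fun u => (derive1 chi u)%:C *
    (kern k n x0 r z (u +i* v) * F (u +i* (v + eps))))); last by move=> u _; rewrite HE.
  have [vh0 [veta _]] := vh v hv.
  by apply: le_trans (ler_norm _); apply: sideP.
have slideP v1 v2 : 0 <= v1 -> v1 <= v2 -> v2 <= Y -> (v2 < y \/ y < v1) ->
    normc (Phi v2 - Phi v1) <= `|C1| * (v2 - v1).
  move=> v10 v12 v2Y hy.
  have itv v : v1 <= v -> v <= v2 -> 0 <= v <= Y.
    by move=> v1v vv2; rewrite (le_trans v10 v1v) (le_trans vv2 v2Y).
  apply: (slide cd v12 _ LP chic chid).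
    move=> u v hu /andP[v1v vv2]; have [_ [_ vlt]] := vh v (itv v v1v vv2).
    apply: dH => //; first exact: le_trans v1v.
    case: hy => hy; first by rewrite lt_eqF// (le_lt_trans vv2).
    by rewrite gt_eqF// (lt_le_trans hy).
  by move=> v /andP[v1v vv2]; apply: side; exact: itv.
have Ez : E z * y%:C = F (x +i* (y + eps)) * mob k x0 r z ^+ n.
  rewrite /E shift.
  have zz : z - z^* = (2 * 'i) * y%:C.
    by apply: eq_ReIm; rewrite mulrC mulr_natl mulr2n /= ?opprK ?subrr; ring.
  have ii : (2 * 'i : C) != 0 by apply: Im_neq0; rewrite mulr_natl mulr2n /=; lra.
  have yc : y%:C != 0 :> C by rewrite -normc_gt0 normc_real normr_gt0 gt_eqF.
  have aux (A1 A2 a b : C) : a != 0 -> b != 0 -> A1 * (A2 * a * (a * b)^-1) * b = A1 * A2.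
    by move=> a0 b0; field; rewrite a0 b0.
  by rewrite zz; exact: aux.
rewrite -Ez Normc.normcM normc_real (gtr0_norm y0).
have -> : 2 * (normc (E z) * y) = y * (2 * normc (E z)) by ring.
apply: ler_wpM2l; first exact: ltW.
apply/ler_addgt0Pr => e e0.
have [s2 s20 jumpP] : exists2 s2, 0 < s2 & forall s, 0 < s -> s < s2 ->
    2 * normc (E z) - e <= normc (Phi (y - s) - Phi (y + s)).
  have y20 : 0 < y / 2 by rewrite divr_gt0.
  have d20 : 0 < del / 2 by rewrite divr_gt0.
  apply: (@jump _ E chi c d x y (y / 2) (del / 2) L e) => //.
  - by move=> u v hu /vy[v0 vlt]; exact: dE.
  - exact: cutoff_itv.
  - by move=> u hu; apply: cutoff1 => //; exact: xx0.
have [s s0 [ss2 sy]] : exists2 s, 0 < s & s < s2 /\ s < y.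
  have m0 : 0 < Num.min s2 y by rewrite lt_min s20.
  have [h1 h2] := midf_lt m0; rewrite add0r in h1 h2.
  by move: h2; rewrite lt_min => /andP[ss2 sy]; exists (Num.min s2 y / 2).
have J := jumpP s s0 ss2.
have S1 : normc (Phi (y - s) - Phi 0) <= `|C1| * (y - s - 0).
  by apply: slideP => //; [rewrite subr_ge0 ltW|exact: (sY s s0 sy).1|left; rewrite ltrBlDr ltrDl].
have S2 : normc (Phi Y - Phi (y + s)) <= `|C1| * (Y - (y + s)).
  have [_ [ys0 ysY]] := sY s s0 sy.
  by apply: slideP => //; right; rewrite ltrDl.
have T : normc (Phi Y) <= C2.
  rewrite /Phi (@ci_eq _ _ _ (fun u => (chi u)%:C *
    (kern k n x0 r z (u +i* Y) * F (u +i* (Y + eps))))); last by move=> u _; rewrite HE.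
  by apply: topP => //; rewrite addrAC subrr add0r gtr0_norm.
have -> : ci K (fun u => (chi u)%:C * kern k n x0 r z (u +i* 0) * F (u +i* eps)) = Phi 0.
  by apply: ci_eq => u _; rewrite HE add0r mulrA.
have tri := tri4 (Phi (y - s)) (Phi 0) (Phi Y) (Phi (y + s)).
exact: (sumup _ _ _ _ _ _ _ _ (ltW s0) J tri S1 S2 T).
Qed.

(** Let [eps] tend to 0: at the interior point [F] is continuous, and on the real line
    the kernel is a fixed test function. *)
Lemma poisson_ineq (k : R) n : 0 < k -> exists rho C0 : R, [/\ 0 < rho, 0 <= C0 &
  forall x y r : R, `|x - x0| <= rho -> 0 < y <= rho -> 0 < r <= 2 * rho ->
  2 * normc (F (x +i* y) * mob k x0 r (x +i* y) ^+ n) <=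
  y * (normc (ci K (fun u => ((chi u)%:C * kern k n x0 r (x +i* y) (u +i* 0)) * g u)) + C0)].
Proof.
move=> k0; have del0' := del0.
have [rho1 [C0 [s0 [rho10 C00 s00 P]]]] := poisson_shifted n k0.
exists (Num.min rho1 del), C0; split; [by rewrite lt_min rho10 del0| by []|].
move=> x y r; rewrite !le_min => /andP[hx hxd] /andP[y0 /andP[yrho _]] /andP[r0 rr].
have rrho : r <= 2 * rho1 by apply: (le_trans rr); apply: ler_wpM2l => //; rewrite ge_min lexx.
set z := x +i* y.
have cd : c <= d by lra.
apply/ler_addgt0Pr => e e0.
set m := mob k x0 r z ^+ n.
have m0 : 0 < normc m + 1 by rewrite ltr_wpDl// normc_ge0.
have e1 : 0 < e / (4 * (normc m + 1)) by rewrite divr_gt0// mulr_gt0.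
have e2 : 0 < e / (2 * y) by rewrite divr_gt0// mulr_gt0.
have [eta eta0 cvgP] := pairing_cvg cd h0 dF bg Fg
  (fun j => @chi_kern_smooth k n x y r j k0 r0 y0)
  (fun u nK => etrans (congr1 (fun a : R => a%:C * kern k n x0 r (x +i* y) (u +i* 0))
     (cutoff0 del0 (ltW (notK nK)))) (mul0r _)) e2.
have y01 : 0 < y <= rho1 by rewrite y0.
have r01 : 0 < r <= 2 * rho1 by rewrite r0.
have hy : 0 < y < h.
  have hh : 0 < s0 / 2 < s0 by lra.
  by have [h1 _] := P x y r (s0 / 2) hx y01 r01 hh; lra.
have [l l0 cF] : exists2 l, 0 < l & forall w, `|w - y| < l ->
    normc (F (x +i* w) - F z) <= e / (4 * (normc m + 1)).
  apply: (ccont_ver (cdiff_ccont (dF _ hy)) e1).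
  by move: hxd; rewrite ler_norml; lra.
pose eps := Num.min s0 (Num.min eta l) / 2.
have mn0 : 0 < Num.min s0 (Num.min eta l) by rewrite !lt_min s00 eta0 l0.
have eps0 : 0 < eps by rewrite divr_gt0.
have epsm : eps < Num.min s0 (Num.min eta l) by rewrite /eps; lra.
move: epsm; rewrite !lt_min => /andP[es /andP[ee el]]; clearbody eps.
have eps1 : 0 < eps < s0 by rewrite eps0.
have [_ Q] := P x y r eps hx y01 r01 eps1; rewrite -/z -/m in Q.
have Q1 := cvgP eps; rewrite eps0 ee in Q1; have {}Q1 := Q1 isT.
have Q2 : normc (F (x +i* (y + eps)) - F z) <= e / (4 * (normc m + 1)).
  by apply: cF; rewrite addrAC subrr add0r gtr0_norm.
set G := ci K (fun u => _ * g u) in Q1 *; set G' := ci K _ in Q Q1.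
have Q3 : normc G' <= normc G + e / (2 * y).
  by have := normcB_ge G' G; lra.
have Q4 : 2 * normc (F z * m) <= 2 * normc (F (x +i* (y + eps)) * m) + e / 2.
  have -> : F z * m = F (x +i* (y + eps)) * m - (F (x +i* (y + eps)) - F z) * m by ring.
  have b1 := normcB (F (x +i* (y + eps)) * m) ((F (x +i* (y + eps)) - F z) * m).
  have b2 : normc ((F (x +i* (y + eps)) - F z) * m) <= e / 4.
    rewrite Normc.normcM; apply: (@le_trans _ _ (e / (4 * (normc m + 1)) * (normc m + 1))).
      by apply: ler_pM; rewrite ?normc_ge0// lerDl.
    by rewrite invfM mulrA -mulrA mulVf ?mulr1// gt_eqF.
  lra.
have Q5 : y * (normc G' + C0) <= y * (normc G + C0) + e / 2.
  have := ler_wpM2l (ltW y0) Q3; rewrite mulrDr.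
  have -> : y * (e / (2 * y)) = e / 2 by field; rewrite gt_eqF.
  rewrite !mulrDr; lra.
lra.
Qed.
End PoissonInequality.

(** * Size and oscillation of the kernel *)

Section Estimates.
Variable R : realType.
Local Notation C := R[i].

(** An integration by parts for a Lipschitz weight [f]: the primitive of [g] is small,
    and the derivative of [f] is at most [L]. *)
Lemma int_lipschitz (f g : R -> C) (a b B L eta : R) : a <= b -> 0 <= L ->
  bounded_meas `[a, b] g ->
  (forall u, normc (f u) <= B) ->
  (forall u u', normc (f u - f u') <= L * `|u - u'|) ->
  (forall t, a <= t <= b -> normc (ci `[a, t] g) <= eta) ->
  normc (ci `[a, b] (fun u => f u * g u)) <= eta * (B + L * (b - a)).
Proof.
move=> ab L0 bg fB fL geta.
have [M M0 gM] := bm_bound bg.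
have bf s t : s <= t -> bounded_meas `[s, t] f.
  move=> st; apply: rcont_bm => // x _; apply: (@lipschitz_rcont _ _ L) => u v; exact: fL.
have bfg : bounded_meas `[a, b] (fun u => f u * g u) by apply: bmM => //; exact: bf.
have eta0 : 0 <= eta by apply: le_trans (geta a _); [exact: normc_ge0|lra].
pose N t := ci `[a, t] g.
(* The derivative of [D] is formally [- f' * N]. *)
pose D t := ci `[a, t] (fun u => f u * g u) - f t * N t.
have DL : normc (D b - D a) <= eta * L * (b - a).
  apply: local_lipschitz => // e t e0 ht.
  have K0 : 0 < 2 * (L * M) + 1 by rewrite ltr_wpDl// !mulr_ge0// ltW.
  exists (e / (2 * (L * M) + 1)); first by rewrite divr_gt0.
  move=> t1 t2 at1 /andP[t1t tt2] t2b; rewrite ltr_pdivlMr// => small.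
  have t12 : t1 <= t2 by lra.
  have t1b : t1 <= b by lra.
  have E1 : ci `[a, t2] (fun u => f u * g u) =
      ci `[a, t1] (fun u => f u * g u) + ci `[t1, t2] (fun u => f u * g u).
    by apply: ci_split => //; exact: bm_sub bfg.
  have E2 : N t2 = N t1 + ci `[t1, t2] g.
    by apply: ci_split => //; exact: bm_sub bg.
  have bg12 : bounded_meas `[t1, t2] g by exact: bm_sub bg.
  have -> : D t2 - D t1 = ci `[t1, t2] (fun u => (f u - f t2) * g u) - (f t2 - f t1) * N t1.
    have -> : ci `[t1, t2] (fun u => (f u - f t2) * g u) =
       ci `[t1, t2] (fun u => f u * g u) - f t2 * ci `[t1, t2] g.
      rewrite -ciZ// -ciB; [|exact: bm_sub bfg|by apply: bmM => //; exact: bm_cst].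
      by apply: ci_eq => u _; rewrite mulrBl.
    rewrite /D E1 E2; ring.
  apply: (le_trans (normcB _ _)); rewrite [X in _ <= X]mulrDl [X in _ <= X]addrC; apply: lerD.
    apply: (@le_trans _ _ (2 * (L * (t2 - t1) * M) * (t2 - t1))).
      apply: ci_le => //; first by apply: bmM => //; apply: bmB; [exact: bf|exact: bm_cst].
      move=> u hu; rewrite Normc.normcM; apply: ler_pM; rewrite ?normc_ge0//; last by apply: gM; lra.
      apply: (le_trans (fL _ _)); apply: ler_wpM2l => //.
      by rewrite ler_norml; lra.
    apply: ler_wpM2r; first lra.
    have := small; lra.
  rewrite Normc.normcM mulrC -[X in _ <= X]mulrA; apply: ler_pM; rewrite ?normc_ge0//.
    by apply: geta; lra.
  by rewrite -[t2 - t1]ger0_norm; [exact: fL|lra].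
have Da : D a = 0.
  by rewrite /D /N !ci_point ?mulr0 ?subr0//; [exact: bm_sub bg|exact: bm_sub bfg].
have -> : ci `[a, b] (fun u => f u * g u) = (D b - D a) + f b * N b.
  by rewrite Da subr0 /D subrK.
apply: (le_trans (normcD _ _)); rewrite [X in _ <= X]mulrDr [X in _ <= X]addrC; apply: lerD.
  by rewrite mulrA.
rewrite Normc.normcM mulrC; apply: ler_pM; rewrite ?normc_ge0//.
by apply: geta; lra.
Qed.

(** Bounded by [b] and Lipschitz with constant [l / r]. This form is stable under
    products, and it makes the bounds for the kernel independent of [r]. *)
Definition sBL (r : R) (f : R -> C) (b l : R) : Prop :=
  (forall u, normc (f u) <= b) /\ forall u u', r * normc (f u - f u') <= l * `|u - u'|.

Lemma sBL_ge0 r f b l : 0 <= r -> sBL r f b l -> 0 <= b /\ 0 <= l.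
Proof.
move=> r0 [fb fl]; split; first exact: le_trans (normc_ge0 _) (fb 0).
have := fl 1 0; rewrite subr0 normr1 mulr1; apply: le_trans.
by rewrite mulr_ge0 ?normc_ge0.
Qed.

Lemma sBL_M r f g b l b' l' : 0 <= r -> sBL r f b l -> sBL r g b' l' ->
  sBL r (fun u => f u * g u) (b * b') (b * l' + b' * l).
Proof.
move=> r0 sf sg; have [b0 l0] := sBL_ge0 r0 sf; have [b0' l0'] := sBL_ge0 r0 sg.
move: sf sg => [fb fl] [gb gl]; split.
  by move=> u; rewrite Normc.normcM; apply: ler_pM; rewrite ?normc_ge0.
move=> u u'; have -> : f u * g u - f u' * g u' = f u * (g u - g u') + g u' * (f u - f u') by ring.
have a1 := ler_pM (normc_ge0 (f u)) (mulr_ge0 r0 (normc_ge0 (g u - g u'))) (fb u) (gl u u').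
have a2 := ler_pM (normc_ge0 (g u')) (mulr_ge0 r0 (normc_ge0 (f u - f u'))) (gb u') (fl u u').
have := ler_wpM2l r0 (normcD (f u * (g u - g u')) (g u' * (f u - f u'))).
rewrite !Normc.normcM; lra.
Qed.

Lemma sBL_cst r (k : C) : sBL r (fun=> k) (normc k) 0.
Proof. by split => // u u'; rewrite subrr Normc.normc0 mulr0 mul0r. Qed.

Lemma sBL_1D r f b l : sBL r f b l -> sBL r (fun u => 1 + f u) (1 + b) l.
Proof.
move=> [fb fl]; split.
  by move=> u; apply: (le_trans (normcD _ _)); rewrite Normc.normc1 lerD2l.
by move=> u u'; have -> : 1 + f u - (1 + f u') = f u - f u' by ring.
Qed.

Lemma sBL_line r (z : C) m : 0 < r -> 0 < m -> m * r <= `|complex.Im z| ->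
  sBL r (fun u => r%:C * ((u +i* 0) - z)^-1) m^-1 (m^-1 ^+ 2).
Proof.
move=> r0 m0 hm; have mr0 : 0 < m * r by rewrite mulr_gt0.
have hn u : m * r <= normc ((u +i* 0) - z).
  apply: (le_trans hm); apply: le_trans (Im_le_normc _).
  by rewrite cImD cImN /= sub0r normrN.
have nz u : (u +i* 0) - z != 0 by rewrite -normc_gt0; exact: lt_le_trans (hn u).
have hV u : r * (normc ((u +i* 0) - z))^-1 <= m^-1.
  rewrite ler_pdivrMr; last exact: lt_le_trans (hn u).
  by rewrite mulrC ler_pdivlMr// mulrC; exact: hn.
split.
  by move=> u; rewrite Normc.normcM normc_real gtr0_norm// Normc.normcV.
move=> u u'.
have -> : r%:C * ((u +i* 0) - z)^-1 - r%:C * ((u' +i* 0) - z)^-1 =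
  r%:C * ((u' +i* 0) - (u +i* 0)) * ((u +i* 0) - z)^-1 * ((u' +i* 0) - z)^-1.
  have aux (A P P' Z : C) : P - Z != 0 -> P' - Z != 0 ->
     A * (P - Z)^-1 - A * (P' - Z)^-1 = A * (P' - P) * (P - Z)^-1 * (P' - Z)^-1.
    by move=> h1 h2; field; rewrite h1 h2.
  exact: aux.
rewrite !Normc.normcM normc_real gtr0_norm// !Normc.normcV normc_re distrC.
have b1 := ler_pM (mulr_ge0 (ltW r0) (ltW (_ : 0 < (normc ((u +i* 0) - z))^-1)))
   (mulr_ge0 (ltW r0) (ltW (_ : 0 < (normc ((u' +i* 0) - z))^-1))) (hV u) (hV u').
have := ler_wpM2r (normr_ge0 (u - u')) (b1 _ _); rewrite !invr_gt0 !normc_gt0 !nz => /(_ isT isT).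
by rewrite expr2; lra.
Qed.

Lemma mob_sBL (k : R) : 0 < k -> exists b l, forall x0 r : R, 0 < r ->
  sBL r (fun u => mob k x0 r (u +i* 0)) b l.
Proof.
move=> k0; exists (1 + normc (gap k) * (k / 2)^-1),
  (normc (gap k) * (k / 2)^-1 ^+ 2 + (k / 2)^-1 * 0) => x0 r r0.
apply: sBL_1D.
have k20 : 0 < k / 2 by rewrite divr_gt0.
have hl : sBL r (fun u => r%:C * ((u +i* 0) - (x0%:C + r%:C * pole k))^-1) (k / 2)^-1 ((k / 2)^-1 ^+ 2).
  apply: sBL_line => //.
  have -> : complex.Im (x0%:C + r%:C * pole k : C) = - (k / 2 * r) by rewrite /pole /=; lra.
  by rewrite normrN gtr0_norm ?mulr_gt0.
have := sBL_M (ltW r0) (sBL_cst r (gap k)) hl.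
by move=> [h1 h2]; split=> [u|u u']; [have := h1 u|have := h2 u u'];
  rewrite !mulrA ![gap k * _]mulrC.
Qed.

(** By homogeneity, [r ^+ 2 * kern] at the scale [r] looks like [kern] at the scale 1. *)
Lemma kern_sBL (k : R) n (m : R) : 0 < k -> 0 < m -> exists2 B : R, 0 < B &
  forall x0 r x y : R, 0 < r -> m * r <= y ->
  sBL r (fun u => (r ^+ 2)%:C * kern k n x0 r (x +i* y) (u +i* 0)) B B.
Proof.
move=> k0 m0.
have [bm [lm mobP]] := mob_sBL k0.
have [bn [ln mobnP]] : exists b l, forall x0 r : R, 0 < r ->
    sBL r (fun u => mob k x0 r (u +i* 0) ^+ n) b l.
  elim: n => [|n [b [l IH]]].
    by exists (normc 1), 0 => x0 r r0; apply: sBL_cst.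
  exists (bm * b), (bm * l + b * lm) => x0 r r0.
  have := sBL_M (ltW r0) (mobP x0 r r0) (IH x0 r r0).
  by move=> [h1 h2]; split=> [u|u u']; [have := h1 u|have := h2 u u']; rewrite !exprS.
have ex : exists b l, forall x0 r x y : R, 0 < r -> m * r <= y ->
    sBL r (fun u => (r ^+ 2)%:C * kern k n x0 r (x +i* y) (u +i* 0)) b l.
  eexists; eexists => x0 r x y r0 ry.
  have y0 : 0 < y by apply: lt_le_trans ry; rewrite mulr_gt0.
  have l1 : sBL r (fun u => r%:C * ((u +i* 0) - (x +i* y)^*)^-1) m^-1 (m^-1 ^+ 2).
    by apply: sBL_line => //=; rewrite normrN gtr0_norm.
  have l2 : sBL r (fun u => r%:C * ((u +i* 0) - (x +i* y))^-1) m^-1 (m^-1 ^+ 2).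
    by apply: sBL_line => //=; rewrite gtr0_norm.
  have := sBL_M (ltW r0) (sBL_M (ltW r0) (sBL_M (ltW r0) (mobnP x0 r r0)
    (sBL_cst r (2 * 'i))) l1) l2.
  have E u : (r ^+ 2)%:C * kern k n x0 r (x +i* y) (u +i* 0) =
    mob k x0 r (u +i* 0) ^+ n * (2 * 'i) * (r%:C * ((u +i* 0) - (x +i* y)^*)^-1) *
      (r%:C * ((u +i* 0) - (x +i* y))^-1).
    by rewrite /kern expr2 -realcM; ring.
  by move=> [h1 h2]; split=> [u|u u']; [rewrite E; exact: h1|rewrite !E; exact: h2].
have [b [l P]] := ex.
exists (`|b| + `|l| + 1); first by rewrite ltr_wpDl// addr_ge0.
move=> x0 r x y r0 ry; have [h1 h2] := P x0 r x y r0 ry; split.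
  move=> u; apply: (le_trans (h1 u)); have := ler_norm b; have : 0 <= `|l| by []. lra.
move=> u u'; apply: (le_trans (h2 u u')); apply: ler_wpM2r => //.
by have := ler_norm l; have : 0 <= `|b| by []; lra.
Qed.

(** [normc D ^+ 2] and [normc (D + r * gap k) ^+ 2] differ by an affine function of
    the point, which vanishes on the line in which zero and pole of [mob] are mirror
    images. *)
Lemma mob_sq k x0 r u v : (u +i* v) - (x0%:C + r%:C * pole k) != 0 :> C ->
  normc (mob k x0 r (u +i* v)) ^+ 2 = 1 + 2 * r * k * (k * (u - x0) + v) /
     normc ((u +i* v) - (x0%:C + r%:C * pole k)) ^+ 2.
Proof.
move=> nz; set D := _ - _ in nz *.
have D0 : normc D ^+ 2 != 0 by rewrite expf_neq0// gt_eqF// normc_gt0.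
have -> : mob k x0 r (u +i* v) = (D + r%:C * gap k) * D^-1.
  have aux (P W : C) : P != 0 -> 1 + W * P^-1 = (P + W) * P^-1.
    by move=> P0; field.
  by rewrite /mob; exact: aux.
rewrite Normc.normcM Normc.normcV exprMn exprVn.
have -> : normc (D + r%:C * gap k) ^+ 2 = normc D ^+ 2 + 2 * r * k * (k * (u - x0) + v).
  rewrite !sqr_normcE cReD cImD !Re_pole !Im_pole /gap cReM cImM /=; by field.
by rewrite mulrDl divff.
Qed.

Lemma pole_nz (k x0 r u v : R) : 0 < k -> 0 < r -> 0 <= v ->
  (u +i* v) - (x0%:C + r%:C * pole k) != 0 :> C.
Proof.
move=> k0 r0 v0; apply: Im_neq0; rewrite Im_pole gt_eqF//.
by rewrite ltr_wpDl// mulr_gt0// divr_gt0.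
Qed.

Lemma mob_ge1 (k x0 r u v : R) : 0 < k -> 0 < r -> 0 <= v -> 0 <= k * (u - x0) + v ->
  1 <= normc (mob k x0 r (u +i* v)).
Proof.
move=> k0 r0 v0 h; rewrite -(ler_pXn2r (ltn0Sn 1)) ?nnegrE ?normc_ge0//.
rewrite expr1n mob_sq; last exact: pole_nz.
by rewrite lerDl divr_ge0 ?sqr_ge0// !mulr_ge0// ltW.
Qed.

Lemma mob_le1 (k x0 r u : R) : 0 < k -> 0 < r -> u <= x0 ->
  normc (mob k x0 r (u +i* 0)) <= 1.
Proof.
move=> k0 r0 h; rewrite -(ler_pXn2r (ltn0Sn 1)) ?nnegrE ?normc_ge0//.
rewrite expr1n mob_sq; last exact: pole_nz.
rewrite gerDl addr0 mulr_le0_ge0 ?invr_ge0 ?sqr_ge0//.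
by rewrite !mulr_ge0_le0 ?mulr_ge0 ?(ltW k0) ?(ltW r0)// subr_le0.
Qed.

(** By [mob_sq], [1 - normc mob ^+ 2] is at least a multiple of [(x0 - u) / r] at
    distances comparable to [r]. *)
Lemma mob_contract (k eta L : R) : 0 < k -> 0 < eta -> eta <= L ->
  exists q : R, [/\ 0 <= q, q < 1 & forall x0 r u : R, 0 < r ->
    eta * r <= x0 - u <= L * r -> normc (mob k x0 r (u +i* 0)) <= q].
Proof.
move=> k0 eta0 etaL.
have p0 := normc_ge0 (pole k).
pose T := (L + normc (pole k)) ^+ 2.
have T0 : 0 < T by rewrite exprn_gt0//; lra.
pose q2 := Num.max 0 (1 - 2 * k ^+ 2 * eta / T).
have q20 : 0 <= q2 by rewrite le_max lexx.
have k2 : 0 < k ^+ 2 by rewrite exprn_gt0.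
have q21 : q2 < 1.
  by rewrite gt_max ltr01 /= gtrBl divr_gt0// !mulr_gt0.
exists (Num.sqrt q2); split; [exact: sqrtr_ge0|by rewrite -sqrtr1 ltr_sqrt|].
move=> x0 r u r0 hu; rewrite -(ler_pXn2r (ltn0Sn 1)) ?nnegrE ?normc_ge0 ?sqrtr_ge0//.
rewrite [X in _ <= X]sqr_sqrtr// mob_sq; last exact: pole_nz.
rewrite addr0 le_max; apply/orP; right; rewrite lerD2l -lerN2 opprK.
set D := normc _.
have DT : D ^+ 2 <= r ^+ 2 * T.
  rewrite /T -exprMn; apply: lerXn2r; rewrite ?nnegrE ?normc_ge0//.
    by rewrite mulr_ge0 ?(ltW r0)//; lra.
  rewrite /D; have -> : (u +i* 0) - (x0%:C + r%:C * pole k) = (u - x0)%:C - r%:C * pole k :> C.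
    by apply: eq_ReIm => /=; lra.
  apply: (le_trans (normcB _ _)); rewrite Normc.normcM !normc_real (gtr0_norm r0) mulrDr.
  rewrite lerD2r mulrC distrC ger0_norm; first by case/andP: hu.
  by apply: le_trans (andP hu).1; rewrite mulr_ge0// ltW.
have D0 : 0 < D ^+ 2 by rewrite exprn_gt0// normc_gt0; exact: pole_nz.
rewrite -mulNr ler_pdivrMr// [X in _ <= X]mulrAC ler_pdivlMr//.
apply: (@le_trans _ _ (2 * k ^+ 2 * eta * (r ^+ 2 * T))).
  by apply: ler_wpM2l => //; rewrite !mulr_ge0// ltW.
have -> : 2 * k ^+ 2 * eta * (r ^+ 2 * T) = (2 * k ^+ 2 * r * T) * (eta * r) by ring.
have -> : - (2 * r * k * (k * (u - x0))) * T = (2 * k ^+ 2 * r * T) * (x0 - u) by ring.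
apply: ler_wpM2l; last by case/andP: hu.
apply: mulr_ge0; last exact: ltW.
by apply: mulr_ge0; [apply: mulr_ge0; [|exact: ltW]|exact: ltW].
Qed.

Lemma inv_sq_integral (x0 a b : R) : a < b -> b < x0 \/ x0 < a ->
  (@lebesgue_measure R).-integrable `[a, b] (EFin \o (fun u : R => (u - x0)^-1 ^+ 2)) /\
  \int[@lebesgue_measure R]_(u in `[a, b]) ((u - x0)^-1 ^+ 2) = (a - x0)^-1 - (b - x0)^-1.
Proof.
move=> ab hx; pose f (u : R) := (u - x0)^-1 ^+ 2; pose F (u : R) := - (u - x0)^-1.
have nz u : a <= u <= b -> u - x0 != 0.
  by move=> hu; rewrite subr_eq0; case: hx => hx; [rewrite lt_eqF|rewrite gt_eqF]; lra.
have d1 (u : R) : is_derive u 1 (fun u : R => u - x0) 1.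
  have h : is_derive u 1 (id - cst x0) (1 - 0) by apply: is_deriveB.
  by apply: (is_derive_eq h); rewrite subr0.
have dF u : a <= u <= b -> is_derive u 1 F (f u).
  move=> hu; have h := is_deriveN (@is_deriveV _ (fun u : R => u - x0) u 1 1 (nz u hu) (d1 u)).
  by apply: (is_derive_eq h); rewrite /f scaleNr opprK /GRing.scale /= mulr1 exprVn.
have cF u : a <= u <= b -> {for u, continuous F}.
  by move=> hu; apply: differentiable_continuous; apply/derivable1_diffP; case: (dF u hu).
have cf u : a <= u <= b -> {for u, continuous f}.
  move=> hu.
  have fE : f = (fun t => F t * F t).
    by apply/funext => t; rewrite /f /F mulrNN expr2.
  by rewrite fE; apply: cvgM; exact: cF.
have cwf : {within `[a, b], continuous f}.
  apply: continuous_in_subspaceT => u /set_mem /=; rewrite in_itv /=; exact: cf.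
have dFoo : derivable_oo_LRcontinuous F a b.
  split.
  - by move=> u; rewrite in_itv /= => /andP[/ltW au /ltW ub]; have [] := dF u; rewrite ?au.
  - by apply: cvg_at_right_filter; apply: cF; lra.
  - by apply: cvg_at_left_filter; apply: cF; lra.
have Ff : {in `]a, b[, derive1 F =1 f}.
  move=> u; rewrite in_itv /= => /andP[/ltW au /ltW ub].
  by rewrite derive1E; have [|_ ->] := dF u; rewrite ?au.
have cpt : compact (`[a, b]%classic : set R) by exact: segment_compact.
split; first exact: continuous_compact_integrable.
rewrite /Rintegral (continuous_FTC2 ab cwf dFoo Ff) -EFinB /= /F; lra.
Qed.
End Estimates.

(** * Smallness of the boundary integral *)

Section Small.
Variable R : realType.
Local Notation C := R[i].

Lemma pow_small (q e : R) : 0 <= q -> q < 1 -> 0 < e -> exists n, q ^+ n <= e.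
Proof.
move=> q0 q1 e0; have : q ^+ n @[n --> \oo] --> (0 : R) by apply: cvg_expr; rewrite ger0_norm.
move=> /cvgrPdist_le /(_ e e0) [n _ /(_ n (leqnn n))] /=.
by rewrite sub0r normrN ger0_norm ?exprn_ge0// => h; exists n.
Qed.

Lemma tail_bound (f : R -> C) (x0 a b T : R) : a < b -> b < x0 \/ x0 < a ->
  bounded_meas `[a, b] f ->
  (forall u, a <= u <= b -> normc (f u) <= T * (u - x0)^-1 ^+ 2) ->
  normc (ci `[a, b] f) <= 2 * (T * ((a - x0)^-1 - (b - x0)^-1)).
Proof.
move=> ab hx bf fT; have [ih <-] := inv_sq_integral ab hx.
rewrite -RintegralZl//; apply: ci_le_int => //.
exact: (@eq_integrable _ _ _ _ _ _ _ _ _ (integrableZl _ T ih)).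
Qed.

Lemma normc_conj_line (u x y : R) :
  normc ((u +i* 0) - (x +i* y)^* : C) = normc ((u +i* 0) - (x +i* y) : C).
Proof. by rewrite !normcE2 /= !sub0r !sqrrN. Qed.

Lemma kern_normE (k : R) n x0 r x y u :
  normc (kern k n x0 r (x +i* y) (u +i* 0)) =
  normc (mob k x0 r (u +i* 0)) ^+ n * (2 * (normc ((u +i* 0) - (x +i* y)))^-1 ^+ 2).
Proof.
rewrite /kern !Normc.normcM !Normc.normcV normc_conj_line normcX normc_i mulr1.
have -> : normc (2 : C) = 2.
  have -> : (2 : C) = (2 : R)%:C by rewrite mulr2n -realcD.
  by rewrite normc_real ger0_norm.
by rewrite expr2 !mulrA.
Qed.

Variables (g : R -> C) (x0 del M : R).
Local Notation c := (x0 - 2 * del).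
Local Notation d := (x0 + 2 * del).
Local Notation K := (`[c, d]%classic : set R).
Local Notation chi := (cutoff x0 del).
Hypothesis del0 : 0 < del.
Hypothesis bg : bounded_meas K g.
Hypothesis M0 : 0 < M.
Hypothesis gM : forall u, c <= u <= d -> normc (g u) <= M.

Section Pieces.
Variables (sg k : R) (n : nat) (x y r : R).
Hypothesis sg0 : 0 < sg.
Hypothesis k0 : 0 < k.
Hypothesis r0 : 0 < r.
Hypothesis hy : sg * r <= y.
Hypothesis yr : y <= r.
Hypothesis Xr : `|x - x0| <= r.

Definition integrand (u : R) : C :=
  ((chi u)%:C * kern k n x0 r (x +i* y) (u +i* 0)) * g u.

Local Notation w u := (normc (((u : R) +i* 0) - (x +i* y))).

Let y0 : 0 < y.
Proof. by apply: lt_le_trans hy; rewrite mulr_gt0. Qed.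

Lemma w_ge u : sg * r <= w u.
Proof.
apply: (le_trans hy); apply: le_trans (Im_le_normc _).
by rewrite cImD cImN /= sub0r normrN gtr0_norm.
Qed.

Lemma w_gt0 u : 0 < w u.
Proof. by apply: lt_le_trans (w_ge u); rewrite mulr_gt0. Qed.

Lemma wV_near u : (w u)^-1 ^+ 2 <= (sg * r)^-1 ^+ 2.
Proof.
have sr0 : 0 < sg * r by rewrite mulr_gt0.
have wu0 := w_gt0 u.
apply: lerXn2r; rewrite ?nnegrE ?invr_ge0 ?(ltW wu0) ?(ltW sr0)//.
by rewrite lef_pV2 ?posrE// w_ge.
Qed.

Lemma wV_far u : 2 * r <= `|u - x0| -> (w u)^-1 ^+ 2 <= 4 * (u - x0)^-1 ^+ 2.
Proof.
move=> hu; have u0 : 0 < `|u - x0| by apply: lt_le_trans hu; rewrite mulr_gt0.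
have wfar : `|u - x0| / 2 <= w u.
  apply: le_trans (Re_le_normc _); rewrite cReD cReN /=.
  have := ler_normD (u - x) (x - x0); rewrite addrA subrK.
  have := Xr; lra.
have -> : 4 * (u - x0)^-1 ^+ 2 = (`|u - x0| / 2)^-1 ^+ 2.
  rewrite !exprVn expr_div_n real_normK ?num_real// invf_div; congr (_ * _).
  by rewrite expr2; lra.
have wu0 := w_gt0 u.
apply: lerXn2r; rewrite ?nnegrE ?invr_ge0 ?(ltW wu0) ?divr_ge0//.
by rewrite lef_pV2 ?posrE ?divr_gt0.
Qed.

Lemma integrand_le u m T : c <= u <= d -> normc (mob k x0 r (u +i* 0)) <= m ->
  (w u)^-1 ^+ 2 <= T -> normc (integrand u) <= m ^+ n * (2 * T) * M.
Proof.
move=> hu hm hT; rewrite /integrand 2!Normc.normcM normc_real (kern_normE k n x0 r x y u).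
have /andP[c0 c1] := cutoff_itv x0 del u; rewrite ger0_norm//.
have w2 : 0 <= 2 * (w u)^-1 ^+ 2 by rewrite mulr_ge0// sqr_ge0.
have mn : 0 <= normc (mob k x0 r (u +i* 0)) ^+ n by rewrite exprn_ge0// normc_ge0.
have m0 : 0 <= m by apply: le_trans hm; exact: normc_ge0.
have P1 : normc (mob k x0 r (u +i* 0)) ^+ n * (2 * (w u)^-1 ^+ 2) <= m ^+ n * (2 * T).
  apply: ler_pM => //; last by apply: ler_wpM2l.
  by apply: lerXn2r; rewrite ?nnegrE ?normc_ge0.
apply: ler_pM; [exact: mulr_ge0 c0 (mulr_ge0 mn w2)|exact: normc_ge0| |exact: gM].
by apply: le_trans P1; rewrite ler_piMl// mulr_ge0.
Qed.

Lemma integrand_bm a b : c <= a -> a <= b -> b <= d -> bounded_meas `[a, b] integrand.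
Proof.
move=> ca ab bd; apply: bmM; last exact: bm_sub bg.
have [L [_ _ pL _ _]] := SB_C11 (fun m => cutoff_SB x0 del m).
apply: bmM; first exact: (real_lipschitz_bm ab pL).
apply: rcont_bm => // u hu; apply/ccont_hor/cdiff_ccont.
apply: cdiff_divB; last by apply/eqP => -[_] /eqP; rewrite eq_sym gt_eqF.
apply: kern_cdiff; first by rewrite add0r gt_eqF// mulr_gt0// divr_gt0.
by rewrite eq_sym oppr_eq0 gt_eqF.
Qed.

Lemma scale_le (I : C) T : normc I <= T / r -> y * normc I <= T.
Proof.
move=> h; apply: (@le_trans _ _ (r * (T / r))); last by rewrite mulrC divfK// gt_eqF.
by apply: ler_pM; rewrite ?normc_ge0// ltW.
Qed.

(** Here the kernel is bounded by its maximum, of order [r ^- 2], and the length of the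
    interval counts. *)
Lemma near_piece a b m : c <= a -> a <= b -> b <= d ->
  (forall u, a <= u <= b -> normc (mob k x0 r (u +i* 0)) <= m) ->
  y * normc (ci `[a, b] integrand) <= m ^+ n * (4 * M / sg ^+ 2) * ((b - a) / r).
Proof.
move=> ca ab bd hm; apply: scale_le.
apply: (@le_trans _ _ (2 * (m ^+ n * (2 * (sg * r)^-1 ^+ 2) * M) * (b - a))).
  apply: ci_le => //; first exact: integrand_bm.
  move=> u /andP[au ub]; apply: integrand_le; last exact: wV_near.
    by rewrite (le_trans ca au) (le_trans ub bd).
  by apply: hm; rewrite au.
rewrite le_eqVlt; apply/orP; left; apply/eqP; field.
by rewrite !gt_eqF.
Qed.

(** At distance at least [2 * r] from [x0] the kernel is comparable to
    [(u - x0) ^- 2]. *)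
Lemma far_piece a b m : c <= a -> a < b -> b <= d -> b < x0 \/ x0 < a ->
  (forall u, a <= u <= b -> 2 * r <= `|u - x0|) ->
  (forall u, a <= u <= b -> normc (mob k x0 r (u +i* 0)) <= m) ->
  y * normc (ci `[a, b] integrand) <=
    16 * (m ^+ n * M) * (r * ((a - x0)^-1 - (b - x0)^-1)).
Proof.
move=> ca ab bd hx hr hm; apply: scale_le.
apply: (@le_trans _ _ (2 * (8 * (m ^+ n * M) * ((a - x0)^-1 - (b - x0)^-1)))).
  apply: tail_bound => //; first exact: integrand_bm (ltW ab) _.
  move=> u hu; have /andP[au ub] := hu.
  have hu' : c <= u <= d by rewrite (le_trans ca au) (le_trans ub bd).
  apply: (le_trans (integrand_le hu' (hm u hu) (wV_far (hr u hu)))).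
  by rewrite le_eqVlt; apply/orP; left; apply/eqP; ring.
rewrite le_eqVlt; apply/orP; left; apply/eqP; field.
rewrite gt_eqF//=; case: hx => hx.
  by rewrite subr_eq0 lt_eqF//= subr_eq0 lt_eqF// (lt_trans ab).
by rewrite subr_eq0 gt_eqF ?(lt_trans hx)//= subr_eq0 gt_eqF.
Qed.

(** The kernel is Lipschitz at the scale [r] and the primitive of [g] is at most
    [e * l * r]. *)
Lemma averaged_piece (l B e : R) : 0 < l -> 0 < B -> 0 < e ->
  sBL r (fun u => (r ^+ 2)%:C * kern k n x0 r (x +i* y) (u +i* 0)) B B ->
  l * r <= del ->
  (forall t, x0 <= t <= x0 + l * r -> normc (ci `[x0, t] g) <= e * (t - x0)) ->
  y * normc (ci `[x0, x0 + l * r] integrand) <= e * (l * B * (1 + l)).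
Proof.
move=> l0 B0 e0 [kB kL] lr_del avg; have del0' := del0.
have lr0 : 0 < l * r by rewrite mulr_gt0.
have x0d : x0 <= x0 + l * r by lra.
have cx : c <= x0 by lra.
have xd : x0 + l * r <= d by lra.
pose ks u := (r ^+ 2)%:C * kern k n x0 r (x +i* y) (u +i* 0).
have bg4 : bounded_meas `[x0, x0 + l * r] g by exact: bm_sub bg.
have E : (r ^+ 2)%:C * ci `[x0, x0 + l * r] integrand =
    ci `[x0, x0 + l * r] (fun u => ks u * g u).
  rewrite -ciZ; last exact: integrand_bm.
  apply: ci_eq => u /=; rewrite in_itv /= => hu.
  rewrite /integrand cutoff1//; last by rewrite ler_norml; lra.
  by rewrite mul1r mulrA.
have H : normc (ci `[x0, x0 + l * r] (fun u => ks u * g u)) <=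
    (e * (l * r)) * (B + B / r * (x0 + l * r - x0)).
  apply: int_lipschitz => //.
  - by rewrite divr_ge0 ?ltW.
  - by move=> u u'; rewrite mulrAC ler_pdivlMr// mulrC; exact: kL.
  move=> t ht; apply: (le_trans (avg t ht)).
  by apply: ler_wpM2l; [exact: ltW|lra].
have H' : r ^+ 2 * normc (ci `[x0, x0 + l * r] integrand) <= e * (l * B * (1 + l)) * r.
  rewrite -[r ^+ 2]ger0_norm ?sqr_ge0// -normc_real -Normc.normcM E; apply: (le_trans H).
  rewrite le_eqVlt; apply/orP; left; apply/eqP.
  by field; rewrite gt_eqF.
apply: scale_le; rewrite ler_pdivlMr// -(ler_pM2l r0).
by move: H'; rewrite expr2; lra.
Qed.
End Pieces.

Hypothesis avg : forall e : R, 0 < e -> exists2 s : R, 0 < s &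
  forall t, x0 <= t <= x0 + s -> t <= d -> normc (ci `[x0, t] g) <= e * (t - x0).

(** The half-line is cut at the distances [L * r] and [et * r] from [x0]. The choice
    of a large [L] settles the far part, by decay, that of a small [et] the part
    next to [x0], by length, and that of a large [n] the part in between, where [mob]
    is a contraction. *)
Lemma left_piece (sg e : R) : 0 < sg -> 0 < e -> exists n rho, 0 < rho /\
  forall x y r : R, 0 < r <= rho -> sg * r <= y -> y <= r -> `|x - x0| <= r ->
  y * normc (ci `[c, x0] (integrand (sg / 2) n x y r)) <= e.
Proof.
move=> sg0 e0; have k0 : 0 < sg / 2 by rewrite divr_gt0.
pose e3 := e / 3; have e30 : 0 < e3 by rewrite divr_gt0.
have sg2 : 0 < sg ^+ 2 by rewrite exprn_gt0.
pose L := 2 + 16 * M / e3.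
have L2 : 2 <= L by rewrite /L lerDl divr_ge0 ?(ltW e30)// mulr_ge0// ltW.
have L0 : 0 < L by apply: lt_le_trans L2.
have LP : 16 * M / L <= e3.
  rewrite ler_pdivrMr// /L mulrDr [e3 * (16 * M / e3)]mulrC divfK ?gt_eqF//.
  by rewrite lerDr mulr_ge0// ltW.
pose et := Num.min 1 (e3 * sg ^+ 2 / (4 * M)).
have et0 : 0 < et by rewrite lt_min ltr01 divr_gt0 ?mulr_gt0.
have et1 : et <= 1 by rewrite ge_min lexx.
have etP : 4 * M / sg ^+ 2 * et <= e3.
  rewrite mulrAC ler_pdivrMr// mulrC -ler_pdivlMr ?mulr_gt0//.
  by rewrite ge_min lexx orbT.
have etL : et <= L by apply: (le_trans et1); apply: le_trans L2; rewrite ler1n.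
have [q [q0 q1 qP]] := mob_contract k0 et0 etL.
have Q0 : 0 < 4 * M / sg ^+ 2 * L by rewrite mulr_gt0// divr_gt0// mulr_gt0.
have [n nP] := pow_small q0 q1 (divr_gt0 e30 Q0).
rewrite ler_pdivlMr// mulrA in nP.
clearbody L et; exists n, (del / L); split; first by rewrite divr_gt0.
move=> x y r /andP[r0]; rewrite ler_pdivlMr// => rL hy yr Xr.
have del0' := del0.
have r2L : 2 * r <= r * L by rewrite mulrC; apply: ler_wpM2l => //; exact: ltW.
have er0 : 0 < et * r by rewrite mulr_gt0.
have erL : et * r <= r * L by rewrite mulrC; apply: ler_wpM2l => //; exact: ltW.
have s1 : c < x0 - r * L by lra.
have s2 : x0 - r * L <= x0 - et * r by lra.
have s3 : x0 - et * r <= x0 by lra.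
have s4 : x0 <= d by lra.
have s5 : x0 - r * L < x0 by lra.
have m1 u : u <= x0 -> normc (mob (sg / 2) x0 r (u +i* 0)) <= 1 by move=> hu; exact: mob_le1.
have I1 : y * normc (ci `[c, x0 - r * L] (integrand (sg / 2) n x y r)) <= e3.
  apply: le_trans LP.
  have hfar u : c <= u <= x0 - r * L -> 2 * r <= `|u - x0|.
    by move=> hu; rewrite ler_normr; apply/orP; right; lra.
  have hm u : c <= u <= x0 - r * L -> normc (mob (sg / 2) x0 r (u +i* 0)) <= 1.
    by move=> hu; apply: m1; lra.
  have s6 : x0 - r * L <= d by lra.
  apply: (le_trans (far_piece n sg0 k0 r0 hy yr Xr (lexx _) s1 s6 (or_introl s5) hfar hm)).
  have -> : c - x0 = - (2 * del) by lra.
  have -> : x0 - r * L - x0 = - (r * L) by lra.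
  rewrite expr1n mul1r; apply: ler_wpM2l; first by rewrite mulr_ge0// ltW.
  rewrite !invrN opprK mulrDr; have -> : r * (r * L)^-1 = L^-1 by field; rewrite !gt_eqF.
  by rewrite gerDr mulrN oppr_le0 mulr_ge0 ?invr_ge0 ?mulr_ge0 ?(ltW r0) ?(ltW del0).
have I2 : y * normc (ci `[x0 - r * L, x0 - et * r] (integrand (sg / 2) n x y r)) <= e3.
  have hm u : x0 - r * L <= u <= x0 - et * r -> normc (mob (sg / 2) x0 r (u +i* 0)) <= q.
    by move=> hu; apply: qP => //; lra.
  have s6 : x0 - et * r <= d by lra.
  apply: (le_trans (near_piece n x sg0 k0 r0 hy yr (ltW s1) s2 s6 hm)); apply: le_trans nP.
  apply: ler_wpM2l; last by rewrite ler_pdivrMr//; lra.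
  by rewrite mulr_ge0 ?exprn_ge0// divr_ge0 ?(ltW sg2)// mulr_ge0// ltW.
have I3 : y * normc (ci `[x0 - et * r, x0] (integrand (sg / 2) n x y r)) <= e3.
  have hm u : x0 - et * r <= u <= x0 -> normc (mob (sg / 2) x0 r (u +i* 0)) <= 1.
    by move=> /andP[_]; exact: m1.
  have s6 : c <= x0 - et * r by lra.
  apply: (le_trans (near_piece n x sg0 k0 r0 hy yr s6 s3 s4 hm)); apply: le_trans etP.
  rewrite expr1n mul1r; apply: ler_wpM2l; last by rewrite ler_pdivrMr//; lra.
  by rewrite divr_ge0 ?(ltW sg2)// mulr_ge0// ltW.
have bI a b : c <= a -> a <= b -> b <= d -> bounded_meas `[a, b] (integrand (sg / 2) n x y r).
  exact: (integrand_bm n x sg0 k0 r0 hy).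
have s7 : x0 - r * L <= x0 by lra.
rewrite (@ci_split _ c (x0 - r * L) x0); [|exact: ltW|exact: s7|by apply: bI => //; lra].
rewrite (@ci_split _ (x0 - r * L) (x0 - et * r) x0); [|exact: s2|exact: s3|by apply: bI => //; exact: ltW].
have y0 : 0 <= y by apply: le_trans hy; rewrite mulr_ge0// ltW.
apply: (le_trans (ler_wpM2l y0 (le_trans (normcD _ _) (lerD (lexx _) (normcD _ _))))).
rewrite !mulrDr; have -> : e = e3 + (e3 + e3) by rewrite /e3; field.
by apply: lerD => //; exact: lerD.
Qed.

(** To the right [mob] may exceed 1, but its powers are bounded once [n] is fixed. The
    part up to the distance [L * r] is small by the averages, the rest by decay. *)
Lemma right_piece (sg e : R) n : 0 < sg -> 0 < e -> exists2 rho, 0 < rho &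
  forall x y r : R, 0 < r <= rho -> sg * r <= y -> y <= r -> `|x - x0| <= r ->
  y * normc (ci `[x0, d] (integrand (sg / 2) n x y r)) <= e.
Proof.
move=> sg0 e0; have k0 : 0 < sg / 2 by rewrite divr_gt0.
have [e2 e20 eE] : exists2 e2, 0 < e2 & e = e2 + e2 by exists (e / 2); lra.
pose A := (2 * (sg / 2) + 3) ^+ n.
have A0 : 0 < A by rewrite exprn_gt0// addr_gt0// mulr_gt0.
have AM0 : 0 < A * M by rewrite mulr_gt0.
pose L := 2 + 16 * (A * M) / e2.
have L2 : 2 <= L by rewrite /L lerDl divr_ge0 ?(ltW e20)// mulr_ge0// ltW.
have L0 : 0 < L by apply: lt_le_trans L2.
have LP : 16 * (A * M) / L <= e2.
  rewrite ler_pdivrMr// /L mulrDr [e2 * (16 * (A * M) / e2)]mulrC divfK ?gt_eqF//.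
  by rewrite lerDr mulr_ge0// ltW.
have [B B0 BP] := kern_sBL n k0 sg0.
have V0 : 0 < L * B * (1 + L) by rewrite !mulr_gt0// addr_gt0.
have [s s0 sP] := avg (divr_gt0 e20 V0).
clearbody L; exists (Num.min (del / L) (s / L)); first by rewrite lt_min !divr_gt0.
move=> x y r /andP[r0]; rewrite le_min !ler_pdivlMr// => /andP[rL rs] hy yr Xr.
have del0' := del0.
have lr0 : 0 < L * r by rewrite mulr_gt0.
have r2L : 2 * r <= L * r by apply: ler_wpM2r => //; exact: ltW.
rewrite mulrC in rL; rewrite mulrC in rs.
have s1 : x0 <= x0 + L * r by lra.
have s2 : x0 + L * r < d by lra.
have s3 : x0 < x0 + L * r by lra.
have s4 : c <= x0 by lra.
have s5 : c <= x0 + L * r by lra.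
have I1 : y * normc (ci `[x0, x0 + L * r] (integrand (sg / 2) n x y r)) <= e2.
  have av t : x0 <= t <= x0 + L * r -> normc (ci `[x0, t] g) <= e2 / (L * B * (1 + L)) * (t - x0).
    by move=> ht; apply: sP; lra.
  have e20' : 0 < e2 / (L * B * (1 + L)) by rewrite divr_gt0.
  apply: (le_trans (averaged_piece sg0 k0 r0 hy yr L0 B0 e20' (BP x0 r x y r0 hy) rL av)).
  by rewrite divfK// gt_eqF.
have I2 : y * normc (ci `[x0 + L * r, d] (integrand (sg / 2) n x y r)) <= e2.
  apply: le_trans LP.
  have hfar u : x0 + L * r <= u <= d -> 2 * r <= `|u - x0|.
    by move=> hu; rewrite ler_normr; apply/orP; left; lra.
  have hm u : x0 + L * r <= u <= d -> normc (mob (sg / 2) x0 r (u +i* 0)) <= 2 * (sg / 2) + 3.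
    by move=> _; exact: mob_bound.
  apply: (le_trans (far_piece n sg0 k0 r0 hy yr Xr s5 s2 (lexx _) (or_intror s3) hfar hm)).
  have -> : d - x0 = 2 * del by lra.
  have -> : x0 + L * r - x0 = L * r by lra.
  rewrite -/A; apply: ler_wpM2l; first by rewrite mulr_ge0// ltW.
  rewrite mulrBr; have -> : r * (L * r)^-1 = L^-1 by field; rewrite !gt_eqF.
  by rewrite gerDl oppr_le0 mulr_ge0 ?invr_ge0 ?mulr_ge0 ?(ltW r0) ?(ltW del0).
have bI : bounded_meas `[x0, d] (integrand (sg / 2) n x y r).
  by apply: (integrand_bm n x sg0 k0 r0 hy) => //; lra.
rewrite (@ci_split _ x0 (x0 + L * r) d) //; last exact: ltW.
have y0 : 0 <= y by apply: le_trans hy; rewrite mulr_ge0// ltW.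
apply: (le_trans (ler_wpM2l y0 (normcD _ _))).
by rewrite mulrDr eE; exact: lerD.
Qed.

Lemma kernel_small (sg e : R) : 0 < sg -> 0 < e -> exists n rho, 0 < rho /\
  forall x y r : R, 0 < r <= rho -> sg * r <= y -> y <= r -> `|x - x0| <= r ->
  y * normc (ci K (integrand (sg / 2) n x y r)) <= e.
Proof.
move=> sg0 e0; have e20 : 0 < e / 2 by rewrite divr_gt0.
have [n [rho1 [rho10 P1]]] := left_piece sg0 e20.
have [rho2 rho20 P2] := right_piece n sg0 e20.
exists n, (Num.min rho1 rho2); split; first by rewrite lt_min rho10.
move=> x y r /andP[r0]; rewrite le_min => /andP[r1 r2] hy yr Xr.
have del0' := del0; have k0 : 0 < sg / 2 by rewrite divr_gt0.
have cx : c <= x0 by lra.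
have xd : x0 <= d by lra.
rewrite (@ci_split _ c x0 d)//; last exact: (integrand_bm n x sg0 k0 r0 hy (lexx c) (le_trans cx xd) (lexx d)).
have y0 : 0 <= y by apply: le_trans hy; rewrite mulr_ge0// ltW.
apply: (le_trans (ler_wpM2l y0 (normcD _ _))); rewrite mulrDr [e]splitr.
by apply: lerD; [apply: P1|apply: P2]; rewrite ?r0.
Qed.
End Small.

(** * The limit in a sector *)

Section Local.
Variable R : realType.
Local Notation C := R[i].
Variables (F : C -> C) (g : R -> C) (x0 del h : R).
Local Notation c := (x0 - 2 * del).
Local Notation d := (x0 + 2 * del).
Local Notation K := (`[c, d]%classic : set R).
Hypothesis del0 : 0 < del.
Hypothesis h0 : 0 < h.
Hypothesis dF : forall u v : R, c <= u <= d -> 0 < v < h -> cdiff F (u +i* v).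
Hypothesis bg : bounded_meas K g.
Hypothesis Fg : forall phi : R -> R, testR K phi -> forall e : R, 0 < e ->
  exists2 eta : R, 0 < eta & forall y : R, 0 < y < eta ->
  normc (ci K (fun u => (phi u)%:C * F (u +i* y)) -
         ci K (fun u => (phi u)%:C * g u)) <= e.
Hypothesis avg : forall e : R, 0 < e -> exists2 s : R, 0 < s &
  forall t, x0 <= t <= x0 + s -> t <= d -> normc (ci `[x0, t] g) <= e * (t - x0).

(** The conditions on [x], [y] and [r] describe a sector of vertex [x0]; in it
    [mob] is at least 1 in modulus, and the constant of the Poisson inequality is
    multiplied by [y]. *)
Lemma sector_limit (sg e : R) : 0 < sg -> 0 < e -> exists2 rho : R, 0 < rho &
  forall x y r : R, 0 < r <= rho -> sg * r <= y -> y <= r -> `|x - x0| <= r ->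
  normc (F (x +i* y)) <= e.
Proof.
move=> sg0 e0; have k0 : 0 < sg / 2 by rewrite divr_gt0.
have [M M0 gM] := bm_bound bg.
have [n [rho1 [rho10 P1]]] := kernel_small del0 bg M0 gM avg sg0 e0.
have [rho2 [C0 [rho20 C00 P2]]] := poisson_ineq del0 h0 dF bg Fg n k0.
have C1 : 0 < C0 + 1 by rewrite ltr_wpDl.
exists (Num.min rho1 (Num.min rho2 (e / (C0 + 1)))).
  by rewrite !lt_min rho10 rho20 divr_gt0.
move=> x y r /andP[r0]; rewrite !le_min => /andP[r1 /andP[r2 r3]] hy yr Xr.
have y0 : 0 < y by apply: lt_le_trans hy; rewrite mulr_gt0.
have h1 : 0 < r <= rho1 by rewrite r0.
have h2 : 0 < y <= rho2 by rewrite y0 (le_trans yr r2).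
have h3 : 0 < r <= 2 * rho2 by rewrite r0; lra.
have Q1 := P1 x y r h1 hy yr Xr.
have Q2 := P2 x y r (le_trans Xr r2) h2 h3.
have yC : y * C0 <= e.
  apply: (@le_trans _ _ (e / (C0 + 1) * (C0 + 1))); last by rewrite divfK// gt_eqF.
  apply: ler_pM => //; [exact: ltW|exact: le_trans yr r3|by rewrite lerDl].
have m1 : 1 <= normc (mob (sg / 2) x0 r (x +i* y)) ^+ n.
  rewrite exprn_ege1//; apply: mob_ge1 => //; first exact: ltW.
  have : (sg / 2) * - r <= (sg / 2) * (x - x0).
    by apply: ler_wpM2l; [exact: ltW|move: Xr; rewrite ler_norml => /andP[]].
  have : 0 < sg * r by rewrite mulr_gt0.
  lra.
have Q3 : normc (F (x +i* y)) <= normc (F (x +i* y) * mob (sg / 2) x0 r (x +i* y) ^+ n).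
  by rewrite Normc.normcM normcX ler_peMr ?normc_ge0.
move: Q1 Q2; rewrite /integrand mulrDr; lra.
Qed.
End Local.

Section Reduction.
Variable R : realType.
Local Notation C := R[i].
Local Notation mu := (@lebesgue_measure R).

(** Test functions vanish outside of [K], and the representative of the boundary value may be
    changed on a null set. *)
Lemma Rintegral_shrink (D K : set R) (f f' : R -> R) :
  measurable K -> K `<=` D ->
  (forall x, D x -> ~ K x -> f x = 0) ->
  measurable_fun K f -> measurable_fun K f' ->
  {ae mu, forall x, K x -> f x = f' x} ->
  \int[mu]_(x in D) f x = \int[mu]_(x in K) f' x.
Proof.
move=> mK KD f0 mf mf' ff'.
rewrite Rintegral_mkcond.
have -> : f \_ D = f \_ K.
  apply/funext => x; rewrite !patchE.
  have [xK|xK] := boolP (x \in K); first by rewrite (mem_set (KD _ (set_mem xK))).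
  case: ifPn => // xD; apply: f0; first exact: set_mem.
  by move/mem_set; apply/negP.
rewrite -Rintegral_mkcond /Rintegral; congr fine.
apply: ae_eq_integral => //.
- exact/measurable_EFinP.
- exact/measurable_EFinP.
- move: ff' => [N [mN N0 sN]]; exists N; split => // x /= nx; apply: sN => /= nx'.
  by apply: nx => Kx; rewrite /= nx'.
Qed.

(** Clipping both components turns an essentially bounded function into a bounded
    one without changing it almost everywhere. *)
Definition clip (M t : R) : R := Num.max (- M) (Num.min t M).

Lemma clip_id M t : `|t| <= M -> clip M t = t.
Proof.
rewrite ler_norml => /andP[h1 h2]; rewrite /clip min_l// max_r//.
Qed.

Lemma clip_le M t : 0 <= M -> `|clip M t| <= M.
Proof.
move=> M0; rewrite ler_norml /clip le_max lexx /= ge_max; apply/andP; split; first lra.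
by rewrite ge_min lexx orbT.
Qed.

Lemma clip_meas (D : set R) M f : measurable_fun D f ->
  measurable_fun D (fun x => clip M (f x)).
Proof.
move=> mf; apply: measurable_maxr; first exact: measurable_cst.
by apply: measurable_minr => //; exact: measurable_cst.
Qed.

Lemma right_cvg (f : R -> C) (l : C) (x : R) : (f : R -> Cplx R) t @[t --> x^'+] --> (l : Cplx R) ->
  forall e : R, 0 < e -> exists2 s : R, 0 < s & forall t, x < t < x + s -> normc (f t - l) <= e.
Proof.
move=> /cvgrPdist_le fl e e0.
have e0' : 0 < e%:C :> Cplx R by rewrite ltcR.
have := fl _ e0'; rewrite near_withinE => /nbhs_ballP[s /= s0 sP].
exists s => // t /andP[xt ts]; have := sP t; rewrite /ball /= => /(_ _ xt).
rewrite normC_normc lecR normcBC; apply.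
by rewrite ltr_norml; lra.
Qed.
End Reduction.

(** * From distributions to bounded functions *)

Section Boundary.
Variable R : realType.
Local Notation C := R[i].
Local Notation mu := (@lebesgue_measure R).

Lemma cintegral_shrink (D K : set R) (f f' : R -> C) :
  measurable K -> K `<=` D ->
  (forall x, D x -> ~ K x -> f x = 0) ->
  measurable_fun K (fun x => complex.Re (f x)) -> measurable_fun K (fun x => complex.Im (f x)) ->
  measurable_fun K (fun x => complex.Re (f' x)) -> measurable_fun K (fun x => complex.Im (f' x)) ->
  {ae mu, forall x, K x -> f x = f' x} ->
  cintegral D f = ci K f'.
Proof.
move=> mK KD f0 mr mi mr' mi' ff'.
have ae (p : C -> R) : {ae mu, forall x, K x -> p (f x) = p (f' x)}.
  move: ff' => [N [mN N0 sN]]; exists N; split => // x /= nx; apply: sN => /= nx'.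
  by apply: nx => Kx; rewrite nx'.
by congr (_ +i* _); apply: Rintegral_shrink => //; try exact: ae; move=> x Dx nK; rewrite f0.
Qed.

(** The two products are convertible but come from different structures, which
    rewriting distinguishes. *)
Lemma regM (z w : C) : (z : Cplx R) * (w : Cplx R) = z * w :> C.
Proof. by []. Qed.

Lemma testR_test_function (K V : set R) (phi : R -> R) : compact K -> closed K -> K `<=` V ->
  testR K phi -> test_function V (fun x => (phi x)%:C : Cplx R).
Proof.
move=> cptK cK KV [sphi phi0].
have sub : fsupport (fun x => (phi x)%:C : Cplx R) `<=` K.
  rewrite [X in _ `<=` X](closure_id K).1//; apply: closure_subset => x /= px.
  by apply: contrapT => nK; move/eqP: px; apply; rewrite phi0.
split.
- by move=> n x; split; [exact: sphi|exact: smoothR_0].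
- by apply: subclosed_compact cptK sub; exact: closed_closure.
- exact: subset_trans KV.
Qed.

Lemma sin_sector (th : R) : 0 < th < pi / 2 -> exists2 sg : R, 0 < sg &
  forall t, th <= t <= pi - th -> sg <= sin t.
Proof.
move=> /andP[th0 thp]; have le : th <= pi - th by lra.
have cs : {within `[th, pi - th], continuous (@sin R)}.
  by apply: continuous_subspaceT; exact: continuous_sin.
have [t + tP] := EVT_min le cs; rewrite in_itv /= => ht.
exists (sin t); first by apply: sin_gt0_pi; lra.
by move=> u hu; apply: tP; rewrite in_itv.
Qed.
End Boundary.

Theorem corollary1 (R : realType) (a b h : R) (F : Cplx R -> Cplx R)
    (f : (R -> Cplx R) -> Cplx R) (x0 : R) (U : set R) (g : R -> Cplx R)
    (gamma : Cplx R)
    (hab : a < b) (hh : 0 < h)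
    (hF : analytic_on (rectangle a b h) F)
    (hf : distribution `]a, b[ f)
    (hlim : distributional_boundary_value a b F f)
    (hx0 : a < x0 < b)
    (hU : open U) (hUx0 : U x0) (hUab : U `<=` `]a, b[)
    (hg : Linfty U g) (hfg : restriction_given_by f U g)
    (havg : (x - x0)^-1%:C * cintegral `[x0, x] g @[x --> x0^'+] --> gamma) :
  angular_limit F x0 gamma.
Proof.
have [rad rad0 radU] : exists2 rad : R, 0 < rad & forall u, `|u - x0| < rad -> U u.
  have /nbhs_ballP[rad rad0 P] := open_nbhs_nbhs (conj hU hUx0).
  by exists rad => // u hu; apply: P; rewrite /ball /= distrC.
(* The support [K] of the cutoff has the half-width [2 * del], less than [rad]. *)
pose del := rad / 3; have del0 : 0 < del by rewrite divr_gt0.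
pose K : set R := `[x0 - 2 * del, x0 + 2 * del]%classic.
have cd : x0 - 2 * del <= x0 + 2 * del by lra.
have KU : K `<=` U.
  move=> u; rewrite /K /= in_itv /= => hu; apply: radU.
  by rewrite ltr_norml; move: hu; rewrite /del; lra.
have Kab u : x0 - 2 * del <= u <= x0 + 2 * del -> a < u < b.
  move=> hu; have Uu : U u by apply: KU; rewrite /K /= in_itv.
  by have := hUab u Uu; rewrite /= in_itv.
have mK : measurable K by exact: measurable_itv.
have cptK : compact K by exact: segment_compact.
have cK : closed K by exact: interval_closed.
have [mr mi [M gM]] := hg.
have mU : measurable U by exact: open_measurable.
pose g1 (x : R) : R[i] := clip `|M| (complex.Re (g x)) +i* clip `|M| (complex.Im (g x)).
have gE : {ae lebesgue_measure, forall x, U x -> g x = g1 x}.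
  move: gM => [N [mN N0 sN]]; exists N; split => // x /= nx; apply: sN => /= gx.
  apply: nx => Ux; have le := le_trans (gx Ux) (ler_norm M).
  apply: eq_ReIm => /=; rewrite clip_id//; apply: le_trans le.
    exact: Re_le_normc.
  exact: Im_le_normc.
have gEK : {ae lebesgue_measure, forall x, K x -> g x = g1 x}.
  move: gE => [N [mN N0 sN]]; exists N; split => // x /= nx; apply: sN => /= gx.
  by apply: nx => /KU.
have mrK : measurable_fun K (fun x => complex.Re (g x)) by exact: measurable_funS mU KU mr.
have miK : measurable_fun K (fun x => complex.Im (g x)) by exact: measurable_funS mU KU mi.
have bg1 : bounded_meas K g1.
  split => /=; [exact: clip_meas|exact: clip_meas|].
  exists (`|M| + `|M|) => x _; apply: (le_trans (normc_le_ReIm _)).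
  by apply: lerD; exact: clip_le.
(* Reduction to the limit 0. *)
pose g2 x : R[i] := g1 x - gamma.
have bg2 : bounded_meas K g2 by apply: bmB => //; exact: bm_cst.
pose F2 (w : R[i]) : R[i] := F w - gamma.
have dF1 u v : x0 - 2 * del <= u <= x0 + 2 * del -> 0 < v < h -> cdiff F (u +i* v).
  by move=> hu hv; apply: derivable_cdiff; apply: hF; split => //=; exact: Kab.
have dF2 u v : x0 - 2 * del <= u <= x0 + 2 * del -> 0 < v < h -> cdiff F2 (u +i* v).
  by move=> hu hv; apply: cdiffB; [exact: dF1|exact: cdiff_cst].
have Fg2 (phi : R -> R) : testR K phi -> forall e : R, 0 < e ->
    exists2 eta : R, 0 < eta & forall y : R, 0 < y < eta ->
    normc (ci K (fun u => (phi u)%:C * F2 (u +i* y)) -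
           ci K (fun u => (phi u)%:C * g2 u)) <= e.
  move=> tphi e e0; have [sphi phi0] := tphi.
  pose p x : R[i] := (phi x)%:C.
  have p0 x : ~ K x -> p x = 0 by move=> nK; rewrite /p phi0.
  have bphi : bounded_meas K p by exact: smoothR_bm.
  have tab : test_function `]a, b[ p.
    by apply: testR_test_function tphi => //; exact: subset_trans KU hUab.
  have tU : test_function U p by apply: testR_test_function tphi.
  have [s s0 sP] := right_cvg (hlim p tab) e0.
  exists (Num.min h s); first by rewrite lt_min hh s0.
  move=> y /andP[y0]; rewrite lt_min => /andP[yh ys].
  have hy : 0 < y < h by rewrite y0.
  have bF : bounded_meas K (fun u => F (u +i* y)) by exact: (F_bm cd dF1).
  have bpF : bounded_meas K (fun u => p u * F (u +i* y)) by exact: bmM.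
  have bpg : bounded_meas K (fun u => p u * g1 u) by exact: bmM.
  have E1 : cintegral `]a, b[ (fun x => F (x +i* y) * p x) = ci K (fun u => p u * F (u +i* y)).
    have [m1 m2 _] := bpF.
    have [m3 m4 _] := bmM bF bphi.
    apply: cintegral_shrink => //.
    - by move=> x _ nK; rewrite regM p0// mulr0.
    - by apply: aeW => x _; rewrite regM mulrC.
  have E2 : f p = ci K (fun u => p u * g1 u).
    have [m1 m2 _] := bpg; have [p1 p2 _] := bphi.
    rewrite (hfg p tU); apply: cintegral_shrink => //.
    - by move=> x _ nK; rewrite regM p0// mulr0.
    - under eq_fun do rewrite cReM.
      by apply: measurable_funB; exact: measurable_funM.
    - under eq_fun do rewrite cImM.
      by apply: measurable_funD; exact: measurable_funM.
    - move: gEK => [N [mN N0 sN]]; exists N; split => // x /= nx; apply: sN => /= gx.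
      by apply: nx => Kx; rewrite (gx Kx) regM mulrC.
  have bpc : bounded_meas K (fun u => gamma * p u) by apply: bmM => //; exact: bm_cst.
  have -> : ci K (fun u => (phi u)%:C * F2 (u +i* y)) - ci K (fun u => (phi u)%:C * g2 u) =
      ci K (fun u => p u * F (u +i* y)) - ci K (fun u => p u * g1 u).
    have -> : ci K (fun u => (phi u)%:C * F2 (u +i* y)) =
        ci K (fun u => p u * F (u +i* y)) - ci K (fun u => gamma * p u).
      by rewrite -ciB//; apply: ci_eq => u _; rewrite /F2 /p mulrBr [gamma * _]mulrC.
    have -> : ci K (fun u => (phi u)%:C * g2 u) =
        ci K (fun u => p u * g1 u) - ci K (fun u => gamma * p u).
      by rewrite -ciB//; apply: ci_eq => u _; rewrite /g2 /p mulrBr [gamma * _]mulrC.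
    by rewrite opprB addrA subrK.
  rewrite -E1 -E2; apply: sP; rewrite y0 add0r.
  exact: ys.
have avg2 (e : R) : 0 < e -> exists2 s : R, 0 < s &
    forall t, x0 <= t <= x0 + s -> t <= x0 + 2 * del -> normc (ci `[x0, t] g2) <= e * (t - x0).
  move=> e0; have [s s0 sP] := right_cvg havg e0.
  exists (s / 2); first by rewrite divr_gt0.
  move=> t /andP[x0t ts] td; have bt f' : bounded_meas K f' -> bounded_meas `[x0, t] f'.
    by apply: bm_sub; lra.
  have [E|tne] := eqVneq t x0.
    rewrite E ci_point ?Normc.normc0 ?subrr ?mulr0//.
    by rewrite -{2}E; exact: bt.
  have x0t' : x0 < t by rewrite lt_neqAle eq_sym tne.
  have dt : 0 < t - x0 by rewrite subr_gt0.
  have tK : `[x0, t] `<=` K by move=> u; rewrite /K /= !in_itv /=; lra.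
  have E : cintegral `[x0, t] g = ci `[x0, t] g1.
    have [m1 m2 _] := bt _ bg1.
    apply: cintegral_shrink => //.
    - exact: measurable_funS mK tK mrK.
    - exact: measurable_funS mK tK miK.
    - move: gEK => [N [mN N0 sN]]; exists N; split => // x /= nx; apply: sN => /= gx.
      by apply: nx => xt; apply: gx; exact: tK.
  have -> : ci `[x0, t] g2 = (t - x0)%:C * (((t - x0)^-1)%:C * ci `[x0, t] g1 - gamma).
    rewrite /g2 ciB; [|exact: bt|exact: bm_cst].
    rewrite ci_cst; last exact: ltW.
    by rewrite mulrBr mulrA realcM divff ?gt_eqF// mul1r.
  rewrite Normc.normcM normc_real gtr0_norm// [leRHS]mulrC; apply: ler_wpM2l; first exact: ltW.
  by rewrite -E; apply: sP; rewrite x0t' /=; lra.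
move=> th hth; have [sg sg0 sgP] := sin_sector hth.
apply/cvgrPdist_le => e' e'0; have [e e0 ->] := posC e'0.
have [rho rho0 rhoP] := sector_limit del0 hh dF2 bg2 Fg2 avg2 sg0 e0.
rewrite near_withinE; apply/nbhs_ballP; exists (rho%:C : Cplx R); first by rewrite /= ltcR.
move=> z hz [r [t [r0 ht zE]]].
have zr : normc (z - x0%:C) = r.
  have -> : z - x0%:C = r%:C * (cos t +i* sin t) by rewrite zE; apply: eq_ReIm => /=; lra.
  rewrite Normc.normcM normc_real gtr0_norm// normcE2 /= cos2Dsin2 sqrtr1 mulr1.
  by [].
have rrho : r <= rho.
  move: hz; rewrite /ball /= normC_normc ltcR -[_ - z]opprB normcNE zr; exact: ltW.
rewrite normC_normc lecR -[_ - F z]opprB normcNE zE.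
apply: (rhoP _ _ r); first by rewrite r0.
- by rewrite mulrC; apply: ler_wpM2l; [exact: ltW|exact: sgP].
- by rewrite ler_piMr ?(ltW r0)// sin_le1.
- rewrite addrAC subrr add0r normrM gtr0_norm// ler_piMr ?(ltW r0)//; exact: cos_max.
Qed.
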